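(* Let $n\ge 1$, $1\le r\le n$, and let $f(\boldsymbol{z})=\sum_{\boldsymbol{\alpha}\in A}a_{\boldsymbol{\alpha}}\boldsymbol{z}^{\boldsymbol{\alpha}}$ be a Laurent polynomial in $\boldsymbol{z}=(z_1,\ldots,z_n)$, with $A\subset\mathbb{Z}^n$ finite and all $a_{\boldsymbol{\alpha}}\neq 0$, which is nondegenerate for its Newton polyhedron $\Delta_f$. Let $g$ be a Laurent polynomial coprime with $f$. Let $E$ be a connected component of the complement $\mathbb{R}^n\setminus\mathcal{A}_f$ of the amoeba of $f$, and let $F(\boldsymbol{z})=\sum_{\boldsymbol{\alpha}\in\mathbb{Z}^n}c_{\boldsymbol{\alpha}}\boldsymbol{z}^{\boldsymbol{\alpha}}$ be the Laurent expansion of $g/f$ centered at $\boldsymbol{0}$ that converges absolutely in $\Lambda^{-1}(E)$. Let $\boldsymbol{Q}=(\boldsymbol{q}_1,\ldots,\boldsymbol{q}_r)$ be an $r$-tuple of vectors in $\mathbb{Z}^n$ generating an $r$-dimensional saturated sublattice of $\mathbb{Z}^n$, and let $$d_{\boldsymbol{Q}}(\boldsymbol{t})=\sum_{\boldsymbol{k}\in\mathbb{Z}^r}c_{\boldsymbol{q}_1k_1+\cdots+\boldsymbol{q}_rk_r}\,\boldsymbol{t}^{\boldsymbol{k}},\qquad \boldsymbol{t}=(t_1,\ldots,t_r),$$ be the complete $\boldsymbol{Q}$-diagonal of $F$, and let $\mathfrak{T}\subset T^r_{\boldsymbol{t}}$ be its (nonempty, logarithmically convex) domain of convergence. Let $L\subset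 T^r_{\boldsymbol{t}}$ be the set defined below. Then $d_{\boldsymbol{Q}}$ can be analytically continued along any path in $T^r_{\boldsymbol{t}}\setminus L$ starting at a point $\boldsymbol{t}_0\in\mathfrak{T}$.
   Context: $T^m_{\boldsymbol{z}}=(\mathbb{C}\setminus\{0\})^m$ denotes the complex torus, $\boldsymbol{z}^{\boldsymbol{\alpha}}=z_1^{\alpha_1}\cdots z_n^{\alpha_n}$, and $Z^\times(h)$ denotes the zero set of a Laurent polynomial $h$ in the torus. The Newton polyhedron $\Delta_f$ is the convex hull of $A$ in $\mathbb{R}^n$. For a face $\delta$ of $\Delta_f$ (including $\Delta_f$ itself), the truncation $f_\delta$ is $\sum_{\boldsymbol{\alpha}\in A\cap\delta}a_{\boldsymbol{\alpha}}\boldsymbol{z}^{\boldsymbol{\alpha}}$. The polynomial $f$ is nondegenerate for $\Delta_f$ if for every face $\delta$ of $\Delta_f$ the gradient $(\partial f_\delta/\partial z_1,\ldots,\partial f_\delta/\partial z_n)$ does not vanish at any point of $Z^\times(f_\delta)$. The map $\Lambda:T^n_{\boldsymbol{z}}\to\mathbb{R}^n$ is $\Lambda(\boldsymbol{z})=(\log|z_1|,\ldots,\log|z_n|)$, and the amoeba of $f$ is $\mathcal{A}_f=\Lambda(Z^\times(f))$; the connected components $E$ of $\mathbb{R}^n\setminus\mathcal{A}_f$ are convex and correspond bijectively to the Laurent expansions of $g/f$ centered at $\boldsymbol{0}$, $\Lambda^{-1}(E)$ being the domain of absolute convergence of the corresponding expansion. Definition of $L$: write $\boldsymbol{q}_j=(q_j^1,\ldots,q_j^n)$.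 For each face $\delta$ of $\Delta_f$ let $M_\delta(\boldsymbol{z})$ be the $(r+1)\times n$ matrix whose first row is $\left(z_1\frac{\partial f_\delta}{\partial z_1},\ldots,z_n\frac{\partial f_\delta}{\partial z_n}\right)$ and whose $(j+1)$-st row is $(q_j^1,\ldots,q_j^n)$, $j=1,\ldots,r$. Let $L_\delta\subset T^r_{\boldsymbol{t}}$ be the image under the monomial map $\boldsymbol{z}\mapsto(\boldsymbol{z}^{\boldsymbol{q}_1},\ldots,\boldsymbol{z}^{\boldsymbol{q}_r})$ of the set of points $\boldsymbol{p}\in Z^\times(f_\delta)$ at which $\operatorname{rank}M_\delta(\boldsymbol{p})<r+1$. Then $L$ is the union of the sets $L_\delta$ over all faces $\delta$ of $\Delta_f$. *)

(* Defs.v *)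
From HB Require Import structures.
From mathcomp Require Import all_boot all_order all_algebra.
From mathcomp Require Import all_classical all_reals all_analysis.
From mathcomp Require Import complex.
Set Implicit Arguments. Unset Strict Implicit. Unset Printing Implicit Defensive.
Import Order.TTheory GRing.Theory Num.Theory.
Import numFieldTopology.Exports numFieldNormedType.Exports.
Local Open Scope ring_scope.
Local Open Scope classical_set_scope.

Section Defs.
Variable R : realType.
Local Notation C := R[i].

Definition cabs (z : C) : R := Normc.normc z.

Section Sums.
Variable I : eqType.
Definition abs_summable (u : I -> C) : Prop :=
  exists M : R, forall s : seq I, uniq s -> \sum_(i <- s) cabs (u i) <= M.
Definition has_sum (u : I -> C) (l : C) : Prop :=
  forall e : R, 0 < e -> exists s0 : seq I, forall s : seq I,
    uniq s -> {subset s0 <= s} -> cabs (\sum_(i <- s) u i - l) < e.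
Definition abs_sum (u : I -> C) (l : C) : Prop := abs_summable u /\ has_sum u l.
End Sums.

Definition mono n (z : 'rV[C]_n) (al : 'rV[int]_n) : C :=
  \prod_(i < n) (z 0 i) ^ (al 0 i).

Definition torus n : set 'rV[C]_n := [set z | forall i, z 0 i != 0].

Definition lpeval n (A : seq 'rV[int]_n) (a : 'rV[int]_n -> C) (z : 'rV[C]_n) : C :=
  \sum_(al <- A) a al * mono z al.

Definition dlpeval n (A : seq 'rV[int]_n) (a : 'rV[int]_n -> C) (i : 'I_n)
    (z : 'rV[C]_n) : C :=
  \sum_(al <- A) a al * (al 0 i)%:~R * mono z (al - delta_mx 0 i).

Definition is_laurent n (h : 'rV[C]_n -> C) : Prop :=
  exists (A : seq 'rV[int]_n) (a : 'rV[int]_n -> C),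
    forall z, torus z -> h z = lpeval A a z.

(* coprimality in the ring of Laurent polynomials (a Laurent polynomial is
   determined by its values on the torus): every common divisor is a unit *)
Definition lp_coprime n (f g : 'rV[C]_n -> C) : Prop :=
  forall h k1 k2 : 'rV[C]_n -> C,
    is_laurent h -> is_laurent k1 -> is_laurent k2 ->
    (forall z, torus z -> f z = h z * k1 z) ->
    (forall z, torus z -> g z = h z * k2 z) ->
    exists u, is_laurent u /\ forall z, torus z -> h z * u z = 1.

Definition intvec n (al : 'rV[int]_n) : 'rV[R]_n := map_mx (fun k : int => k%:~R) al.

Definition newton n (A : seq 'rV[int]_n) : set 'rV[R]_n :=
  [set x | exists lam : 'I_(size A) -> R,
     [/\ forall i, 0 <= lam i, \sum_i lam i = 1 &
         x = \sum_i lam i *: intvec (nth 0 A i)]].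

Definition is_face n (D d : set 'rV[R]_n) : Prop :=
  [/\ d !=set0, d `<=` D,
      (forall x y (t : R), d x -> d y -> 0 <= t <= 1 -> d ((1 - t) *: x + t *: y)) &
      (forall x y (t : R), D x -> D y -> 0 < t < 1 -> d ((1 - t) *: x + t *: y) ->
         d x /\ d y)].

Definition face_supp n (A : seq 'rV[int]_n) (d : set 'rV[R]_n) : seq 'rV[int]_n :=
  [seq al <- A | `[< d (intvec al) >]].

Definition newton_nondegenerate n (A : seq 'rV[int]_n) (a : 'rV[int]_n -> C) : Prop :=
  forall d, is_face (newton A) d ->
    forall p, torus p -> lpeval (face_supp A d) a p = 0 ->
      ~ (forall i, dlpeval (face_supp A d) a i p = 0).

Definition Lambda n (z : 'rV[C]_n) : 'rV[R]_n := \row_i ln (cabs (z 0 i)).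

Definition amoeba n (A : seq 'rV[int]_n) (a : 'rV[int]_n -> C) : set 'rV[R]_n :=
  [set x | exists z, [/\ torus z, lpeval A a z = 0 & x = Lambda z]].

Definition amoeba_complement_component n (A : seq 'rV[int]_n) (a : 'rV[int]_n -> C)
    (E : set 'rV[R]_n) : Prop :=
  exists x, (~` amoeba A a) x /\ E = connected_component (~` amoeba A a) x.

Definition laurent_expansion n (A : seq 'rV[int]_n) (a : 'rV[int]_n -> C)
    (B : seq 'rV[int]_n) (b : 'rV[int]_n -> C) (E : set 'rV[R]_n)
    (c : 'rV[int]_n -> C) : Prop :=
  forall z, torus z -> E (Lambda z) ->
    abs_sum (fun al => c al * mono z al) (lpeval B b z / lpeval A a z).

Definition saturated_lattice n r (Q : 'M[int]_(r, n)) : Prop :=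
  (forall k : 'rV[int]_r, k *m Q = 0 -> k = 0) /\
  (forall (v : 'rV[int]_n) (m : int), m != 0 ->
     (exists k : 'rV[int]_r, m *: v = k *m Q) -> exists k : 'rV[int]_r, v = k *m Q).

Definition diag_coef n r (c : 'rV[int]_n -> C) (Q : 'M[int]_(r, n)) (k : 'rV[int]_r) : C :=
  c (k *m Q).

Definition polydisc r (w : 'rV[C]_r) (rho : R) : set 'rV[C]_r :=
  [set t | forall j, cabs (t 0 j - w 0 j) < rho].

Definition conv_domain r (d : 'rV[int]_r -> C) : set 'rV[C]_r :=
  [set t | exists e : R, 0 < e /\ forall t', polydisc t e t' ->
     torus t' /\ abs_summable (fun k => d k * mono t' k)].

Definition euler_row n (A : seq 'rV[int]_n) (a : 'rV[int]_n -> C) (z : 'rV[C]_n) :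
  'rV[C]_n := \row_j (z 0 j * dlpeval A a j z).

Definition M_face n r (A : seq 'rV[int]_n) (a : 'rV[int]_n -> C) (Q : 'M[int]_(r, n))
    (d : set 'rV[R]_n) (z : 'rV[C]_n) : 'M[C]_(1 + r, n) :=
  col_mx (euler_row (face_supp A d) a z) (map_mx (fun k : int => k%:~R) Q).

Definition Lset n r (A : seq 'rV[int]_n) (a : 'rV[int]_n -> C) (Q : 'M[int]_(r, n)) :
  set 'rV[C]_r :=
  [set t | exists d, is_face (newton A) d /\
     exists p, [/\ torus p, lpeval (face_supp A d) a p = 0,
                   (\rank (M_face A a Q d p) < r.+1)%N &
                   t = \row_j mono p (row j Q)]].

Definition path_in r (gam : R -> 'rV[C]_r) (S : set 'rV[C]_r) : Prop :=
  (forall s, 0 <= s <= 1 -> S (gam s)) /\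
  (forall s, 0 <= s <= 1 -> forall e : R, 0 < e -> exists del : R, 0 < del /\
     forall s', 0 <= s' <= 1 -> `|s' - s| < del -> polydisc (gam s) e (gam s')).

Definition pmono r (t : 'rV[C]_r) (k : 'rV[nat]_r) : C := \prod_(j < r) (t 0 j) ^+ (k 0 j).

Definition psum_at r (P : 'rV[nat]_r -> C) (w t : 'rV[C]_r) (v : C) : Prop :=
  abs_sum (fun k => P k * pmono (t - w) k) v.

(* The Laurent series sum_k d_k t^k (a function near gam 0) can be analytically
   continued along the path gam : [0,1] -> C^r: there is a continuous family of
   convergent power series (germs) P s centered at gam s, s in [0,1], the first of
   which represents the series near gam 0. *)
Definition continues_along r (d : 'rV[int]_r -> C) (gam : R -> 'rV[C]_r) : Prop :=
  exists (P : R -> 'rV[nat]_r -> C) (rho : R -> R),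
  [/\ (forall s, 0 <= s <= 1 -> 0 < rho s /\
         forall t, polydisc (gam s) (rho s) t ->
           abs_summable (fun k => P s k * pmono (t - gam s) k)),
      (exists e : R, 0 < e /\ forall t, polydisc (gam 0) e t ->
         exists v, psum_at (P 0) (gam 0) t v /\ abs_sum (fun k => d k * mono t k) v) &
      (forall s, 0 <= s <= 1 -> exists del : R, 0 < del /\
         forall s', 0 <= s' <= 1 -> `|s' - s| < del ->
           polydisc (gam s) (rho s) (gam s') /\
           exists e : R, 0 < e /\ forall t, polydisc (gam s') e t ->
             exists v, psum_at (P s) (gam s) t v /\ psum_at (P s') (gam s') t v)].

End Defs.

(* Main.v *)
Require Import Defs.
From HB Require Import structures.
From mathcomp Require Import all_boot all_order all_algebra.
From mathcomp Require Import all_classical all_reals all_analysis.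
From mathcomp Require Import complex.
From mathcomp Require Import zify ring lra.
From mathcomp Require mpoly.
Set Implicit Arguments. Unset Strict Implicit. Unset Printing Implicit Defensive.
Import Order.TTheory GRing.Theory Num.Theory.
Import numFieldTopology.Exports numFieldNormedType.Exports.
Local Open Scope ring_scope.
Local Open Scope classical_set_scope.

(* Write f^-(k+1) as a Laurent series w^(k+1) convergent over the component E (a Neumann series
   for 1 - |f|^2/M on one torus, with Laurent coefficients of geometric decay).  The diagonals
   y_(k,be) of z^be / f^(k+1), be in Z^n, satisfy linear relations coming from multiplication by
   z^(q_j), multiplication by f, and the Leibniz rule, and d_Q is a finite combination of the
   y_(0,be).  The relations keep their shape when Laurent series are replaced by power series
   centered at any point t.  Where t is not in L, some matrix H(t) of Laurent polynomials is
   invertible and the relations give, up to small errors near t, a linear system with matrix H(t)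
   bounding the y_(k,be) by their lower order Taylor coefficients; hence every such family has a
   radius of convergence bounded below near t, and it can be continued along paths outside L.
   The invertibility is a Nullstellensatz: the obstruction is a point lam of (C^N, t) killed by
   the binomials and the logarithmic derivatives, its support is a face of the Newton polyhedron,
   lam extends to a character of Z^n, i.e. to a point p of the torus, and p shows that t is in L.

   It remains to see that d_Q near t0 is part of such a family.  This is clear near the image of
   the torus over E; one moves from there to t0 along a curve (t0_j xi^(m_j))_j avoiding the
   finitely many xi where det H vanishes, and on which d_Q converges by logarithmic convexity. *)

(** * Moduli and unordered sums *)

(** Applying t_j d/dt_j to y_(k,be) produces members y_(k+1,be+al_i) of the next level, so the
    relations do not by themselves form a finite differential system. Off L, words of some length
    K+1 in the exponents al_i can be rewritten through words of length K. The words of length at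
    most K, a finite set, then suffice: the Leibniz rule bounds their coefficients of degree S+1 by
    those of degree S, and since the factor l_j + 1 created by differentiation outgrows every fixed
    constant, one bound propagates to all degrees. No particular family is singled out, so the
    radius obtained depends on the point alone; this is why germs of whole families, and not of d_Q
    only, are moved along a path. The start needs separate care because at t0 only the combination
    d_Q is known to converge, not the individual y_(k,be). These are moved to t0 by the same
    estimate, and the equality between their combination and the germ of d_Q is carried along as a
    property of the moving germ. *)

Section Cabs.
Variable R : realType.
Implicit Types z : R[i].

Lemma cabsE z : (cabs z)%:C%C = `|z|. Proof. by case: z => a b; rewrite normc_def. Qed.
Lemma cabs_ge0 z : 0 <= cabs z.
Proof. by rewrite -(@ler0c R) cabsE. Qed.
Lemma cabs0 : cabs 0 = 0 :> R. Proof. exact: Normc.normc0. Qed.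
Lemma cabs1 : cabs 1 = 1 :> R. Proof. exact: Normc.normc1. Qed.
Lemma cabsM z z' : cabs (z * z') = cabs z * cabs z'. Proof. exact: Normc.normcM. Qed.
Lemma cabsV z : cabs z^-1 = (cabs z)^-1. Proof. exact: Normc.normcV. Qed.
Lemma cabsN z : cabs (- z) = cabs z. Proof. exact: normcN. Qed.
Lemma ler_cabsD z z' : cabs (z + z') <= cabs z + cabs z'. Proof. exact: le_normcD. Qed.
Lemma cabs_eq0 z : (cabs z == 0) = (z == 0).
Proof. by rewrite -(@normr_eq0 R[i]) -cabsE; apply/eqP/eqP => [->//|[]]. Qed.
End Cabs.

Section CabsMore.
Variable R : realType.
Implicit Types z : R[i].

Lemma cabsX z k : cabs (z ^+ k) = cabs z ^+ k.
Proof. by elim: k => [|k IH]; rewrite ?expr0 ?cabs1// !exprS cabsM IH. Qed.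

Lemma cabsXz z (k : int) : cabs (z ^ k) = cabs z ^ k.
Proof. by case: k => k; rewrite ?NegzE -?exprnN -?exprnP ?cabsV cabsX. Qed.

Lemma cabs_real (x : R) : cabs x%:C%C = `|x|.
Proof. by rewrite /cabs /Normc.normc /= expr0n addr0 sqrtr_sqr. Qed.

Lemma cabs_gt0 z : (0 < cabs z) = (z != 0).
Proof. by rewrite lt0r cabs_eq0 cabs_ge0 andbT. Qed.

Lemma cabs_sum (I : Type) (s : seq I) (P : pred I) (u : I -> R[i]) :
  cabs (\sum_(i <- s | P i) u i) <= \sum_(i <- s | P i) cabs (u i).
Proof.
elim/big_rec2: _ => [|i x y _ h]; first by rewrite cabs0.
by apply: (le_trans (ler_cabsD _ _)); rewrite lerD2l.
Qed.

Lemma cabs_prod (I : Type) (s : seq I) (P : pred I) (u : I -> R[i]) :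
  cabs (\prod_(i <- s | P i) u i) = \prod_(i <- s | P i) cabs (u i).
Proof.
by elim/big_rec2: _ => [|i x y _ h]; rewrite ?cabs1 // cabsM h.
Qed.

Lemma cabsB z z' : cabs (z - z') = cabs (z' - z).
Proof. by rewrite -cabsN opprB. Qed.

Lemma ler_cabsB z z' : cabs z - cabs z' <= cabs (z - z').
Proof. by rewrite lerBlDr -{1}(subrK z' z) ler_cabsD. Qed.

Lemma cabs_le0P z : (forall e : R, 0 < e -> cabs z < e) -> z = 0.
Proof.
move=> h; apply/eqP; rewrite -cabs_eq0; apply/negPn/negP => h0.
have h1 : 0 < cabs z by rewrite cabs_gt0 -cabs_eq0.
by have := h _ h1; rewrite ltxx.
Qed.
End CabsMore.

Section Sums.
Variable R : realType.
Local Notation C := R[i].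

Section One.
Variable I : eqType.
Implicit Types (u v : I -> C) (w : I -> R) (s : seq I).

Lemma ler_sum_uniq w s s' : (forall i, 0 <= w i) -> uniq s -> {subset s <= s'} ->
  \sum_(i <- s) w i <= \sum_(i <- s') w i.
Proof.
move=> w0; elim: s s' => [|i s IH] s' /=; first by rewrite big_nil sumr_ge0.
case/andP => ins us sub; have i_s' : i \in s' by apply: sub; rewrite inE eqxx.
rewrite (perm_big _ (perm_to_rem i_s')) !big_cons lerD2l; apply: IH => // j js.
have jni : j != i by apply: contraNneq ins => <-.
have : j \in s' by apply: sub; rewrite inE js orbT.
by rewrite (perm_mem (perm_to_rem i_s')) inE (negbTE jni).
Qed.

Lemma abs_summable_le (K : R) u v : 0 <= K -> (forall i, cabs (u i) <= K * cabs (v i)) ->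
  abs_summable v -> abs_summable u.
Proof.
move=> K0 h [M hM]; exists (K * M) => s us.
apply: (le_trans (ler_sum _ (fun i _ => h i))); rewrite -mulr_sumr.
by rewrite ler_wpM2l // hM.
Qed.

Lemma abs_summable_le1 u v : (forall i, cabs (u i) <= cabs (v i)) ->
  abs_summable v -> abs_summable u.
Proof. by move=> h; apply: (abs_summable_le (K := 1)) => // i; rewrite mul1r. Qed.

Lemma abs_summableD u v : abs_summable u -> abs_summable v -> abs_summable (fun i => u i + v i).
Proof.
move=> [M hM] [M' hM']; exists (M + M') => s us.
apply: (le_trans (ler_sum _ (fun i _ => ler_cabsD _ _))).
by rewrite big_split /= lerD // ?hM ?hM'.
Qed.

Lemma abs_summableZ k u : abs_summable u -> abs_summable (fun i => k * u i).
Proof.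
by apply: (abs_summable_le (K := cabs k)); rewrite ?cabs_ge0 // => i; rewrite cabsM.
Qed.

Lemma abs_summable0 : abs_summable (fun _ : I => 0 : C).
Proof. by exists 0 => s _; rewrite big1 // => i _; rewrite cabs0. Qed.

Lemma abs_summable_sum (J : Type) (r : seq J) (P : pred J) (u : J -> I -> C) :
  (forall j, P j -> abs_summable (u j)) -> abs_summable (fun i => \sum_(j <- r | P j) u j i).
Proof.
move=> h; elim: r => [|j r IH].
  by under eq_fun do rewrite big_nil; exact: abs_summable0.
under eq_fun do rewrite big_cons.
by case Pj: (P j) => //; apply: abs_summableD => //; exact: h.
Qed.

(** Real-valued counterpart of [has_sum]. Completeness enters through suprema of real partial sums;
    complex sums are assembled from real and imaginary parts. *)
Definition rsum w (l : R) : Prop :=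
  forall e : R, 0 < e -> exists s0, forall s, uniq s -> {subset s0 <= s} ->
    `|\sum_(i <- s) w i - l| < e.

Lemma rsum_ge0 w (M : R) : (forall i, 0 <= w i) -> (forall s, uniq s -> \sum_(i <- s) w i <= M) ->
  exists l, rsum w l.
Proof.
move=> w0 hM; pose S := [set x | exists2 s, uniq s & x = \sum_(i <- s) w i].
have hS : has_sup S.
  split; first by exists 0; exists [::] => //; rewrite big_nil.
  by exists M => x [s us ->]; exact: hM.
exists (sup S) => e e0.
have [x [s0 us0 ->] hx] := sup_adherent e0 hS.
exists s0 => s us sub.
have h1 := ler_sum_uniq w0 us0 sub.
have h2 : \sum_(i <- s) w i <= sup S by apply: ub_le_sup; [exact: hS.2|exists s].
by rewrite ler0_norm ?subr_le0 // opprB ltrBlDl -ltrBlDr (lt_le_trans hx).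
Qed.

Lemma rsum_abs w (M : R) : (forall s, uniq s -> \sum_(i <- s) `|w i| <= M) -> exists l, rsum w l.
Proof.
move=> hM.
have [l1 h1] := rsum_ge0 (fun i => normr_ge0 (w i)) hM.
(* [w] is the difference of the nonnegative families |w| + w and |w|. *)
have [||l2 h2] := @rsum_ge0 (fun i => `|w i| + w i) (M + M).
- by move=> i; rewrite addrC -lerBlDr sub0r; have := ler_norm (- w i); rewrite normrN; lra.
- move=> s us; rewrite big_split /= lerD ?hM //.
  by apply: le_trans (hM s us); apply: ler_sum => i _; rewrite ler_norm.
exists (l2 - l1) => e e0; have e2 : 0 < e / 2 by rewrite divr_gt0.
have [s1 hs1] := h1 _ e2; have [s2 hs2] := h2 _ e2.
exists (s1 ++ s2) => s us sub.
have {hs1} : `|\sum_(i <- s) `|w i| - l1| < e / 2.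
  by apply: hs1 => // i hi; apply: sub; rewrite mem_cat hi.
have {hs2} : `|\sum_(i <- s) (`|w i| + w i) - l2| < e / 2.
  by apply: hs2 => // i hi; apply: sub; rewrite mem_cat hi orbT.
rewrite big_split /= => a1 a2.
rewrite [e]splitr; apply: le_lt_trans (ltrD a1 a2).
rewrite -[X in _ <= _ + X]normrN; apply: le_trans _ (ler_normD _ _).
by rewrite le_eqVlt; apply/orP; left; apply/eqP; congr `|_|; ring.
Qed.

Lemma cabs_le_ReIm z : cabs (z : C) <= `|complex.Re z| + `|complex.Im z|.
Proof.
case: z => a b; rewrite /cabs /= -[leRHS]ger0_norm ?addr_ge0 // -sqrtr_sqr ler_sqrt ?sqr_ge0 //.
rewrite sqrrD !real_normK ?num_real // lerD2r lerDl.
by rewrite mulrn_wge0 ?mulr_ge0.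
Qed.

Lemma Re_le_cabs z : `|complex.Re z| <= cabs (z : C).
Proof.
case: z => a b /=; rewrite /cabs /= -(sqrtr_sqr a) ler_sqrt ?addr_ge0 ?sqr_ge0 //.
by rewrite lerDl sqr_ge0.
Qed.

Lemma Im_le_cabs z : `|complex.Im z| <= cabs (z : C).
Proof.
case: z => a b /=; rewrite /cabs /= -(sqrtr_sqr b) ler_sqrt ?addr_ge0 ?sqr_ge0 //.
by rewrite lerDr sqr_ge0.
Qed.

Lemma has_sum_ex u : abs_summable u -> exists l, has_sum u l.
Proof.
move=> [M hM].
have [|a ha] := @rsum_abs (fun i => complex.Re (u i)) M.
  by move=> s us; apply: le_trans (hM s us); apply: ler_sum => i _; exact: Re_le_cabs.
have [|b hb] := @rsum_abs (fun i => complex.Im (u i)) M.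
  by move=> s us; apply: le_trans (hM s us); apply: ler_sum => i _; exact: Im_le_cabs.
exists (a +i* b)%C => e e0; have e2 : 0 < e / 2 by rewrite divr_gt0.
have [s1 hs1] := ha _ e2; have [s2 hs2] := hb _ e2.
exists (s1 ++ s2) => s us sub.
apply: (le_lt_trans (cabs_le_ReIm _)); rewrite [e]splitr; apply: ltrD.
  rewrite raddfB raddf_sum /=; apply: hs1 => // i hi; apply: sub; by rewrite mem_cat hi.
rewrite raddfB raddf_sum /=; apply: hs2 => // i hi; apply: sub; by rewrite mem_cat hi orbT.
Qed.

Lemma has_sum_unique u l l' : has_sum u l -> has_sum u l' -> l = l'.
Proof.
move=> h h'; apply/eqP; rewrite -subr_eq0; apply/eqP/cabs_le0P => e e0.
have e2 : 0 < e / 2 by rewrite divr_gt0.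
have [s1 hs1] := h _ e2; have [s2 hs2] := h' _ e2.
pose s := undup (s1 ++ s2).
have {}hs1 : cabs (\sum_(i <- s) u i - l) < e / 2.
  by apply: hs1; rewrite ?undup_uniq // => i hi; rewrite mem_undup mem_cat hi.
have {}hs2 : cabs (\sum_(i <- s) u i - l') < e / 2.
  by apply: hs2; rewrite ?undup_uniq // => i hi; rewrite mem_undup mem_cat hi orbT.
rewrite [e]splitr; apply: le_lt_trans (ltrD hs1 hs2).
rewrite -[X in _ <= X + _]cabsN; apply: le_trans (ler_cabsD _ _).
by rewrite le_eqVlt; apply/orP; left; apply/eqP; congr cabs; ring.
Qed.

Lemma has_sumD u v a b : has_sum u a -> has_sum v b -> has_sum (fun i => u i + v i) (a + b).
Proof.
move=> h h' e e0; have e2 : 0 < e / 2 by rewrite divr_gt0.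
have [s1 hs1] := h _ e2; have [s2 hs2] := h' _ e2.
exists (s1 ++ s2) => s us sub.
have {}hs1 : cabs (\sum_(i <- s) u i - a) < e / 2.
  by apply: hs1 => // i hi; apply: sub; rewrite mem_cat hi.
have {}hs2 : cabs (\sum_(i <- s) v i - b) < e / 2.
  by apply: hs2 => // i hi; apply: sub; rewrite mem_cat hi orbT.
rewrite [e]splitr; apply: le_lt_trans (ltrD hs1 hs2).
apply: le_trans (ler_cabsD _ _); rewrite big_split /=.
by rewrite le_eqVlt; apply/orP; left; apply/eqP; congr cabs; ring.
Qed.

Lemma has_sumZ k u a : has_sum u a -> has_sum (fun i => k * u i) (k * a).
Proof.
move=> h e e0; have [->|k0] := eqVneq k 0.
  by exists [::] => s _ _; rewrite big1 ?mul0r ?subr0 ?cabs0 // => i _; rewrite mul0r.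
have kp : 0 < cabs k by rewrite cabs_gt0.
have [s1 hs1] := h _ (divr_gt0 e0 kp).
exists s1 => s us sub; rewrite -mulr_sumr -mulrBr cabsM mulrC -ltr_pdivlMr //.
exact: hs1.
Qed.

Lemma has_sum_supp u s0 : uniq s0 -> (forall i, i \notin s0 -> u i = 0) ->
  has_sum u (\sum_(i <- s0) u i).
Proof.
move=> us0 h e e0; exists s0 => s us sub.
suff -> : \sum_(i <- s) u i = \sum_(i <- s0) u i by rewrite subrr cabs0.
rewrite (bigID (mem s0)) /= [X in _ + X]big1 ?addr0 => [|i]; last exact: h.
rewrite -big_filter; apply: perm_big; apply: uniq_perm; rewrite ?filter_uniq // => i.
by rewrite mem_filter; case: (boolP (i \in s0)) => //= /sub.
Qed.

Lemma abs_sum_supp u s0 : uniq s0 -> (forall i, i \notin s0 -> u i = 0) ->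
  abs_sum u (\sum_(i <- s0) u i).
Proof.
move=> us0 h; split; last exact: has_sum_supp.
exists (\sum_(i <- s0) cabs (u i)) => s us.
rewrite (bigID (mem s0)) /= [X in _ + X]big1 ?addr0 => [|i /h ->]; last by rewrite cabs0.
rewrite -big_filter; apply: ler_sum_uniq => [i||i]; rewrite ?cabs_ge0 ?filter_uniq //.
by rewrite mem_filter => /andP[].
Qed.

Lemma has_sum_le u l (M : R) : has_sum u l -> (forall s, uniq s -> \sum_(i <- s) cabs (u i) <= M) ->
  cabs l <= M.
Proof.
move=> h hM; apply/ler_addgt0Pr => e e0.
have [s0 hs0] := h _ e0; pose s := undup s0.
have {hs0} : cabs (\sum_(i <- s) u i - l) < e.
  by apply: hs0; rewrite ?undup_uniq // => i hi; rewrite mem_undup.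
rewrite cabsB => h1; have := ler_cabsB l (\sum_(i <- s) u i).
have := le_trans (cabs_sum s xpredT u) (hM s (undup_uniq _)); lra.
Qed.

(** The value is 0 when [u] has no sum, so an equation about [csum] is informative only next to a
    summability statement. *)
Definition csum u : C := xget 0 [set l | has_sum u l].

Lemma abs_sumE u l : abs_sum u l -> csum u = l.
Proof.
move=> [_ h]; rewrite /csum; case: xgetP => [x -> /= hx|]; first exact: has_sum_unique hx h.
by move=> /(_ l).
Qed.

Lemma csumP u : abs_summable u -> abs_sum u (csum u).
Proof.
move=> h; split => //; have [l hl] := has_sum_ex h.
by rewrite (abs_sumE (conj h hl)).
Qed.

Lemma abs_sumD u v a b : abs_sum u a -> abs_sum v b -> abs_sum (fun i => u i + v i) (a + b).
Proof. by move=> [h1 h2] [h3 h4]; split; [exact: abs_summableD|exact: has_sumD]. Qed.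

Lemma abs_sumZ k u a : abs_sum u a -> abs_sum (fun i => k * u i) (k * a).
Proof. by move=> [h1 h2]; split; [exact: abs_summableZ|exact: has_sumZ]. Qed.

Lemma abs_sumN u a : abs_sum u a -> abs_sum (fun i => - u i) (- a).
Proof. by move=> /(abs_sumZ (-1)); rewrite mulN1r; under eq_fun do rewrite mulN1r. Qed.

Lemma abs_sumB u v a b : abs_sum u a -> abs_sum v b -> abs_sum (fun i => u i - v i) (a - b).
Proof. by move=> hu /abs_sumN; exact: abs_sumD. Qed.

Lemma abs_sum0 : abs_sum (fun _ : I => 0 : C) 0.
Proof. by have := @abs_sum_supp (fun=> 0) [::] isT (fun _ _ => erefl); rewrite big_nil. Qed.

Lemma abs_sum_sum (J : Type) (r : seq J) (P : pred J) (u : J -> I -> C) (a : J -> C) :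
  (forall j, P j -> abs_sum (u j) (a j)) ->
  abs_sum (fun i => \sum_(j <- r | P j) u j i) (\sum_(j <- r | P j) a j).
Proof.
move=> h; elim: r => [|j r IH].
  by rewrite big_nil; under eq_fun do rewrite big_nil; exact: abs_sum0.
rewrite big_cons; under eq_fun do rewrite big_cons.
by case Pj: (P j) => //; apply: abs_sumD => //; exact: h.
Qed.

Lemma abs_sum1 (i0 : I) (a : C) : abs_sum (fun i => if i == i0 then a else 0) a.
Proof.
have := @abs_sum_supp (fun i => if i == i0 then a else 0) [:: i0] isT.
rewrite big_seq1 eqxx; apply => i; by rewrite inE => /negbTE ->.
Qed.

Lemma csumZ k u : abs_summable u -> csum (fun i => k * u i) = k * csum u.
Proof. by move=> hu; apply: abs_sumE; apply: abs_sumZ; exact: csumP. Qed.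

Lemma csum_sum (J : Type) (r : seq J) (P : pred J) (u : J -> I -> C) :
  (forall j, P j -> abs_summable (u j)) ->
  csum (fun i => \sum_(j <- r | P j) u j i) = \sum_(j <- r | P j) csum (u j).
Proof. by move=> h; apply: abs_sumE; apply: abs_sum_sum => j Pj; exact: csumP (h j Pj). Qed.

Lemma csum_le u (M : R) : (forall s, uniq s -> \sum_(i <- s) cabs (u i) <= M) -> cabs (csum u) <= M.
Proof.
move=> h; have hu : abs_summable u by exists M.
exact: has_sum_le (csumP hu).2 h.
Qed.
End One.

Lemma abs_summable_inj (I J : eqType) (h : J -> I) (u : I -> C) :
  injective h -> abs_summable u -> abs_summable (u \o h).
Proof.
move=> hi [M hM]; exists M => s us.
by rewrite -(big_map h xpredT (fun i => cabs (u i))) hM ?map_inj_uniq.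
Qed.

(** The image of [h] only has to contain the support of [u], so this also discards vanishing terms,
    as when a series over Z^r supported in N^r becomes a power series. *)
Lemma abs_sum_inj (I J : eqType) (h : J -> I) (u : I -> C) l :
  injective h -> (forall i, u i != 0 -> exists j, h j = i) -> abs_sum u l -> abs_sum (u \o h) l.
Proof.
move=> hi hs [h1 h2]; split; first exact: abs_summable_inj.
move=> e e0; have [s0 hs0] := h2 _ e0.
have [t0 ht0] : exists t0 : seq J, forall i, i \in s0 -> u i != 0 -> exists2 j, j \in t0 & h j = i.
  elim: s0 {hs0} => [|i s0 [t0 IH]]; first by exists [::].
  have [ui|ui] := boolP (u i != 0).
    have [j hj] := hs i ui; exists (j :: t0) => i'; rewrite inE => /orP[/eqP-> _|h' h''].
      by exists j => //; rewrite inE eqxx.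
    by have [j' a b] := IH _ h' h''; exists j' => //; rewrite inE a orbT.
  exists t0 => i'; rewrite inE => /orP[/eqP->|]; [by rewrite (negbTE ui)|exact: IH].
exists t0 => s us sub.
(* Members of [s0] not reached from [s] are added so that the convergence of [u] applies; they
   contribute 0, because the nonzero ones have their preimage in [s]. *)
pose s1 := map h s ++ [seq i <- undup s0 | i \notin map h s].
have us1 : uniq s1.
  rewrite cat_uniq map_inj_uniq // us filter_uniq ?undup_uniq // andbT.
  by apply/hasPn => i /=; rewrite mem_filter => /andP[].
have sub1 : {subset s0 <= s1}.
  by move=> i hi0; rewrite mem_cat mem_filter mem_undup hi0 andbT; exact: orbN.
have := hs0 s1 us1 sub1; rewrite big_cat /= big_map big_filter.
suff -> : \sum_(i <- undup s0 | i \notin [seq h i | i <- s]) u i = 0 by rewrite addr0.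
rewrite big_seq_cond big1 // => i; rewrite mem_undup => /andP[i0 ni].
apply/eqP/negPn/negP => ui; have [j jt hj] := ht0 i i0 ui.
by move/negP: ni; apply; rewrite -hj map_f // sub.
Qed.

Lemma mulrn_div_le (e : R) (k : nat) : 0 <= e -> (e / k.+1%:R) *+ k <= e.
Proof.
move=> e0; have h : e = (e / k.+1%:R) *+ k.+1 by rewrite -mulr_natr divfK ?pnatr_eq0.
have : 0 <= e / k.+1%:R by rewrite divr_ge0.
move=> x0; rewrite [leRHS]h; move: (e / _) x0 => x x0.
by rewrite [leRHS]mulrSr lerDl.
Qed.

Section Pairs.
Variables I J : eqType.
Implicit Types u : I * J -> C.

Lemma abs_summable_fst u i : abs_summable u -> abs_summable (fun j => u (i, j)).
Proof. by apply: (@abs_summable_inj _ _ (fun j => (i, j))) => a b []. Qed.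
Lemma abs_summable_snd u j : abs_summable u -> abs_summable (fun i => u (i, j)).
Proof. by apply: (@abs_summable_inj _ _ (fun i => (i, j))) => a b []. Qed.

Lemma abs_summable_pair u (M : I -> R) (N : R) :
  (forall i s, uniq s -> \sum_(j <- s) cabs (u (i, j)) <= M i) ->
  (forall s, uniq s -> \sum_(i <- s) M i <= N) -> abs_summable u.
Proof.
move=> h1 h2; exists N => s us.
pose sI := undup (map fst s); pose sJ := undup (map snd s).
apply: le_trans (h2 sI (undup_uniq _)).
apply: le_trans (_ : \sum_(p <- [seq (i, j) | i <- sI, j <- sJ]) cabs (u p) <= _).
  apply: ler_sum_uniq => [p||[i j] hp] //; first exact: cabs_ge0.
  apply/allpairsP; exists (i, j); rewrite !mem_undup; split => //.
    by apply/mapP; exists (i, j).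
  by apply/mapP; exists (i, j).
rewrite big_allpairs; apply: ler_sum => i _; exact: h1 (undup_uniq _).
Qed.

Lemma fubini_sum u l : abs_sum u l -> abs_sum (fun i => csum (fun j => u (i, j))) l.
Proof.
move=> [hs hl]; have hu i := abs_summable_fst i hs; split.
  case: hs => M hM; exists M => s us.
  apply/ler_addgt0Pr => e e0.
  (* One finite set of columns approximates all row sums at once. The error is shared among the
     rows, and [.+1] keeps the denominator nonzero when [s] is empty. *)
  have [sJ [usJ hsJ]] : exists sJ : seq J, uniq sJ /\
      forall i, i \in s -> cabs (csum (fun j => u (i, j)) - \sum_(j <- sJ) u (i, j)) <= e / (size s).+1%:R.
    elim: s us => [|i s IH] us; first by exists [::].
    have d0 : 0 < e / (size (i :: s)).+1%:R by rewrite divr_gt0.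
    suff [sJ hsJ] : exists sJ : seq J, forall sJ', uniq sJ' -> {subset sJ <= sJ'} ->
        forall i', i' \in i :: s -> cabs (csum (fun j => u (i', j)) - \sum_(j <- sJ') u (i', j)) <= e / (size (i :: s)).+1%:R.
      exists (undup sJ); split; rewrite ?undup_uniq // => i' hi'.
      by apply: hsJ => //; rewrite ?undup_uniq // => j; rewrite mem_undup.
    move: (e / _) d0 => d d0; elim: (i :: s) => [|i' s' [sJ' IH']]; first by exists [::].
    have [s0 hs0] := (csumP (hu i')).2 _ d0.
    exists (s0 ++ sJ') => s1 us1 sub i1; rewrite inE => /orP[/eqP->|h].
      rewrite cabsB; apply: ltW; apply: hs0 => // j hj; apply: sub; by rewrite mem_cat hj.
    by apply: IH' => // j hj; apply: sub; rewrite mem_cat hj orbT.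
  have h1 : \sum_(i <- s) cabs (csum (fun j => u (i, j))) <=
      \sum_(i <- s) (cabs (\sum_(j <- sJ) u (i, j)) + e / (size s).+1%:R).
    rewrite big_seq [X in _ <= X]big_seq; apply: ler_sum => i hi.
    rewrite -lerBlDl; apply: le_trans (hsJ i hi); exact: ler_cabsB.
  apply: (le_trans h1); rewrite big_split /=; apply: lerD.
    apply: le_trans (ler_sum _ (fun i _ => cabs_sum _ _ _)) _.
    have := hM [seq (i, j) | i <- s, j <- sJ]; rewrite big_allpairs; apply.
    by apply: allpairs_uniq => // -[a b] [c d].
  rewrite big_const_seq count_predT iter_addr addr0; exact: mulrn_div_le (ltW e0).
move=> e e0; have e2 : 0 < e / 2 by rewrite divr_gt0.
have [s0 hs0] := hl _ e2.
exists (map fst s0) => s us sub.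
have e4 : 0 < e / 2 / (size s).+1%:R by rewrite divr_gt0.
have [sJ hsJ] : exists sJ : seq J, forall sJ', uniq sJ' -> {subset sJ <= sJ'} ->
     forall i', i' \in s -> cabs (csum (fun j => u (i', j)) - \sum_(j <- sJ') u (i', j)) <= e / 2 / (size s).+1%:R.
  move: (e / 2 / _) e4 => d d0; elim: {us sub} s => [|i' s' [sJ' IH']]; first by exists [::].
  have [s1 hs1] := (csumP (hu i')).2 _ d0.
  exists (s1 ++ sJ') => s2 us1 sub i1; rewrite inE => /orP[/eqP->|h].
    rewrite cabsB; apply: ltW; apply: hs1 => // j hj; apply: sub; by rewrite mem_cat hj.
  by apply: IH' => // j hj; apply: sub; rewrite mem_cat hj orbT.
pose sJ' := undup (sJ ++ map snd s0).
have sJsub : {subset sJ <= sJ'} by move=> j hj; rewrite mem_undup mem_cat hj.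
have {}hsJ := hsJ sJ' (undup_uniq _) sJsub.
have h1 : cabs (\sum_(i <- s) \sum_(j <- sJ') u (i, j) - l) < e / 2.
  have := hs0 [seq (i, j) | i <- s, j <- sJ']; rewrite big_allpairs; apply.
    by apply: allpairs_uniq; rewrite ?undup_uniq // => -[a b] [c d].
  move=> [i j] hp; apply/allpairsP; exists (i, j); split => //=.
    by apply: sub; apply/mapP; exists (i, j).
  by rewrite mem_undup mem_cat; apply/orP; right; apply/mapP; exists (i, j).
have h2 : cabs (\sum_(i <- s) (csum (fun j => u (i, j)) - \sum_(j <- sJ') u (i, j))) <= e / 2.
  apply: le_trans (cabs_sum _ _ _) _.
  apply: le_trans (_ : \sum_(i <- s) (e / 2 / (size s).+1%:R) <= _).
    by rewrite big_seq [X in _ <= X]big_seq; apply: ler_sum.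
  rewrite big_const_seq count_predT iter_addr addr0; exact: mulrn_div_le (ltW e2).
rewrite [e]splitr; apply: le_lt_trans (ler_ltD h2 h1).
apply: le_trans (ler_cabsD _ _); rewrite sumrB.
by rewrite le_eqVlt; apply/orP; left; apply/eqP; congr cabs; ring.
Qed.
End Pairs.

Lemma abs_summable_swap (I J : eqType) (u : I * J -> C) :
  abs_summable u -> abs_summable (fun p : J * I => u (p.2, p.1)).
Proof. by apply: (@abs_summable_inj _ _ (fun p : J * I => (p.2, p.1))) => -[a b] [c d] [-> ->]. Qed.

Lemma fubini_swap (I J : eqType) (u : I -> J -> C) :
  abs_summable (fun p => u p.1 p.2) ->
  [/\ abs_summable (fun i => csum (u i)),
      abs_summable (fun j => csum (u^~ j)) &
      csum (fun i => csum (u i)) = csum (fun j => csum (u^~ j))].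
Proof.
move=> h; have h' := abs_summable_swap h.
have f1 := fubini_sum (csumP h); have f2 := fubini_sum (csumP h').
split; [exact: f1.1|exact: f2.1|].
rewrite (abs_sumE f1) (abs_sumE f2); apply: esym; apply: abs_sumE.
apply: (@abs_sum_inj _ _ (fun p : J * I => (p.2, p.1)) (fun p => u p.1 p.2)).
- by move=> -[a b] [c d] [-> ->].
- by move=> [i j] _; exists (j, i).
- exact: csumP.
Qed.

Lemma abs_sum_mul (I J : eqType) (u : I -> C) (v : J -> C) a b :
  abs_sum u a -> abs_sum v b -> abs_sum (fun p : I * J => u p.1 * v p.2) (a * b).
Proof.
move=> [[M hM] hu] [[N hN] hv].
have hs : abs_summable (fun p : I * J => u p.1 * v p.2).
  apply: (@abs_summable_pair _ _ _ (fun i => cabs (u i) * N) (M * N)) => [i s us|s us].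
    under eq_bigr do rewrite cabsM.
    by rewrite /= -mulr_sumr ler_wpM2l ?cabs_ge0 ?hN.
  rewrite -mulr_suml ler_wpM2r ?hM //.
  by have := hN [::] isT; rewrite big_nil.
have := fubini_sum (csumP hs) => /=.
have hb : abs_summable v by exists N.
under eq_fun do rewrite csumZ // (abs_sumE (conj hb hv)) mulrC.
move/abs_sumE; have hu' : abs_summable u by exists M.
rewrite csumZ // (abs_sumE (conj hu' hu)) mulrC => ->; exact: csumP.
Qed.
End Sums.

(** * Laurent monomials and series *)

Section Mono.
Variable R : realType.
Local Notation C := R[i].
Variable n : nat.
Implicit Types (z : 'rV[C]_n) (al be : 'rV[int]_n).

Lemma mono0 z : mono z 0 = 1.
Proof. by rewrite /mono big1 // => i _; rewrite mxE expr0z. Qed.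

Lemma monoD z al be : torus z -> mono z (al + be) = mono z al * mono z be.
Proof.
by move=> hz; rewrite /mono -big_split /=; apply: eq_bigr => i _; rewrite mxE expfzDr.
Qed.

Lemma mono_neq0 z al : torus z -> mono z al != 0.
Proof. by move=> hz; apply/prodf_neq0 => i _; rewrite expfz_neq0. Qed.

Lemma monoN z al : torus z -> mono z (- al) = (mono z al)^-1.
Proof.
move=> hz; apply: (mulfI (mono_neq0 al hz)).
by rewrite -monoD // subrr mono0 divff // mono_neq0.
Qed.

Lemma monoB z al be : torus z -> mono z (al - be) = mono z al / mono z be.
Proof. by move=> hz; rewrite monoD // monoN. Qed.

Lemma cabs_mono z al : cabs (mono z al) = \prod_j cabs (z 0 j) ^ al 0 j.
Proof. by rewrite /mono cabs_prod; apply: eq_bigr => i _; rewrite cabsXz. Qed.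

Lemma cabs_mono_gt0 z al : torus z -> 0 < cabs (mono z al).
Proof. by move=> hz; rewrite cabs_gt0 mono_neq0. Qed.

Lemma mono_delta z j : mono z (delta_mx 0 j) = z 0 j.
Proof.
rewrite /mono (bigD1 j) //= mxE !eqxx expr1z big1 ?mulr1 // => i /negbTE ij.
by rewrite mxE eqxx ij expr0z.
Qed.

Lemma mono_sum z (I : Type) (s : seq I) (P : pred I) (be : I -> 'rV[int]_n) : torus z ->
  mono z (\sum_(i <- s | P i) be i) = \prod_(i <- s | P i) mono z (be i).
Proof.
move=> hz; elim/big_rec2: _ => [|i x y _ <-]; rewrite ?mono0 //; exact: monoD.
Qed.

Lemma monoMz z al (k : int) : mono z (k *: al) = mono z al ^ k.
Proof.
transitivity (\prod_i (z 0 i ^ al 0 i) ^ k).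
  by apply: eq_bigr => i _; rewrite mxE mulrC -exprz_exp.
case: k => k; last by rewrite NegzE -exprnN -prodrXl -prodfV; apply: eq_bigr.
by rewrite -exprnP -prodrXl.
Qed.

Lemma mono_mulmx m (Q : 'M[int]_(m, n)) z (k : 'rV[int]_m) : torus z ->
  mono z (k *m Q) = mono (\row_j mono z (row j Q)) k.
Proof.
move=> hz; rewrite mulmx_sum_row mono_sum //; apply: eq_bigr => j _.
by rewrite monoMz mxE.
Qed.

Lemma mono_hadamard z z' al : mono (\row_j (z 0 j * z' 0 j)) al = mono z al * mono z' al.
Proof. by rewrite /mono -big_split /=; apply: eq_bigr => i _; rewrite mxE expfzMl. Qed.
End Mono.

Section Prod.
Variable R : realType.
Local Notation C := R[i].

Definition rV_split n (l : 'rV[int]_n.+1) : int * 'rV[int]_n :=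
  (l 0 ord0, \row_j l 0 (lift ord0 j)).

Lemma rV_split_bij n : bijective (@rV_split n).
Proof.
exists (fun p : int * 'rV[int]_n => \row_j (if unlift ord0 j is Some k then p.2 0 k else p.1)).
  move=> l; apply/rowP => j; rewrite mxE.
  by case: unliftP => [k ->|->] //=; rewrite mxE.
move=> [a l]; congr (_, _); rewrite ?mxE ?unlift_none //.
by apply/rowP => j; rewrite !mxE liftK.
Qed.

Lemma abs_sum_prod n (f : 'I_n -> int -> C) (a : 'I_n -> C) :
  (forall j, abs_sum (f j) (a j)) ->
  abs_sum (fun l : 'rV[int]_n => \prod_j f j (l 0 j)) (\prod_j a j).
Proof.
elim: n f a => [|n IH] f a h.
  rewrite big_ord0; have := @abs_sum1 R _ (0 : 'rV[int]_0) 1.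
  congr (abs_sum _ _); apply/funext => l; rewrite big_ord0.
  by have -> : l == 0 by apply/eqP/rowP; case.
have [g g1 g2] := rV_split_bij n.
have := abs_sum_mul (h ord0) (IH _ _ (fun j => h (lift ord0 j))).
move/(abs_sum_inj (bij_inj (@rV_split_bij n)) (fun p _ => ex_intro _ (g p) (g2 p))).
rewrite big_ord_recl; congr (abs_sum _ _); apply/funext => l.
rewrite big_ord_recl /=; congr (_ * _); apply: eq_bigr => i _; by rewrite mxE.
Qed.

Lemma sum_prod_le n (f : 'I_n -> int -> R) (M : 'I_n -> R) :
  (forall j k, 0 <= f j k) ->
  (forall j s, uniq s -> \sum_(k <- s) f j k <= M j) ->
  forall s : seq 'rV[int]_n, uniq s -> \sum_(l <- s) \prod_j f j (l 0 j) <= \prod_j M j.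
Proof.
move=> f0; elim: n f M f0 => [|n IH] f M f0 h s us.
  rewrite big_ord0; apply: le_trans (_ : \sum_(l <- [:: (0 : 'rV[int]_0)]) \prod_(j < 0) f j (l 0 j) <= _).
    apply: ler_sum_uniq => // [l|l _]; first by rewrite big_ord0 ler01.
    by rewrite inE; apply/eqP/rowP; case.
  by rewrite big_seq1 big_ord0.
have M0 j : 0 <= M j by have := h j [::] isT; rewrite big_nil.
pose s1 := undup [seq p.1 | p <- [seq rV_split l | l <- s]].
pose s2 := undup [seq p.2 | p <- [seq rV_split l | l <- s]].
rewrite big_ord_recl.
apply: le_trans (_ : (\sum_(k <- s1) f ord0 k) *
   (\sum_(l <- s2) \prod_j f (lift ord0 j) (l 0 j)) <= _); last first.
  apply: ler_pM; [exact: sumr_ge0| |exact: h (undup_uniq _)|].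
    by apply: sumr_ge0 => l _; exact: prodr_ge0.
  exact: (IH _ _ (fun j => f0 _) (fun j => h _) _ (undup_uniq _)).
pose F (p : int * 'rV[int]_n) := f ord0 p.1 * \prod_j f (lift ord0 j) (p.2 0 j).
have -> : \sum_(l <- s) \prod_j f j (l 0 j) = \sum_(p <- [seq rV_split l | l <- s]) F p.
  rewrite big_map; apply: eq_bigr => l _; rewrite big_ord_recl /F /=; congr (_ * _).
  by apply: eq_bigr => j _; rewrite mxE.
have -> : (\sum_(k <- s1) f ord0 k) * (\sum_(l <- s2) \prod_j f (lift ord0 j) (l 0 j)) =
   \sum_(p <- [seq (k, l) | k <- s1, l <- s2]) F p.
  by rewrite big_allpairs mulr_suml; apply: eq_bigr => k _; rewrite mulr_sumr.
apply: ler_sum_uniq => [p||p hp].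
- by rewrite mulr_ge0 ?f0 //; apply: prodr_ge0 => j _; exact: f0.
- by rewrite map_inj_uniq //; exact: bij_inj (@rV_split_bij n).
- by apply/allpairsP; exists p; rewrite !mem_undup; split; [exact: map_f|exact: map_f|case: (p)].
Qed.

Lemma abs_summable_prod n (f : 'I_n -> int -> C) : (forall j, abs_summable (f j)) ->
  abs_summable (fun l : 'rV[int]_n => \prod_j f j (l 0 j)).
Proof. by move=> h; have [] := abs_sum_prod (fun j => csumP (h j)). Qed.
End Prod.

(** * Laurent coefficients and values on a torus *)

Section CoefBound.
Variable R : realType.
Local Notation C := R[i].

Lemma abs_summable_tail (I : eqType) (u : I -> C) (e : R) : abs_summable u -> 0 < e ->
  exists2 s0 : seq I, uniq s0 &
    forall s, uniq s -> (forall i, i \in s -> i \notin s0) -> \sum_(i <- s) cabs (u i) <= e.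
Proof.
move=> [M hM] e0; have e2 : 0 < e / 2 by rewrite divr_gt0.
have [l hl] := rsum_ge0 (fun i => cabs_ge0 (u i)) hM.
have [s0 hs0] := hl _ e2; exists (undup s0) => [|s us dis]; first exact: undup_uniq.
have h1 : `|\sum_(i <- undup s0) cabs (u i) - l| < e / 2.
  by apply: hs0; rewrite ?undup_uniq // => i; rewrite mem_undup.
have h2 : `|\sum_(i <- s ++ undup s0) cabs (u i) - l| < e / 2.
  apply: hs0 => [|i hi]; last by rewrite mem_cat mem_undup hi orbT.
  rewrite cat_uniq us undup_uniq andbT /=; apply/hasPn => i hi.
  by apply/negP => hi'; have := dis i hi'; rewrite hi.
move: h1 h2; rewrite big_cat /= !ltr_norml => /andP[a b] /andP[c d]; lra.
Qed.

Lemma root_m1_exists k : exists w : C, w ^+ (2 ^ k) = -1.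
Proof.
elim: k => [|k [w hw]]; first by exists (-1); rewrite expr1.
by exists (sqrtC w); rewrite expnS exprM sqrtCK.
Qed.

(** Iterated square roots of -1 suffice, since only a large order is wanted: if w^(2^k) = -1, the
    order of w divides 2^(k+1) but not 2^k. *)
Lemma two_root_exists k : exists2 w : C, w ^+ (2 ^ k) = 1 &
  forall m : int, w ^ m = 1 -> (`|m| < 2 ^ k)%N -> m = 0.
Proof.
case: k => [|k].
  exists 1; first by rewrite expr1n.
  by move=> m _; rewrite expn0 ltnS leqn0 absz_eq0 => /eqP.
have [w hw] := root_m1_exists k; exists w; first by rewrite expnSr exprM hw sqrrN expr1n.
move=> m hm lt; apply/eqP; rewrite -absz_eq0; apply/negPn/negP => m0.
have {hm} : w ^+ `|m|%N = 1.
  case: m lt m0 hm => a; rewrite ?NegzE ?abszN ?absz_nat // => _ _; rewrite -exprnN => h.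
  by apply: invr_inj; rewrite h invr1.
move: (`|m|%N) lt m0 => {m} m lt m0 hm; rewrite -lt0n in m0.
have [p hp pm] := @prim_order_exists _ m w m0 hm.
have w1 : w ^+ (2 ^ k.+1) = 1 by rewrite expnSr exprM hw sqrrN expr1n.
have : (p %| 2 ^ k.+1)%N by rewrite (prim_order_dvd hp) w1.
case/(dvdn_pfactor _ _ (isT : prime 2)) => j jk pj.
have [jk'|jk'] := leqP j k; last first.
  by have := dvdn_leq m0 pm; rewrite pj leqNgt (leq_trans lt) // leq_exp2l.
have : w ^+ (2 ^ k) = 1.
  by apply/eqP; rewrite -(prim_order_dvd hp) pj dvdn_exp2l.
rewrite hw => /eqP; rewrite eq_sym -subr_eq0 opprK -mulr2n pnatr_eq0 //.
Qed.

Lemma sum_root_of_unity (x : C) N : x ^+ N = 1 ->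
  \sum_(s < N) x ^+ s = if x == 1 then N%:R else 0.
Proof.
move=> xN; case: eqP => [->|/eqP x1].
  by under eq_bigr do rewrite expr1n; rewrite big_const_ord iter_addr addr0.
apply/eqP; have := subrX1 x N; rewrite xN subrr => /eqP.
by rewrite eq_sym mulf_eq0 subr_eq0 (negbTE x1).
Qed.

(* Averages over the product of the groups of 2^k-th roots of unity isolate one coefficient,
   up to the tail of the series. *)
Lemma coef_bound n (u : 'rV[int]_n -> C) (z0 : 'rV[C]_n) (B : R) : torus z0 ->
  abs_summable (fun g => u g * mono z0 g) ->
  (forall z : 'rV[C]_n, (forall j, cabs (z 0 j) = cabs (z0 0 j)) ->
     cabs (csum (fun g => u g * mono z g)) <= B) ->
  forall g, cabs (u g * mono z0 g) <= B.
Proof.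
move=> hz0 hs hB g0; apply/ler_addgt0Pr => e e0.
have [s0 us0 hs0] := abs_summable_tail hs e0.
(* The order of the root of unity must exceed every difference of exponents met in [s0], so that
   averaging separates [g0] from the rest of [s0]. *)
have [k hk] : exists k, forall g, g \in s0 -> forall j, (absz (g 0 j - g0 0 j)%R < 2 ^ k)%N.
  exists (\sum_(g <- s0) \sum_j absz (g 0 j - g0 0 j)%R)%N => g gs j.
  apply: leq_ltn_trans (ltn_expl _ (isT : 1 < 2)%N).
  rewrite (perm_big _ (perm_to_rem gs)) big_cons (bigD1 j) //=.
  by rewrite -addnA leq_addr.
have [w wN wm] := two_root_exists k; set N := (2 ^ k)%N in wN wm hk.
have w0 : w != 0 by apply: contra_eqN wN => /eqP ->; rewrite expr0n expn_eq0 eq_sym oner_eq0.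
have N0 : (N%:R : C) != 0 by rewrite pnatr_eq0 expn_eq0.
have cw : cabs w = 1.
  have := congr1 (@cabs R) wN; rewrite cabsX cabs1 => /eqP.
  by rewrite pexprn_eq1 ?cabs_ge0 // expn_eq0 /= => /eqP.
pose zs (f : {ffun 'I_n -> 'I_N}) : 'rV[C]_n := \row_j (z0 0 j * (\row_i w ^+ f i) 0 j).
pose v g := u g * mono z0 g.
(* Effect of averaging on the term of index [g]: it survives exactly when [g] and [g0] agree modulo
   the order in every coordinate. *)
pose K (g : 'rV[int]_n) : C := \prod_j (if w ^ (g 0 j - g0 0 j) == 1 then 1 else 0).
pose cf (f : {ffun 'I_n -> 'I_N}) : C := \prod_j (N%:R^-1 * (w ^+ f j) ^ (- g0 0 j)).
have key g : \sum_f cf f * (u g * mono (zs f) g) = v g * K g.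
  transitivity (\sum_(f : {ffun 'I_n -> 'I_N}) v g * \prod_j (N%:R^-1 * (w ^ (g 0 j - g0 0 j)) ^+ f j)).
    apply: eq_bigr => f _; rewrite mono_hadamard [u g * _]mulrA -/(v g) mulrCA; congr (_ * _).
    rewrite /cf /mono -big_split /=; apply: eq_bigr => j _; rewrite mxE -mulrA; congr (_ * _).
    by rewrite -expfzDr ?expf_neq0 // exprnP exprz_exp exprnP exprz_exp mulrC addrC.
  rewrite -mulr_sumr -(bigA_distr_bigA (fun j s => N%:R^-1 * (w ^ (g 0 j - g0 0 j)) ^+ nat_of_ord s)).
  congr (_ * _); apply: eq_bigr => j _; rewrite -mulr_sumr sum_root_of_unity.
    by case: ifP => _; rewrite ?mulr0 // mulVf.
  by rewrite exprnP exprz_exp mulrC -exprz_exp -exprnP wN exp1rz.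
have zsc f j : cabs (zs f 0 j) = cabs (z0 0 j).
  by rewrite !mxE cabsM cabsX cw expr1n mulr1.
have sz f : abs_summable (fun g => u g * mono (zs f) g).
  apply: abs_summable_le1 hs => g; rewrite !cabsM !cabs_mono.
  by under eq_bigr do rewrite zsc.
have scf f : abs_summable (fun g => cf f * (u g * mono (zs f) g)) := abs_summableZ (cf f) (sz f).
have svK : abs_summable (fun g => v g * K g).
  under eq_fun do rewrite -key.
  by apply: abs_summable_sum => f _; apply: scf.
have hvK : cabs (csum (fun g => v g * K g)) <= B.
  under eq_fun do rewrite -key.
  rewrite csum_sum => [|f _]; last exact: scf.
  have N00 : 0 < (N%:R : R) by rewrite ltr0n expn_gt0.
  apply: le_trans (cabs_sum _ _ _) _.
  apply: le_trans (_ : \sum_(f : {ffun 'I_n -> 'I_N}) N%:R ^- n * B <= _).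
    apply: ler_sum => f _; rewrite (csumZ _ (sz f)) cabsM.
    suff -> : cabs (cf f) = N%:R ^- n.
      by rewrite ler_wpM2l ?invr_ge0 ?exprn_ge0 ?ler0n ?hB.
    rewrite cabs_prod; under eq_bigr do rewrite cabsM cabsXz cabsX cw expr1n exp1rz mulr1 cabsV.
    rewrite big_const_ord; have -> : cabs (N%:R : C) = N%:R.
      by rewrite -(rmorph_nat (real_complex R)) cabs_real ger0_norm ?ler0n.
    by elim: (n) => [|m IH] //=; rewrite ?expr0 ?invr1 // IH exprS invfM.
  rewrite big_const cardE /= -cardE card_ffun !card_ord iter_addr addr0.
  rewrite -(mulr_natl (N%:R ^- n * B) (N ^ n)%N) (natrX _ N n).
  by rewrite mulrA divff ?mul1r // expf_neq0 // gt_eqF.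
pose d (g : 'rV[int]_n) : C := if g == g0 then v g0 else 0.
have sd : abs_sum d (v g0) by exact: abs_sum1.
have -> : u g0 * mono z0 g0 = csum (fun g => v g * K g) - csum (fun g => v g * K g - d g).
  have -> : csum (fun g => v g * K g - d g) = csum (fun g => v g * K g) - v g0.
    apply: abs_sumE; exact: abs_sumB (csumP svK) sd.
  by rewrite opprB addrC subrK.
apply: le_trans (ler_cabsD _ _) _; rewrite cabsN; apply: lerD => //.
have Kle g : cabs (K g) <= 1.
  rewrite /K cabs_prod; apply: prodr_ile1 => j _; rewrite cabs_ge0 /=.
  by case: ifP => _; rewrite ?cabs1 ?cabs0 ?ler01.
have Kg0 : K g0 = 1 by rewrite /K big1 // => j _; rewrite subrr expr0z eqxx.
(* Once the term [g0] is removed, the averaged series vanishes on [s0], and what is left is bounded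
   by the tail. *)
apply: csum_le => s us.
rewrite (bigID (mem s0)) /= [X in X + _]big1 ?add0r => [|g gs]; last first.
  rewrite /d; case: eqP => [->|/eqP gg0]; first by rewrite Kg0 mulr1 subrr cabs0.
  have [j hj] : exists j, g 0 j != g0 0 j.
    apply/existsP; rewrite -negb_forall; apply: contra gg0 => /forallP h.
    by apply/eqP/rowP => j; apply/eqP.
  rewrite /K (bigD1 j) //= ifF ?mul0r ?mulr0 ?subr0 ?cabs0 //.
  apply/negbTE; apply: contra hj => /eqP/wm/(_ (hk _ gs j)) /eqP.
  by rewrite subr_eq0.
rewrite -big_filter; apply: le_trans (hs0 [seq g <- s | g \notin s0] _ _); last 2 first.
- by rewrite filter_uniq.
- by move=> g; rewrite mem_filter => /andP[].
apply: ler_sum => g _; rewrite -/(v g) /d; case: eqP => [->|_].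
  by rewrite Kg0 mulr1 subrr cabs0 cabs_ge0.
by rewrite subr0 cabsM ler_piMr ?cabs_ge0.
Qed.

(** This is [coef_bound] with constant 0, applied to the difference. It turns equality of values on
    one torus into identities between coefficients, for Laurent expansions and recentered series
    alike. *)
Lemma coef_unique n (u v : 'rV[int]_n -> C) (z0 : 'rV[C]_n) : torus z0 ->
  (forall z : 'rV[C]_n, (forall j, cabs (z 0 j) = cabs (z0 0 j)) ->
     exists l, abs_sum (fun g => u g * mono z g) l /\ abs_sum (fun g => v g * mono z g) l) ->
  u = v.
Proof.
move=> hz0 h; apply/funext => g; apply/eqP; rewrite -subr_eq0.
have hd (z : 'rV[C]_n) : (forall j, cabs (z 0 j) = cabs (z0 0 j)) ->
    abs_sum (fun g => (u g - v g) * mono z g) 0.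
  move=> hz; have [l [h1 h2]] := h z hz.
  have := abs_sumB h1 h2; rewrite subrr; under eq_fun do rewrite -mulrBl.
  by [].
have := @coef_bound n (fun g => u g - v g) z0 0 hz0 (hd z0 (fun j => erefl)).1 _ g.
rewrite cabsM; have m0 := cabs_mono_gt0 g hz0.
rewrite pmulr_lle0 // -cabs_eq0 => H; rewrite eq_le cabs_ge0 andbT; apply: H => z hz.
by rewrite (abs_sumE (hd z hz)) cabs0.
Qed.
End CoefBound.

(** * Recentering Laurent series *)

Section Gbin.
Variable R : realType.
Local Notation C := R[i].

(** The binomial coefficient with an arbitrary integer on top; for -(m+1), that is [Negz m], it is
    (-1)^l times the binomial coefficient of m+l over l. *)
Definition gbin (k : int) (l : nat) : C :=
  match k with Posz m => 'C(m, l)%:R | Negz m => (-1) ^+ l * 'C(m + l, l)%:R end.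

Lemma gbin0 k : gbin k 0 = 1.
Proof. by case: k => m /=; rewrite ?expr0 ?mul1r bin0. Qed.

Lemma gbinS k l : gbin (k + 1) l.+1 = gbin k l.+1 + gbin k l.
Proof.
case: k => [m|[|m]].
- by rewrite -PoszD addn1 /= binS natrD.
- have -> : Negz 0 + 1 = 0 by [].
  by rewrite /= bin0n !add0n !binn !mulr1 exprS mulN1r addNr.
- have -> : Negz m.+1 + 1 = Negz m by rewrite !NegzE; lia.
  rewrite /= !addSn !addnS [in RHS]binS natrD mulrDr exprS !mulN1r !mulNr -addrA.
  by rewrite addNr addr0.
Qed.

Lemma gbin_deriv k l : l.+1%:R * gbin k l.+1 = k%:~R * gbin (k - 1) l.
Proof.
case: k => [[|m]|m].
- by rewrite /= bin0n mulr0 mul0r.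
- have -> : Posz m.+1 - 1 = Posz m by lia.
  by rewrite /= -!natrM mul_bin_diag.
- have -> : Negz m - 1 = Negz m.+1 by rewrite !NegzE; lia.
  have -> : ((Negz m)%:~R : C) = - m.+1%:R by [].
  rewrite /= addnS -addSn mulrCA -natrM mul_bin_left.
  have -> : (m.+1 + l - l = m.+1)%N by rewrite addnK.
  rewrite exprS natrM mulN1r [RHS]mulNr [in RHS]mulrCA mulNr //.
Qed.

Lemma gbin_nat (m l : nat) : (m < l)%N -> gbin m l = 0.
Proof. by move=> h; rewrite /= bin_small. Qed.

(* The coefficient of t^l in the expansion of (v + t)^k. *)
Definition rb (v : C) (k l : int) : C :=
  match l with Posz m => gbin k m * v ^ (k - l) | Negz _ => 0 end.

(** Coefficient form of (v + t)^(k+1) = (v + t) (v + t)^k. The side condition excludes negative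
    powers of 0, whose conventional value is 0. *)
Lemma rbS (v : C) (k l : int) : (0 <= k) || (v != 0) -> rb v (k + 1) l = v * rb v k l + rb v k (l - 1).
Proof.
case: l => [[|l]|l] h; last 1 first.
- have -> : Negz l - 1 = Negz l.+1 by rewrite !NegzE; lia.
  by rewrite /= mulr0 addr0.
- have -> : 0 - 1 = Negz 0 by [].
  rewrite /= !gbin0 !mul1r !subr0 addr0.
  case: (eqVneq v 0) h => [-> |v0 _]; last by rewrite expfzDr // expr1z mulrC.
  rewrite orbF mul0r => k0; rewrite exp0rz; case: eqP => //; move: k0; lia.
have -> : Posz l.+1 - 1 = Posz l by lia.
rewrite /= gbinS mulrDl.
have -> : k + 1 - Posz l.+1 = k - Posz l by lia.
congr (_ + _).
have e : k - Posz l = 1 + (k - Posz l.+1) by lia.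
case: (eqVneq v 0) h => [-> |v0 _]; last by rewrite e expfzDr // expr1z mulrCA.
rewrite orbF mul0r => k0; rewrite exp0rz; case: eqP => [e2|]; last by rewrite mulr0.
by rewrite (_ : k = Posz l) ?gbin_nat ?mul0r //; move: e2; lia.
Qed.

Lemma rb_deriv (v : C) (k l : int) : (l + 1)%:~R * rb v k (l + 1) = k%:~R * rb v (k - 1) l.
Proof.
case: l => [l|[|l]].
- have -> : Posz l + 1 = Posz l.+1 by lia.
  have -> : ((Posz l.+1)%:~R : C) = l.+1%:R by [].
  rewrite /= mulrA gbin_deriv -mulrA; congr (_ * (_ * _ ^ _)); lia.
- by have -> : Negz 0 + 1 = 0 by []; rewrite mul0r /= mulr0.
- have -> : Negz l.+1 + 1 = Negz l by rewrite !NegzE; lia.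
  by rewrite /= !mulr0.
Qed.

(** Coefficient form of k (v + t)^k = (v + t) d/dt (v + t)^k. *)
Lemma rb_euler (v : C) (k l : int) : (0 < k) || (v != 0) || (k == 0) ->
  k%:~R * rb v k l = v * (k%:~R * rb v (k - 1) l) + l%:~R * rb v k l.
Proof.
case: (eqVneq k 0) => [->|k0] h.
  rewrite !mul0r mulr0 add0r; case: l => [[|l]|l]; rewrite ?mul0r //= ?mulr0 //.
  by rewrite bin0n mul0r mulr0.
have e : rb v k l = v * rb v (k - 1) l + rb v (k - 1) (l - 1).
  by have := @rbS v (k - 1) l; rewrite subrK; apply; case: (v != 0) h; rewrite ?orbT //; lia.
have := rb_deriv v k (l - 1); rewrite subrK => ->.
by rewrite {1}e mulrDr mulrCA.
Qed.

(* sup of |v + tau|^k over |tau| <= h, when h < |v| or 0 <= k *)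
Definition majpow (x h : R) (k : int) : R := if k is Posz _ then (x + h) ^ k else (x - h) ^ k.

Lemma rb_negl (v : C) (k l : int) : l < 0 -> rb v k l = 0.
Proof. by case: l. Qed.

Lemma sum_int_nat (f : int -> R) (M : R) : (forall l, 0 <= f l) ->
  (forall l, l < 0 -> f l = 0) -> (forall L, \sum_(i < L) f (Posz i) <= M) ->
  forall s, uniq s -> \sum_(l <- s) f l <= M.
Proof.
move=> f0 fn fM s us.
pose L := (\max_(l <- s) `|l|%N).+1.
apply: le_trans (fM L).
rewrite -(big_mkord xpredT (fun i => f (Posz i))) -(big_map Posz xpredT f).
rewrite (bigID (fun l => 0 <= l)) /= [X in _ + X]big1 ?addr0 => [|l]; last first.
  by rewrite -ltNge => /fn.
rewrite -big_filter; apply: ler_sum_uniq => // [|l]; first exact: filter_uniq.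
rewrite mem_filter => /andP[l0 ls].
have -> : l = Posz `|l|%N by move: l0; lia.
suff h : Posz `|l|%N \in map Posz (index_iota 0 L) by exact: h.
by apply: map_f; rewrite mem_index_iota leq0n ltnS; exact: leq_bigmax_seq.
Qed.

Lemma cabs_gbin_neg m l : cabs (gbin (Negz m) l) = 'C(m + l, l)%:R.
Proof.
rewrite /= cabsM cabsX cabsN cabs1 expr1n mul1r.
by rewrite -(rmorph_nat (real_complex R)) cabs_real ger0_norm.
Qed.

(** Partial sums of the negative binomial series. By Pascal's rule, multiplying the terms of rank m
    by x - h gives those of rank m - 1, up to a boundary term of favorable sign; hence the induction
    on m. *)
Lemma negbin_sum_le (x h : R) m L : 0 <= h -> h < x ->
  \sum_(l < L) 'C(m + l, l)%:R * x ^- (m + l).+1 * h ^+ l <= (x - h) ^- m.+1.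
Proof.
move=> h0 hx; have x0 : 0 < x by exact: le_lt_trans hx.
have xh0 : 0 < x - h by rewrite subr_gt0.
pose a m l : R := 'C(m + l, l)%:R * x ^- (m + l).+1 * h ^+ l.
have a0 m' l : 0 <= a m' l by rewrite /a !mulr_ge0 ?invr_ge0 ?exprn_ge0 // ltW.
rewrite -/(a m _).
have step m' b : (forall l, x * a m' l.+1 - h * a m' l = b l.+1) -> x * a m' 0%N = b 0%N ->
    (x - h) * \sum_(l < L) a m' l <= \sum_(l < L) b l.
  move=> h1 h2; rewrite mulrBl; case: L => [|K]; first by rewrite !big_ord0 !mulr0 subrr.
  rewrite [X in x * X]big_ord_recl [X in _ <= X]big_ord_recl mulrDr h2 -addrA lerD2l.
  rewrite big_ord_recr /= mulrDr opprD addrA; apply: le_trans (_ : x * (\sum_(i < K) a m' (bump 0 i)) - h * (\sum_(i < K) a m' i) <= _).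
    by rewrite gerBl mulr_ge0.
  rewrite !mulr_sumr -sumrB; apply: ler_sum => i _; by rewrite -h1.
elim: m => [|m IH].
  rewrite expr1 -[_^-1]mulr1 ler_pdivlMl //; apply: le_trans (step 0%N (fun l => (l == 0%N)%:R) _ _) _.
  - move=> l; rewrite /a !add0n !binn /= !exprS; field.
    by rewrite expf_neq0 ?gt_eqF.
  - by rewrite /a addn0 bin0 expr0 expr1 mul1r mulr1 divff // gt_eqF.
  case: L {step} => [|K]; first by rewrite big_ord0.
  by rewrite big_ord_recl big1 ?addr0.
rewrite exprS invfM ler_pdivlMl //; apply: le_trans (step m.+1 (a m) _ _) IH.
- move=> l; rewrite /a !addSn addnS [in X in X - _]binS natrD !exprS; field.
  by rewrite expf_neq0 ?gt_eqF.
- by rewrite /a !addn0 !bin0 expr0 !mul1r !mulr1 exprS invfM mulrA divff ?mul1r // gt_eqF.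
Qed.

(** Whether (v + tau)^k with |v| = x equals its expansion for |tau| <= h: always for k >= 0, and
    otherwise when v + tau cannot vanish. *)
Definition expandable (x h : R) (k : int) : bool := (0 <= k) || (h < x).

Lemma rb_sum_le (v : C) (h : R) k : 0 <= h -> expandable (cabs v) h k ->
  forall s, uniq s -> \sum_(l <- s) cabs (rb v k l) * h ^ l <= majpow (cabs v) h k.
Proof.
move=> h0 hk; apply: sum_int_nat => [l|l l0|L].
- by rewrite mulr_ge0 ?cabs_ge0 // exprz_ge0.
- by rewrite rb_negl // cabs0 mul0r.
case: k hk => k hk /=.
  apply: le_trans (_ : \sum_(l < k.+1) cabs v ^+ (k - l) * h ^+ l *+ 'C(k, l) <= _); last first.
    by rewrite -exprDn.
  pose F (l : nat) : R := cabs v ^+ (k - l) * h ^+ l *+ 'C(k, l).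
  have -> : \sum_(i < L) cabs (gbin k i * v ^ (Posz k - Posz i)) * h ^ Posz i = \sum_(i < L) F i.
    apply: eq_bigr => i _; rewrite /F; have [ki|ik] := ltnP k i.
      by rewrite gbin_nat // bin_small // mul0r cabs0 mul0r mulr0n.
    rewrite cabsM subzn // cabsX /= -(rmorph_nat (real_complex R)) cabs_real ger0_norm //.
    by rewrite -mulrA mulr_natl.
  rewrite -!(big_mkord xpredT F).
  have F0 l : 0 <= F l by rewrite /F mulrn_wge0 // mulr_ge0 // ?exprn_ge0 ?cabs_ge0.
  rewrite (bigID (fun l => (l <= k)%N)) /= [X in _ + X]big1 ?addr0 => [|l]; last first.
    by rewrite -ltnNge /F => lk; rewrite bin_small.
  rewrite -big_filter; apply: ler_sum_uniq => // [|l]; first by rewrite filter_uniq ?iota_uniq.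
  by rewrite mem_filter !mem_index_iota /= => /andP[].
have hx : h < cabs v by move: hk; rewrite /expandable.
apply: le_trans (negbin_sum_le k L h0 hx); apply: ler_sum => l _.
rewrite cabsM cabs_gbin_neg cabsXz; have -> : Negz k - Posz l = - Posz (k + l).+1 by rewrite NegzE; lia.
by rewrite -exprnN -exprnP.
Qed.

Lemma rb_abs_summable (v t : C) k : expandable (cabs v) (cabs t) k ->
  abs_summable (fun l => rb v k l * t ^ l).
Proof.
move=> hk; exists (majpow (cabs v) (cabs t) k) => s us.
under eq_bigr do rewrite cabsM cabsXz; exact: rb_sum_le (cabs_ge0 _) hk _ us.
Qed.

Lemma int_shift_bij (c : int) : bijective (fun l : int => l + c).
Proof. by exists (fun l => l - c) => l; rewrite ?addrK ?subrK. Qed.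

(** The series and the power obey the same recurrence in k. From k = 0 one goes up by multiplying
    and down by dividing by v + t, which is nonzero when k is negative. *)
Lemma rb_abs_sum (v t : C) k : expandable (cabs v) (cabs t) k ->
  abs_sum (fun l => rb v k l * t ^ l) ((v + t) ^ k).
Proof.
move=> hk.
have step k' : (0 <= k') || (v != 0) -> expandable (cabs v) (cabs t) k' ->
    csum (fun l => rb v (k' + 1) l * t ^ l) = (v + t) * csum (fun l => rb v k' l * t ^ l).
  move=> h1 h2; have hs := csumP (rb_abs_summable h2); apply: abs_sumE.
  rewrite mulrDl; have h3 : abs_sum (fun l => t * (rb v k' (l - 1) * t ^ (l - 1)))
                               (t * csum (fun l => rb v k' l * t ^ l)).
    apply: abs_sumZ; have [g g1 g2] := int_shift_bij (-1).
    apply: (@abs_sum_inj _ _ _ (fun l : int => l - 1) (fun l => rb v k' l * t ^ l)) => //.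
      exact: can_inj g1.
    by move=> i _; exists (g i).
  have := abs_sumD (abs_sumZ v hs) h3; congr (abs_sum _ _); apply/funext => l.
  rewrite rbS // mulrDl mulrA; congr (_ + _).
  have [l0|l0] := ltP (l - 1) 0; first by rewrite rb_negl // !mul0r mulr0.
  rewrite mulrCA; congr (_ * _).
  have -> : l = Posz `|l - 1|%N.+1 by move: l0; lia.
  have -> : Posz `|l - 1|%N.+1 - 1 = Posz `|l - 1|%N by lia.
  by rewrite -!exprnP exprS.
suff -> : (v + t) ^ k = csum (fun l => rb v k l * t ^ l) by apply: csumP; exact: rb_abs_summable.
have s0 : csum (fun l => rb v 0 l * t ^ l) = 1.
  apply: abs_sumE; have := @abs_sum1 R _ (0 : int) 1; congr (abs_sum _ _); apply/funext => l.
  case: l => [[|l]|l] /=; last by rewrite mul0r.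
    by rewrite bin0 subr0 !expr0z !mulr1.
  by rewrite bin0n !mul0r.
case: k hk => k hk.
  elim: k {hk} => [|k IH]; first by rewrite s0 expr0z.
  have -> : Posz k.+1 = Posz k + 1 by lia.
  by rewrite step // -IH -exprnP exprnP -PoszD addn1 -exprnP exprS.
have ht : cabs t < cabs v by move: hk; rewrite /expandable.
have v0 : v != 0 by rewrite -cabs_gt0 (le_lt_trans _ ht) ?cabs_ge0.
have vt0 : v + t != 0.
  rewrite -cabs_gt0 (lt_le_trans (_ : 0 < cabs v - cabs t)) ?subr_gt0 //.
  by rewrite -[X in _ <= cabs (_ + X)]opprK -[X in _ - X]cabsN ler_cabsB.
have hk2 k' : expandable (cabs v) (cabs t) k' by rewrite /expandable ht orbT.
elim: k {hk} => [|k IH].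
  apply: (mulfI vt0); rewrite -step ?v0 ?orbT //.
  by rewrite s0 NegzE -exprnN expr1 divff.
apply: (mulfI vt0); rewrite -step ?v0 ?orbT //.
have -> : Negz k.+1 + 1 = Negz k by rewrite !NegzE; lia.
by rewrite -IH !NegzE -!exprnN [in LHS]exprS invfM mulrA divff ?mul1r.
Qed.
End Gbin.

Section Rec.
Variable R : realType.
Local Notation C := R[i].
Variable r : nat.
Implicit Types (v w t : 'rV[C]_r) (k l : 'rV[int]_r) (u : 'rV[int]_r -> C).

(* The coefficient of t^l in the expansion of (v + t)^k, k and l multi-indices. *)
Definition RB v k l : C := \prod_j rb (v 0 j) (k 0 j) (l 0 j).
Definition majmono v (h : R) k : R := \prod_j majpow (cabs (v 0 j)) h (k 0 j).
(** Absolute convergence, on |tau_j| <= h, of the double series obtained by expanding every monomial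
    at v. The first clause is asked on the support of [u] only, so that one notion covers Laurent
    series, where negative exponents force h < |v_j|, and power series, which may be recentered even
    at 0. *)
Definition recable v (h : R) u : Prop :=
  (forall k, u k != 0 -> forall j, expandable (cabs (v 0 j)) h (k 0 j)) /\
  exists M : R, forall s, uniq s -> \sum_(k <- s) cabs (u k) * majmono v h k <= M.
(* The Taylor coefficients at v of sum_k (u k) t^k. *)
Definition Rec v u l : C := csum (fun k => u k * RB v k l).

Lemma RB_neg v k l j : l 0 j < 0 -> RB v k l = 0.
Proof. by move=> h; rewrite /RB (bigD1 j) //= rb_negl ?mul0r. Qed.

Lemma Rec_neg v u l j : l 0 j < 0 -> Rec v u l = 0.
Proof.
move=> h; apply: abs_sumE; under eq_fun do rewrite (RB_neg _ _ h) mulr0.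
exact: abs_sum0.
Qed.

Lemma rb_mono_le (x y : C) (h : R) (k l : int) : cabs y <= h ->
  cabs (rb x k l) * cabs y ^ l <= cabs (rb x k l) * h ^ l.
Proof.
move=> yh; case: l => l; last by rewrite rb_negl // cabs0 !mul0r.
by rewrite ler_wpM2l ?cabs_ge0 // -!exprnP lerXn2r ?nnegrE ?cabs_ge0 // (le_trans _ yh) ?cabs_ge0.
Qed.

Lemma RB_sum_le v t (h : R) k : 0 <= h -> (forall j, cabs (t 0 j) <= h) ->
  (forall j, expandable (cabs (v 0 j)) h (k 0 j)) ->
  forall s, uniq s -> \sum_(l <- s) cabs (RB v k l * mono t l) <= majmono v h k.
Proof.
move=> h0 th hk s us.
have H : \sum_(l <- s) \prod_j (cabs (rb (v 0 j) (k 0 j) (l 0 j)) * h ^ (l 0 j)) <= majmono v h k.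
  apply: (@sum_prod_le R r (fun (j : 'I_r) (l : int) => cabs (rb (v 0 j) (k 0 j) l) * h ^ l)
    (fun j => majpow (cabs (v 0 j)) h (k 0 j)) _ _ s us) => [j l|j s' us'].
    by rewrite mulr_ge0 ?cabs_ge0 ?exprz_ge0.
  exact: rb_sum_le.
apply: le_trans H; apply: ler_sum => l _; rewrite cabsM cabs_mono cabs_prod -big_split /=.
by apply: ler_prod => j _; rewrite mulr_ge0 ?cabs_ge0 ?exprz_ge0 ?cabs_ge0 //= rb_mono_le.
Qed.

Lemma RB_abs_sum v t (h : R) k : (forall j, cabs (t 0 j) <= h) ->
  (forall j, expandable (cabs (v 0 j)) h (k 0 j)) ->
  abs_sum (fun l => RB v k l * mono t l) (mono (v + t) k).
Proof.
move=> th hk.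
have H : abs_sum (fun l : 'rV[int]_r => \prod_j (rb (v 0 j) (k 0 j) (l 0 j) * t 0 j ^ l 0 j))
    (\prod_j (v 0 j + t 0 j) ^ k 0 j).
  apply: (abs_sum_prod (f := fun (j : 'I_r) (l : int) => rb (v 0 j) (k 0 j) l * t 0 j ^ l)) => j.
  apply: rb_abs_sum; move: (hk j); rewrite /expandable => /orP[->//|hv].
  by rewrite (le_lt_trans (th j) hv) orbT.
move: H; congr (abs_sum _ _); last by apply: eq_bigr => j _; rewrite mxE.
by apply/funext => l; rewrite big_split.
Qed.

Lemma Rec_pair v t (h : R) u : 0 <= h -> (forall j, cabs (t 0 j) <= h) -> recable v h u ->
  abs_summable (fun p : 'rV[int]_r * 'rV[int]_r => u p.1 * (RB v p.1 p.2 * mono t p.2)).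
Proof.
move=> h0 th [hk [M hM]]; apply: (abs_summable_pair (M := fun k => cabs (u k) * majmono v h k)) hM.
move=> k s us /=; under eq_bigr do rewrite cabsM.
rewrite -mulr_sumr; have [->|uk] := eqVneq (u k) 0; first by rewrite cabs0 !mul0r.
by rewrite ler_wpM2l ?cabs_ge0 // RB_sum_le //; exact: hk.
Qed.

Lemma Rec_psm v (h : R) u l : 0 < h -> recable v h u -> abs_summable (fun k => u k * RB v k l).
Proof.
move=> h0 hu; pose t : 'rV[C]_r := \row_j (h%:C)%C.
have th j : cabs (t 0 j) <= h by rewrite mxE cabs_real gtr0_norm.
have ht : torus t.
  by move=> j; rewrite -cabs_gt0 mxE cabs_real normr_gt0 gt_eqF.
have := abs_summable_snd l (Rec_pair (ltW h0) th hu) => /=.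
move/(abs_summableZ (mono t l)^-1); congr abs_summable; apply/funext => k.
by rewrite [u k * _]mulrA mulrC mulfK ?mono_neq0.
Qed.

(** Interchange of summations in the double series: the monomials are expanded, then the powers of t
    are collected. *)
Lemma Rec_val v t (h : R) u : 0 < h -> (forall j, cabs (t 0 j) <= h) -> recable v h u ->
  abs_sum (fun l => Rec v u l * mono t l) (csum (fun k => u k * mono (v + t) k)) /\
  abs_summable (fun k => u k * mono (v + t) k).
Proof.
move=> h0 th hu.
have hp := Rec_pair (ltW h0) th hu.
have [] := @fubini_swap R _ _ (fun k l => u k * (RB v k l * mono t l)) hp.
have -> : (fun k => csum (fun l => u k * (RB v k l * mono t l))) = (fun k => u k * mono (v + t) k).
  apply/funext => k; have [uk|uk] := eqVneq (u k) 0.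
    apply: abs_sumE; rewrite uk mul0r; under eq_fun do rewrite mul0r; exact: abs_sum0.
  apply: abs_sumE; apply: abs_sumZ; apply: RB_abs_sum th _; exact: hu.1.
have -> : (fun l => csum (fun k => u k * (RB v k l * mono t l))) = (fun l => Rec v u l * mono t l).
  apply/funext => l; rewrite /Rec mulrC -csumZ; last exact: Rec_psm h0 hu.
  by congr csum; apply/funext => k; rewrite mulrA mulrC.
by move=> h1 h2 ->; split=> //; exact: csumP.
Qed.

Definition shift_ok v u := forall k, u k != 0 -> forall j, (0 <= k 0 j) || (v 0 j != 0).

Lemma recable_shift_ok v (h : R) u : 0 <= h -> recable v h u -> shift_ok v u.
Proof.
move=> h0 [hk _] k uk j; case/orP: (hk k uk j) => [->//|hv].
by rewrite -cabs_gt0 (le_lt_trans h0 hv) orbT.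
Qed.

Lemma rV_shift_abs_sum (d : 'rV[int]_r) u (a : C) :
  abs_sum u a -> abs_sum (fun k => u (k + d)) a.
Proof.
apply: (@abs_sum_inj _ _ _ (fun k => k + d)) => [|k _]; first exact: addIr.
by exists (k - d); rewrite subrK.
Qed.

Lemma RB_prodE v k l j : RB v k l = rb (v 0 j) (k 0 j) (l 0 j) *
  \prod_(i | i != j) rb (v 0 i) (k 0 i) (l 0 i).
Proof. by rewrite /RB (bigD1 j). Qed.

Lemma RB_other v k l j (c d : int) :
  RB v (k + c *: delta_mx 0 j) (l + d *: delta_mx 0 j) = rb (v 0 j) (k 0 j + c) (l 0 j + d) *
  \prod_(i | i != j) rb (v 0 i) (k 0 i) (l 0 i).
Proof.
rewrite (RB_prodE _ _ _ j); congr (_ * _); first by rewrite !mxE !eqxx !mulr1.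
by apply: eq_bigr => i /negbTE ij; rewrite !mxE ij !mulr0 !addr0.
Qed.

Let e j : 'rV[int]_r := delta_mx 0 j.

Lemma RBS v k l j : (0 <= k 0 j) || (v 0 j != 0) ->
  RB v (k + e j) l = v 0 j * RB v k l + RB v k (l - e j).
Proof.
move=> h; have := RB_other v k l j 1 0; rewrite scale1r scale0r !addr0 => ->.
have := RB_other v k l j 0 (-1); rewrite scale0r addr0 scaleN1r addr0 => ->.
by rewrite (RB_prodE v k l j) rbS // mulrDl mulrA.
Qed.

Lemma RB_deriv v k l j :
  (l 0 j + 1)%:~R * RB v k (l + e j) = (k 0 j)%:~R * RB v (k - e j) l.
Proof.
have := RB_other v k l j 0 1; rewrite scale0r addr0 scale1r addr0 => ->.
have := RB_other v k l j (-1) 0; rewrite scaleN1r scale0r !addr0 => ->.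
by rewrite !mulrA rb_deriv.
Qed.

Lemma RB_euler v k l j : (0 <= k 0 j) || (v 0 j != 0) ->
  (k 0 j)%:~R * RB v k l = v 0 j * ((l 0 j + 1)%:~R * RB v k (l + e j)) + (l 0 j)%:~R * RB v k l.
Proof.
move=> h; rewrite RB_deriv.
have := RB_other v k l j (-1) 0; rewrite scaleN1r scale0r !addr0 => ->.
rewrite (RB_prodE v k l j) !mulrA -mulrDl; congr (_ * _).
by rewrite rb_euler ?mulrA //; move: h; rewrite le_eqVlt eq_sym; case: (_ == 0); rewrite ?orbT ?orbF.
Qed.

Lemma Rec_shift v u l j : shift_ok v u -> (forall l, abs_summable (fun k => u k * RB v k l)) ->
  abs_sum (fun k => u (k - e j) * RB v k l) (v 0 j * Rec v u l + Rec v u (l - e j)).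
Proof.
move=> ok hu.
have := abs_sumD (abs_sumZ (v 0 j) (csumP (hu l))) (csumP (hu (l - e j))).
move/(rV_shift_abs_sum (- e j)); congr (abs_sum _ _); apply/funext => k.
have [->|uk] := eqVneq (u (k - e j)) 0; first by rewrite !mul0r mulr0 addr0.
have := @RBS v (k - e j) l j (ok _ uk j); rewrite subrK => ->.
by rewrite mulrDr mulrCA.
Qed.

(* The operator t_j d/dt_j, t = w + tau, on the coefficients of a series in tau. *)
Definition er w j u l : C :=
  w 0 j * (l 0 j + 1)%:~R * u (l + e j) + (l 0 j)%:~R * u l.

(** The operator is the same before and after recentering; only its expression changes, with the
    center passing from w_j to w_j + v_j. *)
Lemma Rec_er v w u l j : shift_ok v u -> (forall l, abs_summable (fun k => u k * RB v k l)) ->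
  abs_sum (fun k => er w j u k * RB v k l) (er (w + v) j (Rec v u) l).
Proof.
move=> ok hu.
have h1 := abs_sumZ (w 0 j * (l 0 j + 1)%:~R) (csumP (hu (l + e j))).
have h2 := abs_sumZ (v 0 j * (l 0 j + 1)%:~R) (csumP (hu (l + e j))).
have h3 := abs_sumZ (l 0 j)%:~R (csumP (hu l)).
have := abs_sumD (rV_shift_abs_sum (e j) h1) (abs_sumD h2 h3).
rewrite addrA -mulrDl -mulrDl /er [(w + v) 0 j]mxE; congr (abs_sum _ _); apply/funext => k.
rewrite mulrDl; congr (_ + _).
  have := @RB_deriv v (k + e j) l j; rewrite addrK mxE [delta_mx _ _ _ _]mxE !eqxx => E.
  transitivity (w 0 j * u (k + e j) * ((l 0 j + 1)%:~R * RB v (k + e j) (l + e j))); first by ring.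
  by rewrite E /=; ring.
have [->|uk] := eqVneq (u k) 0; first by rewrite !mul0r !mulr0 mul0r addr0.
rewrite [RHS]mulrAC (RB_euler _ (ok _ uk j)); by ring.
Qed.

End Rec.

(** * Families of diagonals and their local growth *)

Section Family.
Variable R : realType.
Local Notation C := R[i].
Variables (n r N : nat) (al : 'I_N -> 'rV[int]_n) (ac : 'I_N -> C) (Q : 'M[int]_(r, n)).

Definition dotv (be : 'rV[int]_n) (x : 'cV[C]_n) : C := \sum_i (be 0 i)%:~R * x i 0.

(* The relations between the Q-diagonals y k be of z^be / f^(k+1), f = sum_i ac i z^(al i),
   written for coefficients of expansions around w (w = 0 for Laurent series).
   fr0: multiplication by z^(q_j) is multiplication by t_j = w_j + (t_j - w_j);
   fr1: z^be / f^(k+1) = z^be f / f^(k+2);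
   fr2: Leibniz rule for the derivation sum_i x_i z_i d/dz_i, which acts on diagonals as
        sum_j (q_j . x) t_j d/dt_j. *)
Record diag_rel (w : 'rV[C]_r) (y : nat -> 'rV[int]_n -> 'rV[int]_r -> C) : Prop := Diag_rel {
  fr0 : forall k be j l, y k (be + row j Q) l = w 0 j * y k be l + y k be (l - delta_mx 0 j);
  fr1 : forall k be l, y k be l = \sum_i ac i * y k.+1 (be + al i) l;
  fr2 : forall x k be l, \sum_j dotv (row j Q) x * er w j (y k be) l =
     dotv be x * y k be l - k.+1%:R * \sum_i dotv (al i) x * ac i * y k.+1 (be + al i) l }.

Lemma diag_rel_Rec w v y : (forall k be, shift_ok v (y k be)) ->
  (forall k be l, abs_summable (fun m => y k be m * RB v m l)) ->
  diag_rel w y -> diag_rel (w + v) (fun k be => Rec v (y k be)).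
Proof.
move=> ok hs [h0 h1 h2]; split.
- move=> k be j l; apply: abs_sumE.
  have := abs_sumD (abs_sumZ (w 0 j) (csumP (hs k be l))) (Rec_shift l j (ok k be) (hs k be)).
  rewrite mxE mulrDl -addrA; congr (abs_sum _ _); apply/funext => m.
  by rewrite h0 mulrDl mulrA.
- move=> k be l; apply: abs_sumE.
  have := @abs_sum_sum R _ _ (index_enum 'I_N) xpredT _ _
    (fun i _ => abs_sumZ (ac i) (csumP (hs k.+1 (be + al i) l))).
  congr (abs_sum _ _); apply/funext => m.
  by rewrite h1 mulr_suml; apply: eq_bigr => i _; rewrite mulrA.
- move=> x k be l.
  have a1 := @abs_sum_sum R _ _ (index_enum 'I_r) xpredT _ _
    (fun j _ => abs_sumZ (dotv (row j Q) x) (Rec_er w l j (ok k be) (hs k be))).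
  have a2 := @abs_sum_sum R _ _ (index_enum 'I_N) xpredT _ _
    (fun i _ => abs_sumZ (dotv (al i) x * ac i) (csumP (hs k.+1 (be + al i) l))).
  have a3 := abs_sumB (abs_sumZ (dotv be x) (csumP (hs k be l))) (abs_sumZ k.+1%:R a2).
  rewrite -(abs_sumE a1) -(abs_sumE a3); congr csum; apply/funext => m.
  transitivity ((\sum_j dotv (row j Q) x * er w j (y k be) m) * RB v m l).
    by rewrite mulr_suml; apply: eq_bigr => j _; rewrite mulrA.
  rewrite h2 mulrBl mulrA; congr (_ - _); rewrite -mulrA mulr_suml; congr (_ * _).
  by apply: eq_bigr => i _; rewrite !mulrA.
Qed.
End Family.

(** * Local bounds for solutions of the diagonal relations *)

Section Local.
Variable R : realType.
Local Notation C := R[i].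
Variables (n r N : nat) (al : 'I_N -> 'rV[int]_n) (ac : 'I_N -> C) (Q : 'M[int]_(r, n)).
Local Notation diag_rel := (diag_rel al ac Q).
Implicit Types (u : 'rV[int]_r -> C) (l : 'rV[int]_r) (S : int) (h : R).

Definition wdeg l : int := \sum_j l 0 j.

Lemma wdegD l l' : wdeg (l + l') = wdeg l + wdeg l'.
Proof. by rewrite /wdeg -big_split; apply: eq_bigr => j _; rewrite mxE. Qed.

Lemma wdeg_delta j : wdeg (delta_mx 0 j) = 1.
Proof.
rewrite /wdeg (bigD1 j) //= mxE !eqxx big1 ?addr0 // => i /negbTE ij; by rewrite mxE ij.
Qed.

Definition nnsupp u := forall l j, l 0 j < 0 -> u l = 0.

(** A majorant on the polydisc of radius h, truncated at total degree S. Truncation makes some bound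
    available at once, see [bnd_ex]; the point of the estimates is that their constants do not
    depend on S. *)
Definition bnd h S (X : R) u := forall l, wdeg l <= S -> cabs (u l) * h ^ wdeg l <= X.

Lemma bndD h S X Y u v : 0 < h -> bnd h S X u -> bnd h S Y v -> bnd h S (X + Y) (fun l => u l + v l).
Proof.
move=> h0 hu hv l hl; apply: le_trans (_ : (cabs (u l) + cabs (v l)) * h ^ wdeg l <= _).
  by rewrite ler_wpM2r ?ler_cabsD // exprz_ge0 // ltW.
by rewrite mulrDl lerD ?hu ?hv.
Qed.

Lemma bndZ h S X (c : C) u : bnd h S X u -> bnd h S (cabs c * X) (fun l => c * u l).
Proof. by move=> hu l hl; rewrite cabsM -mulrA ler_wpM2l ?cabs_ge0 ?hu. Qed.

Lemma bndN h S X u : bnd h S X u -> bnd h S X (fun l => - u l).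
Proof. by move=> hu l hl; rewrite cabsN hu. Qed.

Lemma bnd_sum h S (I : eqType) (s : seq I) (X : I -> R) (u : I -> 'rV[int]_r -> C) : 0 < h ->
  (forall i, i \in s -> bnd h S (X i) (u i)) ->
  bnd h S (\sum_(i <- s) X i) (fun l => \sum_(i <- s) u i l).
Proof.
move=> h0; elim: s => [|i s IH] hu l hl; first by rewrite !big_nil cabs0 mul0r.
have hs : forall i', i' \in s -> bnd h S (X i') (u i').
  by move=> i' hi'; apply: hu; rewrite inE hi' orbT.
have hi : bnd h S (X i) (u i) by apply: hu; rewrite inE eqxx.
by rewrite !big_cons; exact: (bndD h0 hi (IH hs)).
Qed.

Lemma bnd_le h S X Y u : X <= Y -> bnd h S X u -> bnd h S Y u.
Proof. by move=> XY hu l hl; exact: le_trans (hu l hl) XY. Qed.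

Lemma bnd_shift h S X u j : 0 < h -> bnd h S X u -> bnd h S (h * X) (fun l => u (l - delta_mx 0 j)).
Proof.
move=> h0 hu l hl; have e : wdeg l = 1 + wdeg (l - delta_mx 0 j).
  by have := wdegD (l - delta_mx 0 j) (delta_mx 0 j); rewrite subrK wdeg_delta addrC.
rewrite e expfzDr ?gt_eqF // expr1z mulrCA ler_pM2l // hu //.
by move: hl; rewrite e; lia.
Qed.

Lemma bnd_ex h S u : 0 < h -> nnsupp u -> exists2 X, 0 <= X & bnd h S X u.
Proof.
move=> h0 hu.
pose F (f : {ffun 'I_r -> 'I_(`|S|%N.+1)}) : 'rV[int]_r := \row_j (f j : nat)%:Z.
have T0 f : 0 <= cabs (u (F f)) * h ^ wdeg (F f) by rewrite mulr_ge0 ?cabs_ge0 // exprz_ge0 // ltW.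
exists (\sum_f cabs (u (F f)) * h ^ wdeg (F f)); first exact: sumr_ge0.
move=> l hl; have [/forallP lp|] := boolP [forall j, 0 <= l 0 j]; last first.
  rewrite negb_forall => /existsP[j]; rewrite -ltNge => /hu ->.
  by rewrite cabs0 mul0r; apply: sumr_ge0.
have lS j : (absz (l 0%R j) < (absz S).+1)%N.
  have : l 0 j <= wdeg l.
    by rewrite /wdeg (bigD1 j) //= lerDl sumr_ge0.
  by have := lp j; move: hl; lia.
rewrite (bigD1 [ffun j => Ordinal (lS j)]) //=.
have -> : F [ffun j => Ordinal (lS j)] = l.
  by apply/rowP => j; rewrite mxE ffunE /=; have := lp j; lia.
by rewrite lerDl; apply: sumr_ge0.
Qed.

(** For a word s in the indices of t, [st s t] is the monomial t^s, and [sQ s] is the exponent in z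
    of the matching product of the z^(q_j). *)
Definition sQ (s : seq 'I_r) : 'rV[int]_n := \sum_(j <- s) row j Q.
Definition st (s : seq 'I_r) (t : 'rV[C]_r) : C := \prod_(j <- s) t 0 j.

(** Multiplication by z^(q_j) acts as w_j plus a shift. Since w_j is close to t_j and the shift has
    norm at most h for the truncated majorant, the product over s acts as the number t^s up to a
    small operator. *)
Lemma bnd_sQ (t : 'rV[C]_r) (s : seq 'I_r) (e : R) : 0 < e -> exists2 d : R, 0 < d &
  forall (w : 'rV[C]_r) h, (forall j, cabs (w 0 j - t 0 j) <= d) -> 0 < h -> h <= d ->
  forall y, diag_rel w y -> forall k be S (X : R), 0 <= X -> bnd h S X (y k be) ->
  bnd h S (e * X) (fun l => y k (be + sQ s) l - st s t * y k be l).
Proof.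
elim: s e => [|j s IH] e e0.
  exists 1 => // w h _ h0 _ y _ k be S X X0 _ l _.
  by rewrite /sQ /st !big_nil addr0 mul1r subrr cabs0 mul0r mulr_ge0 // ltW.
have tj0 := cabs_ge0 (t 0 j); have P0 := cabs_ge0 (st s t).
have [|d0 d00 IHd] := IH (Num.min 1 (e / (2 * (cabs (t 0 j) + 1)))).
  by rewrite lt_min ltr01 /= divr_gt0 // mulr_gt0 // ltr_wpDl.
set e' := Num.min _ _ in IHd.
have e'0 : 0 < e' by rewrite /e' lt_min ltr01 /= divr_gt0 // mulr_gt0 // ltr_wpDl.
have e'1 : e' <= 1 by rewrite ge_min lexx.
have e'2 : e' * (2 * (cabs (t 0 j) + 1)) <= e.
  by rewrite -ler_pdivlMr ?ge_min ?lexx ?orbT // mulr_gt0 // ltr_wpDl.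
(* With x = |w_j - t_j|, P = |t^s| and T = |t_j|, the new error is (x + h)(e' + P) + T e'. As e' <=
   1, bounding x and h by e/(4(P + 1)) keeps the first term below e/2; e' <= e/(2(T + 1)) does the
   same for the second. *)
exists (Num.min d0 (e / (4 * (cabs (st s t) + 1)))).
  by rewrite lt_min d00 /= divr_gt0 // mulr_gt0 // ltr_wpDl.
move=> w h hw h0 hd y hy k be S X X0 hX.
have [hd0 hd1] : h <= d0 /\ h * (4 * (cabs (st s t) + 1)) <= e.
  move: hd; rewrite le_min => /andP[-> h2]; split => //.
  by rewrite -ler_pdivlMr // mulr_gt0 // ltr_wpDl.
have {}hw i : cabs (w 0 i - t 0 i) <= d0 /\ cabs (w 0 i - t 0 i) * (4 * (cabs (st s t) + 1)) <= e.
  move: (hw i); rewrite le_min => /andP[-> h2]; split => //.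
  by rewrite -ler_pdivlMr // mulr_gt0 // ltr_wpDl.
have H1 := IHd w h (fun i => (hw i).1) h0 hd0 y hy k be S X X0 hX.
have H2 : bnd h S ((e' + cabs (st s t)) * X) (y k (be + sQ s)).
  have := bndD h0 H1 (bndZ (st s t) hX); rewrite -mulrDl.
  by congr (bnd _ _ _ _); apply/funext => l; rewrite subrK.
have := bndD h0 (bndD h0 (bndZ (w 0 j - t 0 j) H2) (bnd_shift j h0 H2)) (bndZ (t 0 j) H1).
have -> : (fun l => (w 0 j - t 0 j) * y k (be + sQ s) l + y k (be + sQ s) (l - delta_mx 0 j) +
   t 0 j * (y k (be + sQ s) l - st s t * y k be l)) =
   (fun l => y k (be + sQ (j :: s)) l - st (j :: s) t * y k be l).
  apply/funext => l; rewrite /sQ big_cons [row j Q + _]addrC addrA (fr0 hy).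
  by rewrite /st big_cons -/(sQ s) -/(st s t); ring.
apply: bnd_le; rewrite !mulrA -!mulrDl; apply: ler_wpM2r => //.
have := (hw j).2; have := cabs_ge0 (w 0 j - t 0 j); move: (cabs (w 0 j - t 0 j)) => x x0 hx.
move: (cabs (t 0 j)) (cabs (st s t)) tj0 P0 e'1 e'2 hd1 hx => T P T0 P0 e1 e2 k1 k2.
have a1 : (x + h) * (e' + P) <= (x + h) * (1 + P).
  by rewrite ler_wpM2l ?lerD2r // addr_ge0 // ltW.
rewrite [x * _]mulrC [h * _]mulrC in k1 k2.
by move: e'0 a1 k1 k2 e2; clear; rewrite !mulrDr !mulrDl !mulr1; lra.
Qed.

Lemma bnd_sQ_all (t : 'rV[C]_r) (L : seq (seq 'I_r)) (e : R) : 0 < e -> exists2 d : R, 0 < d &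
  forall (w : 'rV[C]_r) h, (forall j, cabs (w 0 j - t 0 j) <= d) -> 0 < h -> h <= d ->
  forall y, diag_rel w y -> forall s, s \in L -> forall k be S (X : R), 0 <= X -> bnd h S X (y k be) ->
  bnd h S (e * X) (fun l => y k (be + sQ s) l - st s t * y k be l).
Proof.
move=> e0; elim: L => [|s L [d d0 IH]]; first by exists 1.
have [d' d'0 H] := bnd_sQ t s e0; exists (Num.min d d'); first by rewrite lt_min d0.
move=> w h hw h0; rewrite le_min => /andP[hd hd'] y hy s'; rewrite inE => /orP[/eqP->|s'L].
  by apply: H hy => // j; apply: le_trans (hw j) _; rewrite ge_min lexx orbT.
by apply: IH hy _ s'L => // j; apply: le_trans (hw j) _; rewrite ge_min lexx.
Qed.

Definition wsum (s : seq 'I_N) : 'rV[int]_n := \sum_(i <- s) al i.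

(* In every family satisfying the diagonal relations, the members indexed by words of length
   K+1 satisfy, uniformly in the level p and the base exponent be, a linear system with matrix
   sum_e e.1 t^e.2, whose right-hand side only involves words of length K. *)
Definition cert K (H : K.+1.-tuple 'I_N -> K.+1.-tuple 'I_N -> seq (C * seq 'I_r)) : Prop :=
  forall p be, exists Nc : K.+1.-tuple 'I_N -> K.-tuple 'I_N -> C,
  forall w y, diag_rel w y -> forall mu l,
    \sum_nu \sum_(e <- H mu nu) e.1 * y (p + K.+1)%N (be + wsum nu + sQ e.2) l =
    \sum_nu Nc mu nu * y (p + K)%N (be + wsum nu) l.

Definition hev K (H : K.+1.-tuple 'I_N -> K.+1.-tuple 'I_N -> seq (C * seq 'I_r)) t mu nu : C :=
  \sum_(e <- H mu nu) e.1 * st e.2 t.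

Definition hmat K (H : K.+1.-tuple 'I_N -> K.+1.-tuple 'I_N -> seq (C * seq 'I_r)) t :
    'M[C]_#|{: K.+1.-tuple 'I_N}| :=
  \matrix_(i, j) hev H t (enum_val i) (enum_val j).

(** Only the invertibility depends on t: the certificate holds for all centers, so nearby points and
    whole curves can share it. *)
Definition good t := exists K H, @cert K H /\ hmat H t \in unitmx.

Lemma hmat_inv K H t : @hmat K H t \in unitmx -> exists G : K.+1.-tuple 'I_N -> K.+1.-tuple 'I_N -> C,
  forall xi nu, \sum_mu G xi mu * hev H t mu nu = (xi == nu)%:R.
Proof.
move=> hu; exists (fun xi mu => invmx (hmat H t) (enum_rank xi) (enum_rank mu)) => xi nu.
have /matrixP /(_ (enum_rank xi) (enum_rank nu)) := mulVmx hu.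
rewrite !mxE (inj_eq enum_rank_inj) => <-.
rewrite (reindex_onto enum_val enum_rank) /=; last by move=> i _; rewrite enum_rankK.
apply: eq_big => [i|i _]; first by rewrite enum_valK eqxx.
by rewrite enum_valK mxE enum_rankK.
Qed.

(** Near t, a member shifted by [sQ s] may be replaced by t^s times the unshifted one, at the cost
    of the error of [bnd_sQ]. Inverting the matrix then isolates the words of length K+1 and bounds
    them by half of their own bound plus a multiple of that for length K. *)
Lemma self_bound K H t : @cert K H -> hmat H t \in unitmx -> exists2 d : R, 0 < d &
  forall p be, exists2 Cc : R, 0 <= Cc & forall (w : 'rV[C]_r) h,
  (forall j, cabs (w 0 j - t 0 j) <= d) -> 0 < h -> h <= d ->
  forall y, diag_rel w y -> forall S (X Y : R), 0 <= X -> 0 <= Y ->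
  (forall nu : K.+1.-tuple 'I_N, bnd h S X (y (p + K.+1)%N (be + wsum nu))) ->
  (forall nu : K.-tuple 'I_N, bnd h S Y (y (p + K)%N (be + wsum nu))) ->
  forall nu : K.+1.-tuple 'I_N, bnd h S (X / 2 + Cc * Y) (y (p + K.+1)%N (be + wsum nu)).
Proof.
move=> hc /hmat_inv[G hG].
pose T := \sum_xi \sum_mu cabs (G xi mu) * \sum_nu \sum_(e <- H mu nu) cabs e.1.
have T1 xi : 0 <= \sum_mu cabs (G xi mu) * \sum_nu \sum_(e <- H mu nu) cabs e.1.
  apply: sumr_ge0 => mu _; rewrite mulr_ge0 ?cabs_ge0 //.
  by apply: sumr_ge0 => nu _; apply: sumr_ge0 => e _; rewrite cabs_ge0.
have T0 : 0 <= T by apply: sumr_ge0 => xi _.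
(* [T] is the total weight of the inverse matrix against the entries of [H]; this tolerance keeps
   the accumulated error below X/2. *)
have e0 : 0 < (2 * (T + 1))^-1 :> R by rewrite invr_gt0 mulr_gt0 // ltr_wpDl.
pose L := flatten [seq [seq e.2 | e <- H mu.1 mu.2] | mu <- enum {: K.+1.-tuple 'I_N * K.+1.-tuple 'I_N}].
have [d d0 hd] := bnd_sQ_all t L e0.
exists d => // p be; have [Nc hN] := hc p be.
exists (\sum_xi \sum_mu cabs (G xi mu) * \sum_nu cabs (Nc mu nu)).
  apply: sumr_ge0 => xi _; apply: sumr_ge0 => mu _; rewrite mulr_ge0 ?cabs_ge0 //.
  by apply: sumr_ge0 => nu _; rewrite cabs_ge0.
move=> w h hw h0 hhd y hy S X Y X0 Y0 hX hY xi.
pose yy nu l := y (p + K.+1)%N (be + wsum nu) l.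
pose yQ nu s l := y (p + K.+1)%N (be + wsum nu + sQ s) l.
pose z nu l := y (p + K)%N (be + wsum nu) l.
have E : y (p + K.+1)%N (be + wsum xi) = (fun l =>
   \sum_mu G xi mu * (\sum_(nu : K.+1.-tuple 'I_N) \sum_(e <- H mu nu) e.1 * (-1 * (yQ nu e.2 l - st e.2 t * yy nu l))) +
   \sum_mu G xi mu * (\sum_(nu : K.-tuple 'I_N) Nc mu nu * z nu l)).
  apply/funext => l; rewrite -big_split /=.
  transitivity (\sum_mu G xi mu * \sum_(nu : K.+1.-tuple 'I_N) hev H t mu nu * yy nu l); last first.
    apply: eq_bigr => mu _; rewrite -mulrDr; congr (_ * _).
    rewrite /z -(hN w y hy mu l) -big_split /=; apply: eq_bigr => nu _.
    rewrite /hev mulr_suml -big_split /=; apply: eq_bigr => e _.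
    by rewrite /yQ; ring.
  under eq_bigr do rewrite mulr_sumr; rewrite exchange_big /=.
  transitivity (\sum_(nu : K.+1.-tuple 'I_N) (xi == nu)%:R * yy nu l).
    rewrite (bigD1 xi) //= eqxx mul1r big1 ?addr0 // => nu; rewrite eq_sym => /negbTE ->.
    by rewrite mul0r.
  apply: eq_bigr => nu _; rewrite -hG mulr_suml; apply: eq_bigr => mu _; by rewrite mulrA.
rewrite E; apply: bndD => //.
  apply: bnd_le (bnd_sum h0 (s := index_enum {: K.+1.-tuple 'I_N}) (X := fun mu => cabs (G xi mu) *
     (\sum_(nu : K.+1.-tuple 'I_N) \sum_(e <- H mu nu) cabs e.1 * (cabs (-1) * ((2 * (T + 1))^-1 * X)))) _).
    rewrite cabsN cabs1 mul1r.
    have -> : \sum_mu cabs (G xi mu) * (\sum_(nu : K.+1.-tuple 'I_N) \sum_(e <- H mu nu) cabs e.1 * ((2 * (T + 1))^-1 * X)) =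
      (\sum_mu cabs (G xi mu) * (\sum_(nu : K.+1.-tuple 'I_N) \sum_(e <- H mu nu) cabs e.1)) * ((2 * (T + 1))^-1 * X).
      rewrite mulr_suml; apply: eq_bigr => mu _; rewrite -mulrA; congr (_ * _).
      by rewrite mulr_suml; apply: eq_bigr => nu _; rewrite mulr_suml.
    rewrite mulrA [X / 2]mulrC ler_wpM2r //.
    rewrite ler_pdivrMr ?mulr_gt0 // ?ltr_wpDl // mulrA mulVf ?pnatr_eq0 // mul1r.
    apply: le_trans (_ : T <= _); last by rewrite lerDl.
    by rewrite /T [leRHS](bigD1 xi) //= lerDl sumr_ge0.
  move=> mu _; apply: bndZ; apply: bnd_sum => // nu _; apply: bnd_sum => // e He.
  apply: bndZ; apply: bndZ; apply: hd hy _ _ _ _ _ _ _ (hX nu) => //.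
  by apply/flattenP; exists [seq e.2 | e <- H mu nu]; [apply/mapP; exists (mu, nu); rewrite ?mem_enum|exact: map_f].
apply: bnd_le (bnd_sum h0 (s := index_enum {: K.+1.-tuple 'I_N}) (X := fun mu => cabs (G xi mu) *
     (\sum_nu cabs (Nc mu nu) * Y)) _); last first.
  by move=> mu _; apply: bndZ; apply: bnd_sum => // nu _; apply: bndZ; exact: hY.
have -> : \sum_mu cabs (G xi mu) * (\sum_nu cabs (Nc mu nu) * Y) =
   (\sum_mu cabs (G xi mu) * (\sum_nu cabs (Nc mu nu))) * Y.
  by rewrite mulr_suml; apply: eq_bigr => mu _; rewrite -mulrA mulr_suml.
rewrite ler_wpM2r // [leRHS](bigD1 xi) //= lerDl; apply: sumr_ge0 => xi' _.
apply: sumr_ge0 => mu _; rewrite mulr_ge0 ?cabs_ge0 //.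
by apply: sumr_ge0 => nu _; rewrite cabs_ge0.
Qed.

Lemma half_iter (x c X : R) : (forall m : nat, x <= X / 2 ^+ m + c) -> x <= c.
Proof.
move=> H; apply/ler_addgt0Pr => e e0.
have [m hm] : exists m : nat, `|X| / e < m%:R.
  by exists (Num.bound (`|X| / e)); apply: archi_boundP; rewrite divr_ge0 // ltW.
apply: le_trans (H m) _; rewrite addrC lerD2l ler_pdivrMr ?exprn_gt0 //.
apply: le_trans (ler_norm X) _; move: hm; rewrite ltr_pdivrMr // => /ltW hm.
apply: (le_trans hm); rewrite mulrC ler_wpM2l ?(ltW e0) //.
by rewrite -natrX ler_nat ltnW // ltn_expl.
Qed.

(** Iterating [self_bound] from any X, which exists thanks to the truncation, gives X/2^m + 2 Cc Y
    for every m, as 2 Cc Y is the fixed point of x -> x/2 + Cc Y. Neither X nor S survives in the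
    constant. *)
Lemma level_bound K H t : @cert K H -> hmat H t \in unitmx -> exists2 d : R, 0 < d &
  forall p be, exists2 Cc : R, 0 <= Cc & forall (w : 'rV[C]_r) h,
  (forall j, cabs (w 0 j - t 0 j) <= d) -> 0 < h -> h <= d ->
  forall y, diag_rel w y -> (forall k be, nnsupp (y k be)) -> forall S (Y : R), 0 <= Y ->
  (forall nu : K.-tuple 'I_N, bnd h S Y (y (p + K)%N (be + wsum nu))) ->
  forall nu : K.+1.-tuple 'I_N, bnd h S (Cc * Y) (y (p + K.+1)%N (be + wsum nu)).
Proof.
move=> hc hu; have [d d0 hd] := self_bound hc hu; exists d => // p be.
have [Cc C0 hC] := hd p be; exists (2 * Cc); first by rewrite mulr_ge0.
move=> w h hw h0 hhd y hy ynn S Y Y0 hY.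
have [X X0 hX] : exists2 X : R, 0 <= X &
    forall nu : K.+1.-tuple 'I_N, bnd h S X (y (p + K.+1)%N (be + wsum nu)).
  have /choice[f hf] : forall nu : K.+1.-tuple 'I_N, exists X : R, 0 <= X /\
      bnd h S X (y (p + K.+1)%N (be + wsum nu)).
    by move=> nu; have [X a b] := bnd_ex S h0 (ynn (p + K.+1)%N (be + wsum nu)); exists X.
  exists (\sum_nu f nu); first by apply: sumr_ge0 => nu _; exact: (hf nu).1.
  move=> nu; apply: bnd_le (hf nu).2; rewrite (bigD1 nu) //= lerDl.
  by apply: sumr_ge0 => nu' _; exact: (hf nu').1.
have step m : forall nu : K.+1.-tuple 'I_N,
    bnd h S (X / 2 ^+ m + 2 * Cc * Y) (y (p + K.+1)%N (be + wsum nu)).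
  elim: m => [|m IH] nu.
    by apply: bnd_le (hX nu); rewrite expr0 divr1 lerDl !mulr_ge0.
  apply: bnd_le (hC w h hw h0 hhd y hy S _ Y _ Y0 IH hY nu).
    rewrite exprSr invfM mulrA [leRHS]addrC mulrDl; set a := X / _ / _.
    suff -> : a + 2 * Cc * Y / 2 + Cc * Y = 2 * Cc * Y + a by [].
    by field.
  by rewrite addr_ge0 ?mulr_ge0 ?invr_ge0 ?exprn_ge0.
by move=> nu l hl; apply: half_iter => m; exact: step.
Qed.

Hypothesis dual : exists U : 'I_r -> 'cV[C]_n, forall j j', dotv (row j Q) (U j') = (j == j')%:R.

Lemma er_eq w y j U : diag_rel w y -> (forall i i', dotv (row i Q) (U i') = (i == i')%:R :> C) ->
  forall k be l, er w j (y k be) l = dotv be (U j) * y k be l -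
    k.+1%:R * \sum_i dotv (al i) (U j) * ac i * y k.+1 (be + al i) l.
Proof.
move=> hy hU k be l; rewrite -(fr2 hy) (bigD1 j) //= hU eqxx mul1r big1 ?addr0 // => i /negbTE ij.
by rewrite hU ij mul0r.
Qed.

(** In [er], the coefficient of u (l + e_j) has modulus at least x (l_j + 1), while the other terms
    are at most (D + l_j) Y, hence at most 2 (l_j + 1) Y. The weight h of the additional degree
    absorbs the factor 2, because 2 h <= x, and the bound Y is reproduced exactly. *)
Lemma er_step (w : 'rV[C]_r) h (x : R) j u l (Y D : R) : 0 < h -> 0 < x -> x <= cabs (w 0 j) ->
  2 * h <= x -> 0 <= Y -> 0 <= D -> 0 <= l 0 j -> D <= (l 0 j + 1)%:~R ->
  cabs (u l) * h ^ wdeg l <= Y -> cabs (er w j u l) * h ^ wdeg l <= D * Y ->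
  cabs (u (l + delta_mx 0 j)) * h ^ wdeg (l + delta_mx 0 j) <= Y.
Proof.
move=> h0 x0 xw hx Y0 D0 lj Dl hu he.
pose m : R := (l 0 j + 1)%:~R.
have m0 : 0 < m by rewrite ltr0z ltzD1.
have lm : 0 <= ((l 0 j)%:~R : R) /\ ((l 0 j)%:~R : R) <= m by rewrite ler0z lj /m intrD lerDl.
have cm (a : int) : 0 <= a -> cabs (a%:~R : C) = a%:~R.
  by move=> a0; rewrite -(rmorph_int (real_complex R)) cabs_real ger0_norm // ler0z.
have E : w 0 j * (l 0 j + 1)%:~R * u (l + delta_mx 0 j) = er w j u l - (l 0 j)%:~R * u l.
  by rewrite /er addrK.
have := congr1 (@cabs R) E; rewrite !cabsM cm; last by rewrite addr_ge0.
rewrite -/m => E'.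
have lo : cabs (er w j u l - (l 0 j)%:~R * u l) * h ^ wdeg l <= (D + m) * Y.
  apply: le_trans (_ : (cabs (er w j u l) + cabs ((l 0 j)%:~R * u l)) * h ^ wdeg l <= _).
    by rewrite ler_wpM2r ?exprz_ge0 ?(ltW h0) // -[X in _ <= _ + X]cabsN ler_cabsD.
  rewrite !mulrDl lerD // cabsM cm // -mulrA; case: lm => lm1 lm2.
  apply: le_trans (ler_wpM2l lm1 hu) _; exact: ler_wpM2r.
have hh : 0 < h ^ wdeg l by rewrite exprz_gt0.
rewrite wdegD wdeg_delta expfzDr ?gt_eqF // expr1z.
move: lo; rewrite -E'; set a := cabs (u _); set b := h ^ _ => lo.
have ab0 : 0 <= a * b by rewrite mulr_ge0 ?cabs_ge0 // ltW.
have k1 : x * m * (a * b) <= 2 * m * Y.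
  apply: le_trans (_ : cabs (w 0 j) * m * (a * b) <= _).
    by rewrite ler_wpM2r // ler_wpM2r // ltW.
  rewrite mulrA; apply: le_trans lo _.
  by rewrite ler_wpM2r // -/m mulr2n mulrDl mul1r lerD2r.
have k2 : x * (a * b) <= 2 * Y.
  by move: k1; rewrite mulrAC [2 * m * Y]mulrAC ler_pM2r.
rewrite mulrA -(ler_pM2l x0); apply: le_trans (_ : h * (2 * Y) <= _).
  by rewrite [a * b * h]mulrC mulrCA ler_pM2l.
by rewrite mulrA [h * 2]mulrC ler_wpM2r.
Qed.

Lemma ler_sum1 (I : finType) (F : I -> R) i0 : (forall i, 0 <= F i) -> F i0 <= \sum_i F i.
Proof. by move=> F0; rewrite (bigD1 i0) //= lerDl sumr_ge0. Qed.

Lemma wdeg_big (m : nat) l : (r * m)%N%:Z < wdeg l -> exists j, m%:Z < l 0 j.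
Proof.
move=> hl; apply/existsP; apply: contraTT hl; rewrite negb_exists -leNgt => /forallP h.
apply: le_trans (_ : \sum_(j < r) m%:Z <= _).
  by apply: ler_sum => j _; rewrite leNgt h.
by rewrite sumr_const card_ord -mulr_natl natz -PoszM.
Qed.

Lemma torus_lb (t : 'rV[C]_r) : torus t -> exists2 x : R, 0 < x & forall j, x <= cabs (t 0 j).
Proof.
move=> ht; exists (\prod_j Num.min 1 (cabs (t 0 j))).
  by apply: prodr_gt0 => j _; rewrite lt_min ltr01 cabs_gt0 ht.
move=> j; rewrite (bigD1 j) //=; apply: le_trans (_ : Num.min 1 (cabs (t 0 j)) <= _).
  rewrite ler_piMr ?le_min ?ler01 ?cabs_ge0 //.
  by apply: prodr_ile1 => i _; rewrite le_min ler01 cabs_ge0 ge_min lexx.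
by rewrite ge_min lexx orbT.
Qed.

(** Induction on the degree with a single bound Y for all words of length at most K. A coefficient
    of large degree has a large exponent l_j, and [er_step] in direction j derives it from lower
    degree while lengthening words by one letter; [level_bound] brings length K+1 back to K. The
    radius depends on t only, whereas M depends on the family. *)
Lemma local_ext t : torus t -> good t -> exists2 d : R, 0 < d &
  forall w : 'rV[C]_r, (forall j, cabs (w 0 j - t 0 j) <= d) ->
  forall y, diag_rel w y -> (forall k be, nnsupp (y k be)) ->
  forall k be, exists M : R, forall l, cabs (y k be l) * d ^ wdeg l <= M.
Proof.
move=> ht [K [H [hc hu]]]; have [U hU] := dual.
have [d0 d00 hd0] := level_bound hc hu.
have [x x0 hx] := torus_lb ht.
(* With x a lower bound for the |t_j|, the fraction x/4 leaves |w_j| >= x/2 and gives 2 h <= x/2, as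
   [er_step] requires. *)
exists (Num.min d0 (x / 4)); first by rewrite lt_min d00 divr_gt0.
set h := Num.min _ _; have hd : h <= d0 by rewrite ge_min lexx.
have h4 : h <= x / 4 by rewrite ge_min lexx orbT.
have h0 : 0 < h by rewrite lt_min d00 divr_gt0.
move=> w hw y hy ynn k0 be0; have [Cc C0 hC] := hd0 k0 be0.
have hwd0 j : cabs (w 0 j - t 0 j) <= d0 by exact: le_trans (hw j) hd.
have {}hC := hC w h hwd0 h0 hd y hy ynn.
have xw j : x / 2 <= cabs (w 0 j).
  have := ler_cabsB (t 0 j) (w 0 j); rewrite cabsB => a.
  have := hw j; have := hx j; have := h4; move: a; lra.
pose Dt (i : nat) (nu : seq 'I_N) j : R := cabs (dotv (be0 + wsum nu) (U j)) +
   (k0 + i).+1%:R * \sum_i' cabs (dotv (al i') (U j) * ac i') * (1 + Cc).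
have Dt0 i nu j : 0 <= Dt i nu j.
  rewrite addr_ge0 ?cabs_ge0 // mulr_ge0 //; apply: sumr_ge0 => i' _.
  by rewrite mulr_ge0 ?cabs_ge0 // addr_ge0.
pose D := \sum_(i < K.+1) \sum_(nu : i.-tuple 'I_N) \sum_j Dt i nu j.
have DD i nu j : (i <= K)%N -> size nu = i -> Dt i nu j <= D.
  move=> iK sn; have sn' : size nu == i by apply/eqP.
  apply: le_trans (ler_sum1 (F := fun j => Dt i nu j) j _) _ => //.
  apply: le_trans (ler_sum1 (F := fun nu : i.-tuple 'I_N => \sum_j Dt i nu j) (Tuple sn') _) _.
    by move=> nu'; apply: sumr_ge0.
  apply: (ler_sum1 (F := fun i : 'I_K.+1 => \sum_(nu : i.-tuple 'I_N) \sum_j Dt i nu j) (Ordinal (iK : (i < K.+1)%N))).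
  by move=> i'; repeat (apply: sumr_ge0 => ? _).
have D0 : 0 <= D by repeat (apply: sumr_ge0 => ? _).
pose bb S (Y : R) := forall i nu, (i <= K)%N -> size nu = i -> bnd h S Y (y (k0 + i)%N (be0 + wsum nu)).
(* Beyond degree r m some l_j exceeds m, hence D. The bound Y is fixed on the finitely many
   coefficients up to that degree and then persists. *)
have [m hm] : exists m : nat, D <= m%:R.
  by exists (Num.bound D); apply/ltW/archi_boundP.
have [Y Y0 hY] : exists2 Y : R, 0 <= Y & bb (r * m)%N%:Z Y.
  have /choice[g hg] : forall s : seq 'I_N, exists X : R, 0 <= X /\
      bnd h (r * m)%N%:Z X (y (k0 + size s)%N (be0 + wsum s)).
    by move=> s; have [X a b] := bnd_ex (r * m)%N%:Z h0 (ynn (k0 + size s)%N (be0 + wsum s)); exists X.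
  have g0 s : 0 <= g s by exact: (hg s).1.
  exists (\sum_(i < K.+1) \sum_(nu : i.-tuple 'I_N) g nu); first by repeat (apply: sumr_ge0 => ? _).
  move=> i nu iK sn; have sn' : size nu == i by apply/eqP.
  have := (hg nu).2; rewrite {1}sn; apply: bnd_le.
  apply: le_trans (ler_sum1 (F := fun nu : i.-tuple 'I_N => g nu) (Tuple sn') _) _ => //.
  apply: (ler_sum1 (F := fun i : 'I_K.+1 => \sum_(nu : i.-tuple 'I_N) g nu) (Ordinal (iK : (i < K.+1)%N))).
  by move=> i'; apply: sumr_ge0.
have step (S : nat) : (r * m <= S)%N -> bb S%:Z Y -> bb S.+1%:Z Y.
  move=> mS hS i nu iK sn l' hl'.
  have [/hS|lS] := leP (wdeg l') S%:Z; first by apply.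
  have [/forallP lp|] := boolP [forall j, 0 <= l' 0 j]; last first.
    rewrite negb_forall => /existsP[j]; rewrite -ltNge => /ynn ->.
    by rewrite cabs0 mul0r.
  have [j hj] : exists j, m%:Z < l' 0 j.
    by apply: wdeg_big; apply: le_lt_trans lS; rewrite lez_nat.
  pose l := l' - delta_mx 0 j.
  have lj : l 0 j = l' 0 j - 1 by rewrite !mxE !eqxx.
  have el : l + delta_mx 0 j = l' by rewrite subrK.
  have wl : wdeg l <= S%:Z by have := wdegD l (delta_mx 0 j); rewrite el wdeg_delta; move: hl'; clear; lia.
  rewrite -el.
  have lj0 : 0 <= l 0 j by rewrite lj; move: hj; clear; lia.
  have Dl : D <= (l 0 j + 1)%:~R.
    apply: le_trans hm _; rewrite lj subrK.
    by have := ltW hj; rewrite -(ler_int R).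
  have hx2 : 2 * h <= x / 2 by move: h4; lra.
  have x20 : 0 < x / 2 by rewrite divr_gt0.
  apply: (er_step h0 x20 (xw j) hx2 Y0 D0 lj0 Dl (hS i nu iK sn l wl)).
  apply: le_trans (_ : Dt i nu j * Y <= _); last by rewrite ler_wpM2r // DD.
  rewrite (er_eq j hy hU).
  suff hb : bnd h S%:Z (Dt i nu j * Y) (fun l => dotv (be0 + wsum nu) (U j) * y (k0 + i)%N (be0 + wsum nu) l -
       (k0 + i).+1%:R * (\sum_i0 dotv (al i0) (U j) * ac i0 * y (k0 + i).+1 (be0 + wsum nu + al i0) l)).
    exact: hb l wl.
  rewrite mulrDl; apply: bndD => //; first by apply: bndZ; exact: hS.
  have -> : (k0 + i).+1%:R * (\sum_i' cabs (dotv (al i') (U j) * ac i') * (1 + Cc)) * Y =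
    cabs (k0 + i).+1%:R * \sum_i' cabs (dotv (al i') (U j) * ac i') * ((1 + Cc) * Y).
    rewrite -(rmorph_nat (real_complex R)) cabs_real ger0_norm // -mulrA mulr_suml; congr (_ * _).
    by apply: eq_bigr => i' _; rewrite mulrA.
  apply: bndN; apply: bndZ; apply: bnd_sum => // i' _; apply: bndZ.
  have -> : be0 + wsum nu + al i' = be0 + wsum (rcons nu i').
    by rewrite /wsum -cats1 big_cat big_seq1 addrA.
  rewrite -addnS; have [iK'|iK'] := ltnP i K.
    apply: bnd_le (hS i.+1 _ iK' _); last by rewrite size_rcons sn.
    by rewrite mulrDl mul1r lerDl mulr_ge0.
  (* The only length at which the additional letter leaves the range of the induction. *)
  have iKe : i = K by apply/eqP; rewrite eqn_leq iK.
  have sz : size (rcons nu i') == K.+1 by rewrite size_rcons sn iKe.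
  rewrite iKe; apply: bnd_le (hC S%:Z Y Y0 _ (Tuple sz)); first by rewrite mulrDl mul1r lerDr.
  by move=> nu'; apply: hS => //; rewrite size_tuple.
have all (S : nat) : bb (r * m + S)%N%:Z Y.
  elim: S => [|S IH]; first by rewrite addn0.
  by rewrite addnS; apply: step => //; rewrite leq_addr.
exists Y => l; have := all `|wdeg l|%N 0%N [::] isT erefl l.
rewrite addn0 /wsum big_nil addr0; apply.
by rewrite PoszD; move: (wdeg l) (r * m)%N; clear; lia.
Qed.
End Local.
Import (canonicals, coercions) mpoly.

(** * Nullstellensatz and faces *)

Section Uncountable.
Variable R : realType.

(** Countable sets are Lebesgue null and [0, 1] is not, so some fiber is infinite. *)
Lemma uncountable_fiber (f : R -> nat) : exists k, forall m : nat,
  exists xs : seq R, [/\ uniq xs, size xs = m & forall x, x \in xs -> f x = k].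
Proof.
have [k hk] : exists k, infinite_set (f @^-1` [set k]).
  apply: contrapT => /forallNP h.
  have ct : countable [set: R].
    have -> : [set: R] = \bigcup_(k in [set: nat]) (f @^-1` [set k]).
      by apply/seteqP; split => // x _; exists (f x).
    apply: bigcup_countable => // k _; apply: finite_set_countable.
    exact: contrapT (h k).
  have := @countable_lebesgue_measure0 R `[0, 1]%classic (sub_countable (subset_card_le (@subsetT _ _)) ct).
  rewrite lebesgue_measure_itv /= lte_fin ltr01 oppr0 adde0 => /eqP.
  by rewrite eqe oner_eq0.
exists k => m; have [B sB cB] := infinite_set_fset m hk.
exists (take m (finmap.enum_fset B)); split.
- by rewrite take_uniq // finmap.fset_uniq.
- by rewrite size_take_min; apply/minn_idPl.
- by move=> x /mem_take xB; apply: sB.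
Qed.
End Uncountable.

Section Null.
Variables (R : realType).
Local Notation C := R[i].
Variable S : comAlgType C.
Variables (D : nat -> nat) (e : forall d, 'I_(D d) -> S).
(** Countable dimension in the form of use: countably many finite families, one of which suffices
    for a given element. *)
Hypothesis span : forall p : S, exists d (c : 'I_(D d) -> C), p = \sum_i c i *: e i.

Record idealp (J : S -> Prop) : Prop := Idealp {
  id0 : J 0;
  idD : forall p q, J p -> J q -> J (p + q);
  idM : forall p q, J q -> J (p * q) }.

Lemma idB J p q : idealp J -> J p -> J q -> J (p - q).
Proof. by move=> hJ hp hq; apply: (idD hJ) => //; rewrite -mulN1r; apply: (idM hJ). Qed.

Lemma idZ J c p : idealp J -> J p -> J (c *: p).
Proof. by move=> hJ hp; rewrite -[p]mul1r scalerAl; apply: (idM hJ). Qed.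

Definition adj (J : S -> Prop) (a : S) : S -> Prop := fun p => exists h, J (p - a * h).

Lemma adj_ideal J a : idealp J -> idealp (adj J a).
Proof.
move=> hJ; split.
- by exists 0; rewrite mulr0 subrr; exact: id0.
- move=> p q [h hp] [h' hq]; exists (h + h'); rewrite mulrDr opprD addrACA; exact: idD.
- by move=> p q [h hq]; exists (p * h); rewrite mulrCA -mulrBr; apply: (idM hJ).
Qed.

Lemma adj_sub J a p : J p -> adj J a p.
Proof. by move=> hp; exists 0; rewrite mulr0 subr0. Qed.

Lemma adj_in J a : idealp J -> adj J a a.
Proof. by move=> hJ; exists 1; rewrite mulr1 subrr; exact: id0. Qed.

Definition avoids (J : S -> Prop) (y : S) := forall K : nat, ~ J (y ^+ K).

(** As some power of y lies in J + (g - l), a factor g - l can be traded for a power of y; root by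
    root, only a power of y remains. *)
Lemma id_prod J (y g : S) (K : nat) (rs : seq C) : idealp J ->
  (forall l : C, exists K h, J (y ^+ K - (g - l%:A) * h)) ->
  J (y ^+ K * \prod_(l <- rs) (g - l%:A)) -> exists K, J (y ^+ K).
Proof.
move=> hJ hl; elim: rs K => [|l rs IH] K; first by rewrite big_nil mulr1; exists K.
rewrite big_cons => hK; have [K' [h hh]] := hl l.
apply: (IH (K' + K)%N); rewrite exprD.
set W := \prod_(l <- rs) _ in hK *.
have -> : y ^+ K' * y ^+ K * W = (y ^+ K * W) * (y ^+ K' - (g - l%:A) * h) + h * (y ^+ K * ((g - l%:A) * W)).
  by ring.
by apply: (idD hJ); apply: (idM hJ).
Qed.

(** Otherwise each l gives y^K = (g - l) h_l modulo J. Among the uncountably many real l, infinitely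
    many share K and a finite-dimensional space containing h_l, so some of these h_l are linearly
    dependent. Clearing denominators produces a nonzero polynomial P with y^K P(g) in J, and
    [id_prod] over the roots of P puts a power of y in J. *)
Lemma null_step J (y g : S) : idealp J -> avoids J y -> exists l : C, avoids (adj J (g - l%:A)) y.
Proof.
move=> hJ av; apply: contrapT => /forallNP H.
have hl l : exists K h, J (y ^+ K - (g - l%:A) * h).
  by have /existsNP[K /contrapT[h hh]] := H l; exists K, h.
have /choice[f hf] : forall x : R, exists q : nat * nat, exists c : 'I_(D q.2) -> C,
    J (y ^+ q.1 - (g - (x%:C)%C%:A) * \sum_i c i *: e i).
  move=> x; have [K [h hh]] := hl (x%:C)%C; have [d [c hc]] := span h.
  by exists (K, d), c; rewrite -hc.
have [k hk] := uncountable_fiber (fun x => pickle (f x)).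
have [x0 [_ _ hx0]] := hk 1%N.
have [xs1 [u1 s1 h1]] := hk 1%N.
case: xs1 u1 s1 h1 => // x1 [] // _ _ h1.
have fk x : pickle (f x) = k -> f x = f x1.
  move=> fx; apply: (pcan_inj pickleK); rewrite fx h1 ?inE //.
pose K := (f x1).1; pose d := (f x1).2.
have [xs [ux sx hx]] := hk (D d).+1.
pose X (i : 'I_(D d).+1) : R := xs`_i.
have Xinj : injective X.
  by move=> i j /eqP; rewrite nth_uniq ?sx // => /eqP/val_inj.
have /choice[c hc] : forall i : 'I_(D d).+1, exists c : 'I_(D d) -> C,
    J (y ^+ K - (g - ((X i)%:C)%C%:A) * \sum_i c i *: e i).
  move=> i; have := hf (X i); rewrite (fk (X i)) //.
  by apply: hx; rewrite mem_nth ?sx.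
pose A : 'M[C]_((D d).+1, D d) := \matrix_(i, j) c i j.
have : kermx A != 0.
  rewrite -mxrank_eq0 mxrank_ker -lt0n subn_gt0.
  by apply: leq_ltn_trans (rank_leq_col A) _.
case/rowV0Pn => v /sub_kermxP vA v0.
have hv : \sum_i v 0 i *: \sum_j c i j *: e j = 0.
  under eq_bigr do rewrite scaler_sumr; rewrite exchange_big /= big1 // => j _.
  under eq_bigr do rewrite scalerA; rewrite -scaler_suml.
  have /matrixP/(_ 0 j) := vA; rewrite !mxE => E.
  have -> : \sum_i v 0 i * c i j = 0 by rewrite -[RHS]E; apply: eq_bigr => i _; rewrite mxE.
  by rewrite scale0r.
pose a i : C := ((X i)%:C)%C.
have ainj : injective a by move=> i j [] /Xinj.
(* Numerator of the sum of the fractions v_i / (X - a_i). Its value at a_i is v_i times a nonzero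
   product, so P is nonzero. *)
pose P : {poly C} := \sum_i v 0 i *: \prod_(j | j != i) ('X - (a j)%:P).
have P0 : P != 0.
  have [i vi] : exists i, v 0 i != 0 by apply/rV0Pn.
  apply: contra_neq vi => PP0.
  have : P.[a i] = 0 by rewrite PP0 horner0.
  have hz j : j != i -> (v 0 j *: \prod_(k | k != j) ('X - (a k)%:P)).[a i] = 0.
    move=> ji; rewrite hornerZ horner_prod (bigD1 i) 1?eq_sym //=.
    by rewrite hornerXsubC subrr mul0r mulr0.
  rewrite /P horner_sum (bigD1 i) //= (eq_bigr (fun=> 0 : C)) // big1_eq addr0.
  rewrite hornerZ horner_prod => /eqP; rewrite mulf_eq0 => /orP[/eqP//|].
  rewrite prodf_seq_eq0 => /hasP[j _ /andP[ji]].
  by rewrite hornerXsubC subr_eq0 => /eqP/ainj eij; rewrite eij eqxx in ji.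
have JP : J (y ^+ K * horner_alg g P).
  have hx' j : horner_alg g ('X - (a j)%:P) = g - (a j)%:A.
    by rewrite rmorphB /= horner_algX horner_algC.
  have hP : horner_alg g P = \sum_i v 0 i *: \prod_(j | j != i) (g - (a j)%:A).
    rewrite linear_sum /=; apply: eq_bigr => i _; rewrite linearZ /= rmorph_prod mulr_algl.
    by congr (_ *: _); apply: eq_bigr => j _; exact: hx'.
  have -> : y ^+ K * horner_alg g P = \sum_i (v 0 i *: \prod_(j | j != i) (g - (a j)%:A)) *
       (y ^+ K - (g - (a i)%:A) * \sum_j c i j *: e j).
    rewrite (eq_bigr (fun i => y ^+ K * (v 0 i *: \prod_(j | j != i) (g - (a j)%:A)) -
       (\prod_j (g - (a j)%:A)) * (v 0 i *: \sum_j c i j *: e j))).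
      by rewrite sumrB -!mulr_sumr hv mulr0 subr0 hP.
    move=> i _; rewrite mulrBr [y ^+ K * _]mulrC; congr (_ - _).
    rewrite mulrA -scalerAl [_ * (g - _)]mulrC [in RHS](bigD1 i) //=.
    by rewrite -scalerAl -scalerAr.
  by elim/big_ind: _ => [|p q|i _]; [exact: id0|exact: idD|apply: (idM hJ); exact: hc].
have [rs hrs] := closed_field_poly_normal P.
have l0 : lead_coef P != 0 by rewrite lead_coef_eq0.
have : J (y ^+ K * \prod_(l <- rs) (g - l%:A)).
  have := idZ (lead_coef P)^-1 hJ JP; rewrite {2}hrs linearZ /= mulr_algl -scalerAr scalerA mulVf // scale1r.
  rewrite rmorph_prod; congr (J (_ * _)); apply: eq_bigr => l _.
  by rewrite rmorphB /= horner_algX horner_algC.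
by case/(id_prod hJ hl) => K'; exact: av.
Qed.

Lemma null_list (J : S -> Prop) (y : S) (I : eqType) (s : seq I) (g : I -> S) :
  idealp J -> avoids J y -> exists (l : I -> C) (J' : S -> Prop),
  [/\ idealp J', avoids J' y, (forall p, J p -> J' p) & forall i, i \in s -> J' (g i - (l i)%:A)].
Proof.
elim: s J => [|i s IH] J hJ av; first by exists (fun=> 0), J.
have [l0 hl0] := null_step (g i) hJ av.
have [l [J' [h1 h2 h3 h4]]] := IH _ (adj_ideal (g i - l0%:A) hJ) hl0.
exists (fun j => if j == i then l0 else l j), J'; split => //.
  by move=> p /(adj_sub (g i - l0%:A)) /h3.
move=> j; rewrite inE; case: eqP => [-> _|_ /h4//].
by apply: h3; apply: adj_in.
Qed.
End Null.

Section NullMpoly.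
Variables (R : realType) (N : nat).
Local Notation C := R[i].
Local Notation S := (mpoly.mpoly N C).
Local Notation XX i := (mpoly.mpolyX C (mpoly.mnm1 i)).

Lemma mpoly_span (p : S) : exists d (c : 'I_#|{: mpoly.bmultinom N d}| -> C),
  p = \sum_i c i *: mpoly.mpolyX C (mpoly.bmnm (enum_val i)).
Proof.
exists (mpoly.mmeasure (@mpoly.mdeg N) p), (fun i => mpoly.mcoeff (mpoly.bmnm (enum_val i)) p).
rewrite {1}(mpoly.mpolywE (leqnn (mpoly.mmeasure (@mpoly.mdeg N) p))).
rewrite (reindex_onto enum_val enum_rank) /=; last by move=> i _; rewrite enum_rankK.
by apply: eq_bigl => i; rewrite enum_valK eqxx.
Qed.

(* As C is uncountable and S has countable dimension, for each variable some value can be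
   imposed without spoiling [avoids]. *)
Lemma nullstellensatz (J : S -> Prop) (i0 : 'I_N) : idealp J -> avoids J (XX i0) ->
  exists l : 'I_N -> C, l i0 != 0 /\ forall p, J p -> mpoly.meval l p = 0.
Proof.
move=> hJ av.
have [l [J' [h1 h2 h3 h4]]] := null_list mpoly_span (enum 'I_N) (fun i => XX i) hJ av.
have {}h4 i : J' (XX i - (l i)%:A) by apply: h4; rewrite mem_enum.
(* Modulo [J'] every variable is a scalar, so every polynomial is congruent to its value at [l];
   since [J'] does not contain 1, members of [J] must vanish there. *)
have key p : J' (p - (mpoly.meval l p)%:A).
  elim/mpoly.mpolyind: p => [|c m p _ _ IH].
    by rewrite mpoly.meval0 scale0r subrr; exact: id0.
  rewrite mpoly.mevalD scalerDl opprD addrACA; apply: (idD h1) IH.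
  rewrite mpoly.mevalZ -scalerA -scalerBr; apply: idZ => //.
  rewrite mpoly.mevalX mpoly.mpolyXE_id.
  elim/big_ind2: _ => [|c1 p1 c2 p2 IH1 IH2|i _].
  - by rewrite scale1r subrr; exact: id0.
  - have -> : p1 * p2 - (c1 * c2)%:A = p2 * (p1 - c1%:A) + c1 *: (p2 - c2%:A).
      rewrite -scalerA scalerBr mulrBr [p2 * p1]mulrC -scalerAr mulr1 addrA subrK //.
    apply: (idD h1); [exact: (idM h1)|exact: idZ].
  - elim: (m i) => [|k IH]; first by rewrite !expr0 scale1r subrr; exact: id0.
    have -> : XX i ^+ k.+1 - (l i ^+ k.+1)%:A = XX i ^+ k * (XX i - (l i)%:A) + l i *: (XX i ^+ k - (l i ^+ k)%:A).
      rewrite exprSr [l i ^+ k.+1]exprS -scalerA scalerBr mulrBr -scalerAr mulr1 addrA subrK //.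
    apply: (idD h1); [exact: (idM h1)|exact: idZ].
exists l; split.
  apply/eqP => l0; have := h4 i0; rewrite l0 scale0r subr0 => h.
  by apply: (h2 1%N); rewrite expr1.
move=> p Jp; apply/eqP/negPn/negP => p0.
have := idB h1 (h3 _ Jp) (key p); rewrite opprB addrC subrK => h.
by apply: (h2 0%N); rewrite expr0; have := idZ (mpoly.meval l p)^-1 h1 h; rewrite scalerA mulVf // scale1r.
Qed.
End NullMpoly.

(** * Extension of characters and integer relations *)

Section CharExt.
Variable R : realType.
Local Notation C := R[i].

Lemma int_root (d : int) (x : C) : d != 0 -> x != 0 -> exists2 y : C, y != 0 & y ^ d = x.
Proof.
move=> d0 x0.
have rt (k : nat) (z : C) : (0 < k)%N -> z != 0 -> exists2 y : C, y != 0 & y ^+ k = z.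
  move=> k0 z0; exists (k.-root z); last by rewrite rootCK.
  by apply: contraNneq z0 => e; rewrite -(rootCK k0 z) e expr0n gtn_eqF.
case: d d0 => k k0; first by have [y y0 hy] := rt k x ltac:(by rewrite lt0n) x0; exists y.
have [y y0 hy] := rt k.+1 x^-1 isT ltac:(by rewrite invr_eq0).
by exists y => //; rewrite NegzE -exprnN hy invrK.
Qed.

Lemma row_torus m q (z : 'rV[C]_q) (W : 'M[int]_(m, q)) : torus z -> torus (\row_j mono z (row j W)).
Proof. by move=> hz j; rewrite mxE mono_neq0. Qed.

(* A homomorphism from a subgroup of Z^q to the divisible group C^* extends to Z^q;
   the extension is read off the Smith normal form of a matrix of generators. *)
Lemma char_ext s q (W : 'M[int]_(s, q)) (mu : 'rV[C]_s) : torus mu ->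
  (forall m : 'rV[int]_s, m *m W = 0 -> mono mu m = 1) ->
  exists p : 'rV[C]_q, torus p /\ forall i, mono p (row i W) = mu 0 i.
Proof.
move=> hmu hW; have [L uL [P uP [d _ eW]]] := int_Smith_normal_form W.
pose D : 'M[int]_(s, q) := \matrix_(i, j) (d`_i *+ (i == j :> nat)).
have {}eW : W = L *m D *m P by [].
pose mu' := \row_i mono mu (row i (invmx L)).
have hmu' : torus mu' by exact: row_torus.
have mu'E m : mono mu' m = mono mu (m *m invmx L) by rewrite mono_mulmx.
have hD (m : 'rV[int]_s) : m *m D = 0 -> mono mu' m = 1.
  move=> hm; rewrite mu'E; apply: hW.
  by rewrite eW !mulmxA mulmxKV // hm mul0mx.
have hrow i : row i D = 0 -> mu' 0 i = 1.
  move=> h; rewrite -mono_delta; apply: hD; by rewrite -rowE.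
(* In the Smith basis, coordinate j has to be a d_j-th root of the prescribed value. Where d_j = 0
   that value is 1 by [hrow], and columns without a matching row are unconstrained. *)
have /choice[p0 hp0] : forall j : 'I_q, exists y : C, y != 0 /\
    forall i : 'I_s, i = j :> nat -> y ^ d`_i = mu' 0 i.
  move=> j; have [js|js] := ltnP j s; last first.
    exists 1; rewrite oner_eq0; split=> // i ij.
    by have := ltn_ord i; rewrite ij ltnNge js.
  have hij (i : 'I_s) : i = j :> nat -> i = Ordinal js by move=> ij; apply: val_inj.
  have [d0|d0] := eqVneq d`_j 0.
    exists 1; rewrite oner_eq0; split=> // i ij; rewrite exp1rz hrow //.
    by apply/rowP => k; rewrite !mxE ij d0 mul0rn.
  have [y y0 hy] := int_root d0 (hmu' (Ordinal js)).
  by exists y; split => // i ij; rewrite (hij _ ij).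
pose p' := \row_j p0 j.
have hp' : torus p' by move=> j; rewrite mxE; exact: (hp0 j).1.
have p'D i : mono p' (row i D) = mu' 0 i.
  have [iq|iq] := ltnP i q; last first.
    have r0 : row i D = 0.
      apply/rowP => k; rewrite !mxE; case: eqP => [e|_]; last by rewrite mulr0n.
      by have := ltn_ord k; rewrite -e ltnNge iq.
    by rewrite r0 mono0 hrow.
  have -> : row i D = d`_i *: delta_mx 0 (Ordinal iq).
    apply/rowP => k; rewrite !mxE eqxx /= -(inj_eq val_inj) /= eq_sym.
    by case: (_ == _); rewrite ?mulr1 ?mulr0.
  by rewrite monoMz mono_delta mxE; apply: (hp0 (Ordinal iq)).2.
exists (\row_j mono p' (row j (invmx P))); split; first exact: row_torus.
move=> i; rewrite -mono_mulmx // eW !row_mul mulmxK // mono_mulmx //.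
have -> : \row_j mono p' (row j D) = mu' by apply/rowP => j; rewrite mxE p'D.
rewrite mu'E -row_mul mulmxV // row1 mono_delta //.
Qed.
End CharExt.

Section RatApprox.
Variable R : realType.

Lemma rat_clear N (c : 'rV[rat]_N) : exists (M : int) (m : 'rV[int]_N), 0 < M /\
  forall i, (m 0 i)%:~R = M%:~R * c 0 i :> rat.
Proof.
exists (\prod_i denq (c 0 i)), (\row_i (numq (c 0 i) * \prod_(j | j != i) denq (c 0 j))).
split; first by apply: prodr_gt0.
move=> i; rewrite mxE [in RHS](bigD1 i) // !intrM mulrAC; congr (_ * _).
by rewrite -{3}(divq_num_den (c 0 i)) mulrC divfK // intr_eq0 denq_eq0.
Qed.

Lemma rat_approx (x e : R) : 0 < e -> exists q : rat, `|ratr q - x| < e.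
Proof.
move=> e0; have [q] := @rat_in_itvoo R (x - e) (x + e) ltac:(by lra).
by rewrite in_itv /= => /andP[a b]; exists q; rewrite ltr_norml; lra.
Qed.

(** The relations among the rows of [B] form a space defined over Q, so a real one is approximated
    by a rational one and denominators are cleared. Closeness preserves the positive entries; zero
    entries have to be imposed. *)
Lemma int_relation N q (B : 'M[int]_(N, q)) (c : 'rV[R]_N) (J : pred 'I_N) :
  c *m map_mx intr B = 0 -> (forall i, ~~ J i -> 0 <= c 0 i) ->
  exists m : 'rV[int]_N, [/\ m *m B = 0, (forall i, ~~ J i -> 0 <= m 0 i) &
    forall i, ~~ J i -> 0 < c 0 i -> 0 < m 0 i].
Proof.
move=> hc hJ.
(* Additional equations that force to 0 the entries outside [J] where [c] vanishes; approximation
   alone could make them negative. *)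
pose Z : 'M[int]_N := diag_mx (\row_i (~~ J i && (c 0 i == 0))%:Z).
pose B' := row_mx B Z.
pose Bq : 'M[rat]_(N, q + N) := map_mx intr B'.
have hB' : c *m map_mx ratr Bq = 0.
  have -> : map_mx ratr Bq = map_mx (intr : int -> R) B'.
    by apply/matrixP => i j; rewrite !mxE ratr_int.
  rewrite map_row_mx mul_mx_row hc; apply/eqP; rewrite row_mx_eq0 eqxx /=.
  apply/eqP/rowP => j; rewrite mxE (bigD1 j) //= big1 => [|i /negbTE ij].
    rewrite !mxE eqxx mulr1n addr0.
    by case: (c 0 j =P 0) => [->|_]; rewrite ?mul0r // andbF mulr0.
  by rewrite !mxE ij mulr0n mulr0.
pose K := kermx Bq.
have /submxP[d hd] : (c <= map_mx (ratr : rat -> R) K)%MS.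
  by rewrite map_kermx; apply/sub_kermxP.
(* A common lower bound for the positive entries of [c]: an error smaller than this keeps them
   positive. *)
have [e e0 he] : exists2 e : R, 0 < e & forall i, 0 < c 0 i -> e <= c 0 i.
  exists (\prod_i (if 0 < c 0 i then Num.min 1 (c 0 i) else 1)).
    by apply: prodr_gt0 => i _; case: ifP => // ci; rewrite lt_min ltr01.
  move=> i ci; rewrite (bigD1 i) //= ci.
  apply: le_trans (_ : Num.min 1 (c 0 i) <= _); last by rewrite ge_min lexx orbT.
  rewrite ler_piMr //; first by rewrite le_min ler01 ltW.
  apply: prodr_ile1 => j _; case: ifP => cj; last by rewrite ler01 lexx.
  by rewrite le_min ler01 (ltW cj) ge_min lexx.
pose T := \sum_k \sum_i `|ratr (K k i) : R|.
have T0 : 0 <= T by apply: sumr_ge0 => k _; apply: sumr_ge0.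
have e1 : 0 < e / (T + 1) by rewrite divr_gt0 // ltr_wpDl.
have /choice[d' hd'] : forall k, exists x : rat, `|ratr x - d 0 k| < e / (T + 1).
  by move=> k; exact: rat_approx.
pose c' := (\row_k d' k) *m K.
have c'B : c' *m Bq = 0 by rewrite -mulmxA mulmx_ker mulmx0.
have close i : `|ratr (c' 0 i) - c 0 i| < e.
  rewrite hd !mxE rmorph_sum -sumrB /=.
  apply: le_lt_trans (ler_norm_sum _ _ _) _.
  apply: le_lt_trans (_ : \sum_k e / (T + 1) * `|ratr (K k i) : R| < _).
    apply: ler_sum => k _; rewrite !mxE rmorphM -mulrBl normrM ler_wpM2r //.
    exact: ltW (hd' k).
  rewrite -mulr_sumr; apply: le_lt_trans (_ : e / (T + 1) * T < _).
    rewrite ler_wpM2l ?(ltW e1) //; apply: ler_sum => k _.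
    by rewrite (bigD1 i) //= lerDl sumr_ge0.
  by rewrite mulrAC ltr_pdivrMr ?ltr_wpDl // ltr_pM2l // ltrDl.
have [M [m [M0 hm]]] := rat_clear c'.
have mB' : m *m B' = 0.
  apply/matrixP => i j; rewrite mxE [RHS]mxE; apply/eqP.
  rewrite -(intr_eq0 rat) rmorph_sum /=.
  have -> : \sum_k (m i k * B' k j)%:~R = M%:~R * (c' *m Bq) i j.
    rewrite [in RHS]mxE mulr_sumr; apply: eq_bigr => k _.
    by rewrite intrM mulrA (ord1 i) hm /Bq [map_mx _ _ _ _]mxE.
  by rewrite c'B mxE mulr0.
have pos i : 0 < c 0 i -> 0 < m 0 i.
  move=> ci; rewrite -(ltr0z rat) hm mulr_gt0 ?ltr0z // -(ltr0q R).
  have := close i; have := he i ci; rewrite ltr_norml => a /andP[b _]; lra.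
have mB : m *m B = 0 /\ m *m Z = 0.
  by move/eqP: mB'; rewrite mul_mx_row row_mx_eq0 => /andP[/eqP-> /eqP->].
exists m; split; first exact: mB.1; last by move=> i _; exact: pos.
move=> i iJ; have := hJ i iJ; rewrite le_eqVlt => /orP[/eqP ci|/pos/ltW//].
have /rowP/(_ i) := mB.2; rewrite mxE (bigD1 i) //= big1 => [|j /negbTE ji]; last first.
  by rewrite !mxE ji mulr0n mulr0.
by rewrite !mxE eqxx mulr1n iJ -ci eqxx mulr1 addr0 => ->.
Qed.
End RatApprox.

(** * From a common zero to a point of the torus lying over [t] *)

Section Face.
Variable R : realType.
Local Notation C := R[i].
Variables (n r : nat) (A : seq 'rV[int]_n) (a : 'rV[int]_n -> C) (Q : 'M[int]_(r, n)).
Local Notation N := (size A).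
Definition expo (i : 'I_N) : 'rV[int]_n := nth 0 A i.
Definition coefA (i : 'I_N) : C := a (expo i).
Local Notation al := expo.
Local Notation ac := coefA.

Definition posn (z : int) : nat := if z is Posz k then k else 0%N.
Definition negn (z : int) : nat := if z is Negz k then k.+1 else 0%N.

Lemma posnB z : z = (posn z)%:Z - (negn z)%:Z.
Proof. by case: z => k /=; rewrite ?subr0 // sub0r NegzE. Qed.

Lemma exprz_posn (x : C) z : x != 0 -> x ^ z = x ^+ posn z / x ^+ negn z.
Proof. by move=> x0; case: z => k /=; rewrite ?expr0 ?divr1 // NegzE -exprnN mul1r. Qed.

Definition kseq (f : 'I_r -> nat) : seq 'I_r := flatten [seq nseq (f j) j | j <- enum 'I_r].

Lemma st_kseq (t : 'rV[C]_r) f : st (kseq f) t = \prod_j t 0 j ^+ f j.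
Proof.
rewrite /st /kseq big_flatten big_map big_enum /=; apply: eq_bigr => j _.
by rewrite big_nseq; elim: (f j) => //= k ->; rewrite exprS.
Qed.

Lemma sQ_kseq f : sQ Q (kseq f) = \sum_j (f j)%:Z *: row j Q.
Proof.
rewrite /sQ /kseq big_flatten big_map big_enum /=; apply: eq_bigr => j _.
rewrite big_nseq; elim: (f j) => /= [|k ->]; first by rewrite scale0r.
by have -> : Posz k.+1 = 1 + Posz k by []; rewrite scalerDl scale1r.
Qed.

Variables (t : 'rV[C]_r) (lam : 'I_N -> C) (i0 : 'I_N).
Hypothesis ht : torus t.
Hypothesis lam0 : lam i0 != 0.
Hypothesis bin : forall (m1 m2 : 'I_N -> nat) (s1 s2 : seq 'I_r),
  (\sum_i m1 i = \sum_i m2 i)%N ->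
  \sum_i (m1 i)%:Z *: al i + sQ Q s1 = \sum_i (m2 i)%:Z *: al i + sQ Q s2 ->
  st s1 t * \prod_i lam i ^+ m1 i = st s2 t * \prod_i lam i ^+ m2 i.
Hypothesis lin : forall (c0 : C) x, (forall j, dotv (row j Q) x = 0) ->
  \sum_i (c0 + dotv (al i) x) * ac i * lam i = 0.

Local Notation J := (fun i => lam i != 0).

Lemma lam_rel (m : 'rV[int]_N) (k : 'rV[int]_r) : \sum_i m 0 i = 0 ->
  \sum_i m 0 i *: al i + k *m Q = 0 ->
  (\prod_j t 0 j ^+ posn (k 0 j)) * \prod_i lam i ^+ posn (m 0 i) =
  (\prod_j t 0 j ^+ negn (k 0 j)) * \prod_i lam i ^+ negn (m 0 i).
Proof.
move=> h1 h2; rewrite -!st_kseq; apply: bin.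
  apply/eqP; rewrite -eqz_nat !(big_morph Posz PoszD (erefl _)) -subr_eq0 -sumrB.
  by under eq_bigr do rewrite -posnB; rewrite h1.
apply/eqP; rewrite -subr_eq0 opprD addrACA -sumrB !sQ_kseq -sumrB; apply/eqP; rewrite -[RHS]h2.
congr (_ + _); first by apply: eq_bigr => i _; rewrite -scalerBl -posnB.
by rewrite mulmx_sum_row; apply: eq_bigr => i _; rewrite -scalerBl -posnB.
Qed.

(** In the binomial relation attached to m, a positive m_i with lam_i = 0 kills one side; the other
    side then contains some lam_j = 0 with m_j < 0, against the sign hypothesis. *)
Lemma supp_int (m : 'rV[int]_N) : \sum_i m 0 i = 0 -> \sum_i m 0 i *: al i = 0 ->
  (forall i, ~~ J i -> 0 <= m 0 i) -> forall i, ~~ J i -> m 0 i = 0.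
Proof.
move=> h1 h2 hJ i iJ; have := hJ i iJ; rewrite le_eqVlt => /orP[/eqP->//|mi].
have := @lam_rel m 0 h1; rewrite mul0mx addr0 => /(_ h2).
under eq_bigr do rewrite mxE expr0.
under [X in _ = X * _]eq_bigr do rewrite mxE expr0.
rewrite !big1_eq !mul1r [LHS](bigD1 i) //=.
have -> : lam i = 0 by apply/eqP/negPn.
rewrite expr0n; have -> : (posn (m 0 i) == 0%N) = false by case: (m 0 i) mi => -[].
rewrite mul0r => /esym/eqP; rewrite prodf_seq_eq0 => /hasP[j _ /=].
rewrite expf_eq0 => /andP[nj lj].
have := hJ j; rewrite lj => /(_ isT); by case: (m 0 j) nj.
Qed.

(** Reduction to [supp_int] through [int_relation]; the constant column of [B] carries the condition
    that the coefficients sum to 0. *)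
Lemma supp_real (c : 'I_N -> R) : \sum_i c i = 0 -> \sum_i c i *: intvec R (al i) = 0 ->
  (forall i, ~~ J i -> 0 <= c i) -> forall i, ~~ J i -> c i = 0.
Proof.
move=> h1 h2 hJ i iJ; have := hJ i iJ; rewrite le_eqVlt => /orP[/eqP->//|ci].
pose B : 'M[int]_(N, 1 + n) := row_mx (const_mx 1) (\matrix_i al i).
have [||m [mB mJ mpos]] := @int_relation R N _ B (\row_i c i) J.
- rewrite map_row_mx mul_mx_row; apply/eqP; rewrite row_mx_eq0; apply/andP; split; apply/eqP.
    apply/rowP => j; rewrite !mxE -[RHS]h1; apply: eq_bigr => k _; by rewrite !mxE mulr1.
  rewrite -[RHS]h2 mulmx_sum_row; apply: eq_bigr => k _; rewrite mxE; congr (_ *: _).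
  by apply/rowP => j; rewrite !mxE.
- by move=> k kJ; rewrite mxE hJ.
have := mpos i iJ; rewrite mxE => /(_ ci).
move/eqP: mB; rewrite mul_mx_row row_mx_eq0 => /andP[/eqP m1 /eqP m2].
rewrite (supp_int _ _ mJ iJ) ?ltxx //.
  have /matrixP/(_ 0 0) := m1; rewrite !mxE => E; rewrite -[RHS]E.
  by apply: eq_bigr => k _; rewrite mxE mulr1.
by rewrite -[RHS]m2 mulmx_sum_row; apply: eq_bigr => k _; rewrite rowK.
Qed.

(* The points of the Newton polyhedron that are carried by the support J of lam. *)
Definition lface : set 'rV[R]_n := [set x | exists c : 'I_N -> R,
  [/\ forall i, 0 <= c i, \sum_i c i = 1, forall i, ~~ J i -> c i = 0 &
      x = \sum_i c i *: intvec R (al i)]].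

(** The difference of two convex representations of a point is a relation covered by [supp_real].
    Hence every representation of a point of [lface], and not just one, is carried by the support,
    which makes [lface] extremal. *)
Lemma lface_rep c : (forall i, 0 <= c i) -> \sum_i c i = 1 ->
  lface (\sum_i c i *: intvec R (al i)) -> forall i, ~~ J i -> c i = 0.
Proof.
move=> c0 c1 [d [d0 d1 dJ e]] i iJ.
have := @supp_real (fun i => c i - d i) _ _ _ i iJ; rewrite dJ // subr0; apply.
- by rewrite sumrB c1 d1 subrr.
- by under eq_bigr do rewrite scalerBl; rewrite sumrB e subrr.
- by move=> k kJ; rewrite dJ // subr0.
Qed.

Lemma delta_sum (V : lmodType R) (F : 'I_N -> V) i : \sum_k (k == i)%:R *: F k = F i.
Proof.
rewrite (bigD1 i) //= eqxx scale1r big1 ?addr0 // => k /negbTE ->; by rewrite scale0r.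
Qed.

Lemma delta_sum1 i : \sum_(k < N) (k == i)%:R = 1 :> R.
Proof. by rewrite (bigD1 i) //= eqxx big1 ?addr0 // => k /negbTE ->. Qed.

Lemma lface_al i : lface (intvec R (al i)) <-> J i.
Proof.
split=> [h|iJ].
  apply: contraT => iJ.
  have H : ((i == i)%:R : R) = 0.
    apply: (@lface_rep (fun k => (k == i)%:R)) => //; first exact: delta_sum1.
    by rewrite delta_sum.
  by move/eqP: H; rewrite eqxx oner_eq0.
exists (fun k => (k == i)%:R); split.
- by move=> k; rewrite ler0n.
- exact: delta_sum1.
- move=> k kJ; case: eqP => // e; by rewrite e iJ in kJ.
- by rewrite delta_sum.
Qed.

Lemma lface_face : is_face (newton A) lface.
Proof.
split.
- by exists (intvec R (al i0)); apply/lface_al.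
- by move=> x [c [c0 c1 cJ ->]]; exists c.
- move=> x y s [c [c0 c1 cJ ->]] [d [d0 d1 dJ ->]] /andP[s0 s1].
  exists (fun i => (1 - s) * c i + s * d i); split.
  + by move=> i; rewrite addr_ge0 ?mulr_ge0 ?subr_ge0.
  + by rewrite big_split /= -!mulr_sumr c1 d1 !mulr1 subrK.
  + by move=> i iJ; rewrite cJ // dJ // !mulr0 addr0.
  + rewrite !scaler_sumr -big_split /=; apply: eq_bigr => i _.
    by rewrite !scalerA scalerDl.
- move=> x y s [c [c0 c1 ->]] [d [d0 d1 ->]] /andP[s0 s1] h.
  have h' : forall i, ~~ J i -> (1 - s) * c i + s * d i = 0.
    apply: (@lface_rep (fun i => (1 - s) * c i + s * d i)).
    + by move=> i; rewrite addr_ge0 ?mulr_ge0 ?subr_ge0 // ltW.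
    + by rewrite big_split /= -!mulr_sumr c1 d1 !mulr1 subrK.
    + have -> : \sum_i ((1 - s) * c i + s * d i) *: intvec R (al i) =
        (1 - s) *: (\sum_i c i *: intvec R (al i)) + s *: (\sum_i d i *: intvec R (al i)).
        rewrite !scaler_sumr -big_split /=; apply: eq_bigr => i _.
        by rewrite !scalerA scalerDl.
      exact: h.
  have s10 : 0 < 1 - s by rewrite subr_gt0.
  split; [exists c; split => // i iJ|exists d; split => // i iJ]; have /eqP := h' i iJ;
    rewrite paddr_eq0 ?mulr_ge0 ?(ltW s10) ?(ltW s0) // !mulf_eq0 (gt_eqF s10) (gt_eqF s0) /= => /andP[/eqP ? /eqP ?] //.
Qed.

Lemma mono_row_mx m1 m2 (p : 'rV[C]_(m1 + m2)) (u : 'rV[int]_m1) (v : 'rV[int]_m2) :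
  mono p (row_mx u v) = mono (lsubmx p) u * mono (rsubmx p) v.
Proof.
rewrite /mono big_split_ord /=; congr (_ * _); apply: eq_bigr => i _; rewrite !mxE.
  by rewrite (unsplitK (inl _)).
by rewrite (unsplitK (inr _)).
Qed.

(** [char_ext] for the rows (1, al i), i in the support, with values lam_i, and (0, q_j) with values
    t_j. The additional coordinate counts letters: the relations known for [lam] compare words of
    equal length, so a common scalar x0 remains free. *)
Lemma lam_char : exists (x0 : C) (p : 'rV[C]_n), [/\ x0 != 0, torus p,
  (forall i, J i -> x0 * mono p (al i) = lam i) & forall j, mono p (row j Q) = t 0 j].
Proof.
(* Outside the support the row is 0 with value 1, so that the index set stays ['I_N]. *)
pose W1 : 'M[int]_(N, 1 + n) := \matrix_i (if J i then row_mx 1 (al i) else 0).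
pose W2 : 'M[int]_(r, 1 + n) := row_mx 0 Q.
pose mu1 : 'rV[C]_N := \row_i (if J i then lam i else 1).
have hmu : torus (row_mx mu1 t).
  move=> j; rewrite !mxE; case: splitP => k _; last exact: ht.
  by rewrite mxE; case: ifP => // _; rewrite oner_eq0.
have hW m : m *m col_mx W1 W2 = 0 -> mono (row_mx mu1 t) m = 1.
  rewrite -(hsubmxK m); move: (lsubmx m) (rsubmx m) => u k; rewrite mul_row_col.
  pose u' : 'rV[int]_N := \row_i (if J i then u 0 i else 0).
  have -> : u *m W1 = row_mx (\row__ \sum_i u' 0 i) (\sum_i u' 0 i *: al i).
    rewrite mulmx_sum_row.
    transitivity (\sum_i row_mx (\row_(_ < 1) u' 0 i) (u' 0 i *: al i)).
      apply: eq_bigr => i _; rewrite rowK mxE; case: ifP => _; last first.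
        rewrite scaler0 scale0r; apply/esym/eqP; rewrite row_mx_eq0 eqxx andbT.
        by apply/eqP/rowP => j; rewrite !mxE.
      by rewrite scale_row_mx; congr row_mx; apply/rowP => j; rewrite !mxE ord1 eqxx mulr1.
    apply/rowP => j; rewrite -(splitK j) summxE; case: (fintype.split j) => k' /=.
      by rewrite row_mxEl mxE; apply: eq_bigr => i _; rewrite row_mxEl mxE.
    by rewrite row_mxEr summxE; apply: eq_bigr => i _; rewrite row_mxEr.
  rewrite mul_mx_row mulmx0 add_row_mx addr0 => /eqP; rewrite row_mx_eq0 => /andP[/eqP h1 /eqP h2].
  have h1' : \sum_i u' 0 i = 0 by have /rowP/(_ 0) := h1; rewrite !mxE.
  have := lam_rel h1' h2.
  rewrite mono_row_mx row_mxKl row_mxKr /mono.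
  have -> : \prod_i mu1 0 i ^ u 0 i = (\prod_i lam i ^+ posn (u' 0 i)) / \prod_i lam i ^+ negn (u' 0 i).
    rewrite -prodf_div; apply: eq_bigr => i _; rewrite !mxE; case: ifP => iJ.
      by rewrite exprz_posn.
    by rewrite exp1rz /= !expr0 divr1.
  have -> : \prod_j t 0 j ^ k 0 j = (\prod_j t 0 j ^+ posn (k 0 j)) / \prod_j t 0 j ^+ negn (k 0 j).
    by rewrite -prodf_div; apply: eq_bigr => j _; rewrite exprz_posn.
  have n1 : \prod_j t 0 j ^+ negn (k 0 j) != 0.
    by apply/prodf_neq0 => j _; rewrite expf_neq0 // ht.
  have n2 : \prod_i lam i ^+ negn (u' 0 i) != 0.
    apply/prodf_neq0 => i _; rewrite mxE; case: ifP => iJ; first by rewrite expf_neq0.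
    by rewrite expr0 oner_eq0.
  move=> E; rewrite mulf_div [X in X / _]mulrC E [X in _ / X]mulrC divff // mulf_neq0 //.
have [P [hP hPr]] := char_ext hmu hW.
exists (P 0 (lshift n 0)), (rsubmx P); split.
- exact: hP.
- by move=> j; rewrite mxE; exact: hP.
- move=> i iJ; have := hPr (lshift r i); rewrite rowKu rowK iJ mono_row_mx row_mxEl mxE iJ => <-.
  congr (_ * _); rewrite /mono big_ord_recl big_ord0 mulr1 !mxE expr1z.
  by congr (P _ _); apply: val_inj.
- move=> j; have := hPr (rshift N j); rewrite rowKd row_mxEr => <-.
  rewrite (_ : row j W2 = row_mx 0 (row j Q)); first by rewrite mono_row_mx mono0 mul1r.
  by rewrite row_row_mx row0.
Qed.

Lemma face_sum (F : 'rV[int]_n -> C) :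
  \sum_(be <- face_supp A lface) F be = \sum_(i | J i) F (al i).
Proof.
rewrite big_filter (big_nth 0) big_mkord; apply: eq_bigl => i.
by apply/asboolP/idP => /lface_al.
Qed.

(** The scalar x0 is harmless, [lin] being linear in [lam]. With c0 = 1 and x = 0 it gives the
    vanishing of the truncation at p; with c0 = 0 and x a column of the cokernel of [Q] it places
    the Euler row in the row space of [Q], so the rank is at most r. *)
Lemma zero_in_Lset : Lset A a Q t.
Proof.
have [x0 [p [x00 hp h1 h2]]] := lam_char.
exists lface; split; first exact: lface_face.
have hm i : J i -> mono p (al i) = x0^-1 * lam i by move=> iJ; rewrite -h1 // mulKf.
have lin' c0 x : (forall j, dotv (row j Q) x = 0) ->
    \sum_(i | J i) (c0 + dotv (al i) x) * (ac i * mono p (al i)) = 0.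
  move=> hx; transitivity (x0^-1 * \sum_i (c0 + dotv (al i) x) * ac i * lam i); last by rewrite lin ?mulr0.
  rewrite mulr_sumr [RHS](bigID J) /= [X in _ = _ + X]big1 ?addr0 => [|i /negPn/eqP->].
    by apply: eq_bigr => i iJ; rewrite hm // !mulrA; ring.
  by rewrite !mulr0.
exists p; split => //.
- rewrite /lpeval face_sum; have d0 be : dotv be (0 : 'cV[C]_n) = 0.
    by rewrite /dotv big1 // => i _; rewrite [X in _ * X]mxE mulr0.
  have h0 j : dotv (row j Q) (0 : 'cV[C]_n) = 0 by exact: d0.
  rewrite -[RHS](lin' 1 0 h0); apply: eq_bigr => i _.
  by rewrite d0 addr0 mul1r.
- rewrite ltnS; pose Qc : 'M[C]_(r, n) := map_mx (fun k : int => k%:~R) Q.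
  apply: leq_trans (_ : \rank Qc <= r)%N; last exact: rank_leq_row.
  apply: mxrankS; rewrite col_mx_sub submx_refl andbT submxE; apply/eqP/rowP => k.
  rewrite mxE [RHS]mxE; set X := cokermx Qc.
  have hx j : dotv (row j Q) (col k X) = 0.
    have /matrixP/(_ j k) := mulmx_coker Qc; rewrite !mxE => E; rewrite -[RHS]E.
    by apply: eq_bigr => i _; rewrite !mxE.
  rewrite -[RHS](lin' 0 _ hx).
  transitivity (\sum_j \sum_(i | J i) ac i * (al i 0 j)%:~R * mono p (al i) * X j k).
    apply: eq_bigr => j _; rewrite mxE /dlpeval face_sum mulr_sumr mulr_suml.
    apply: eq_bigr => i _; congr (_ * _); rewrite monoB // mono_delta mulrCA; congr (_ * _).
    by rewrite mulrCA divff ?mulr1 // hp.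
  rewrite exchange_big; apply: eq_bigr => i _ /=.
  rewrite add0r /dotv mulr_suml; apply: eq_bigr => j _; rewrite [col k X j 0]mxE.
  by rewrite /coefA; ring.
- by apply/rowP => j; rewrite mxE h2.
Qed.
End Face.

(** * The ideal of polynomials that can be rewritten in lower degree *)

Section Cert.
Variable R : realType.
Local Notation C := R[i].
Variables (n r N : nat) (al : 'I_N -> 'rV[int]_n) (ac : 'I_N -> C) (Q : 'M[int]_(r, n)).
Local Notation S := (mpoly.mpoly N C).
Local Notation mon := (mpoly.multinom N).
Local Notation XX m := (mpoly.mpolyX C m).
Local Notation deg := (@mpoly.mdeg N).
Local Notation diag_rel := (diag_rel al ac Q).

Definition mal (m : mon) : 'rV[int]_n := \sum_i (m i)%:Z *: al i.

Lemma malD m1 m2 : mal (mpoly.mnm_add m1 m2) = mal m1 + mal m2.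
Proof.
rewrite /mal -big_split /=; apply: eq_bigr => i _; by rewrite mpoly.mnmDE PoszD scalerDl.
Qed.

Lemma mal0 : mal (@mpoly.mnm0 N) = 0.
Proof. by rewrite /mal big1 // => i _; rewrite mpoly.mnm0E scale0r. Qed.

Lemma mal1 i : mal (mpoly.mnm1 i) = al i.
Proof.
rewrite /mal (bigD1 i) //= mpoly.mnm1E eqxx scale1r big1 ?addr0 // => j /negbTE ji.
by rewrite mpoly.mnm1E eq_sym ji scale0r.
Qed.

(* The degree d part of p, its monomials m being replaced by F m. *)
Definition Psi (d : nat) (p : S) (F : mon -> C) : C :=
  \sum_(m : mpoly.bmultinom N d.+1 | deg m == d) mpoly.mcoeff m p * F m.

Lemma PsiD d p q F : Psi d (p + q) F = Psi d p F + Psi d q F.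
Proof. by rewrite /Psi -big_split; apply: eq_bigr => m _; rewrite mpoly.mcoeffD mulrDl. Qed.

Lemma PsiZ d c p F : Psi d (c *: p) F = c * Psi d p F.
Proof. by rewrite /Psi mulr_sumr; apply: eq_bigr => m _; rewrite mpoly.mcoeffZ mulrA. Qed.

Lemma Psi0 d F : Psi d 0 F = 0.
Proof. by rewrite /Psi big1 // => m _; rewrite mpoly.mcoeff0 mul0r. Qed.

Lemma Psi_sum d (I : Type) (s : seq I) (p : I -> S) F :
  Psi d (\sum_(i <- s) p i) F = \sum_(i <- s) Psi d (p i) F.
Proof. by elim: s => [|i s IH]; rewrite ?big_nil ?Psi0 // !big_cons PsiD IH. Qed.

Lemma PsiX d m F : Psi d (XX m) F = if deg m == d then F m else 0.
Proof.
rewrite /Psi; case: eqP => [dm|/eqP dm].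
  have hm : (deg m < d.+1)%N by rewrite dm.
  rewrite (bigD1 (mpoly.BMultinom hm)) /= ?dm // mpoly.mcoeffX eqxx mul1r big1 ?addr0 // => m' /andP[_ h].
  rewrite mpoly.mcoeffX; case: eqP => [e|_]; last by rewrite mul0r.
  by case/negP: h; apply/eqP/val_inj.
rewrite big1 // => m' /eqP h; rewrite mpoly.mcoeffX; case: eqP => [e|_]; last by rewrite mul0r.
by rewrite e h eqxx in dm.
Qed.

Lemma PsiMX d m1 p F : Psi d (XX m1 * p) F =
  if (deg m1 <= d)%N then Psi (d - deg m1) p (fun m => F (mpoly.mnm_add m1 m)) else 0.
Proof.
elim/mpoly.mpolyind: p => [|c m p _ _ IH]; first by rewrite mulr0 !Psi0 if_same.
rewrite mulrDr PsiD IH -scalerAr -mpoly.mpolyXD PsiZ PsiX mpoly.mdegD.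
case: leqP => h; last by rewrite gtn_eqF ?mulr0 ?addr0 // ltn_addr.
by rewrite PsiD PsiZ PsiX -(eqn_add2l (deg m1) (deg m)) subnKC.
Qed.

(* p is in cideal t when, degree by degree, its image in any family satisfying the diagonal
   relations is a combination of terms (t^s - t^s(w + shift)) y and of terms of lower degree. *)
Definition cideal (t : 'rV[C]_r) (p : S) : Prop := forall d : nat,
  exists L : seq (C * (mon * seq 'I_r)), (forall q, q \in L -> deg q.2.1 = d) /\
  forall p0 b0, exists M : seq (C * mon), (forall q, q \in M -> (deg q.2).+1 = d) /\
  forall w y, diag_rel w y -> forall l, Psi d p (fun m => y (p0 + d)%N (b0 + mal m) l) =
    \sum_(q <- L) q.1 * (st q.2.2 t * y (p0 + d)%N (b0 + mal q.2.1) l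
                         - y (p0 + d)%N (b0 + mal q.2.1 + sQ Q q.2.2) l) +
    \sum_(q <- M) q.1 * y (p0 + deg q.2)%N (b0 + mal q.2) l.

Lemma cideal0 t : cideal t 0.
Proof.
move=> d; exists [::]; split => // p0 b0; exists [::]; split => // w y _ l.
by rewrite Psi0 !big_nil addr0.
Qed.

Lemma cidealD t p q : cideal t p -> cideal t q -> cideal t (p + q).
Proof.
move=> hp hq d; have [L [hL HL]] := hp d; have [L' [hL' HL']] := hq d.
exists (L ++ L'); split => [x|p0 b0]; first by rewrite mem_cat => /orP[/hL|/hL'].
have [M [hM HM]] := HL p0 b0; have [M' [hM' HM']] := HL' p0 b0.
exists (M ++ M'); split => [x|w y hy l]; first by rewrite mem_cat => /orP[/hM|/hM'].
by rewrite PsiD (HM w y hy) (HM' w y hy) !big_cat /= addrACA.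
Qed.

Lemma cidealZ t c p : cideal t p -> cideal t (c *: p).
Proof.
move=> hp d; have [L [hL HL]] := hp d.
exists [seq (c * q.1, q.2) | q <- L]; split => [x /mapP[q /hL h ->]//|p0 b0].
have [M [hM HM]] := HL p0 b0.
exists [seq (c * q.1, q.2) | q <- M]; split => [x /mapP[q /hM h ->]//|w y hy l].
rewrite PsiZ (HM w y hy) !big_map mulrDr !mulr_sumr.
by congr (_ + _); apply: eq_bigr => q _; rewrite mulrA.
Qed.

(** Multiplication by a monomial only moves the base level and exponent, which is why [cideal]
    quantifies over them once [L] is fixed. *)
Lemma cidealX t m p : cideal t p -> cideal t (XX m * p).
Proof.
move=> hp d; have [md|md] := leqP (deg m) d; last first.
  exists [::]; split => // p0 b0; exists [::]; split => // w y _ l.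
  by rewrite PsiMX leqNgt md !big_nil addr0.
have [L [hL HL]] := hp (d - deg m)%N.
exists [seq (q.1, (mpoly.mnm_add m q.2.1, q.2.2)) | q <- L]; split => [x /mapP[q /hL h ->] /=|p0 b0].
  by rewrite mpoly.mdegD h subnKC.
have [M [hM HM]] := HL (p0 + deg m)%N (b0 + mal m).
exists [seq (q.1, mpoly.mnm_add m q.2) | q <- M]; split => [x /mapP[q /hM h ->] /=|w y hy l].
  by rewrite mpoly.mdegD -addnS h subnKC.
have e : (p0 + deg m + (d - deg m) = p0 + d)%N by rewrite -addnA subnKC.
rewrite PsiMX md !big_map.
have -> : (fun m0 => y (p0 + d)%N (b0 + mal (mpoly.mnm_add m m0)) l) =
   (fun m0 => y (p0 + deg m + (d - deg m))%N (b0 + mal m + mal m0) l).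
  by apply/funext => m0; rewrite malD addrA e.
rewrite (HM w y hy) e; congr (_ + _); apply: eq_bigr => q _ /=; rewrite ?malD ?mpoly.mdegD.
  by rewrite !addrA.
by rewrite !addrA addnA.
Qed.

Lemma cideal_ideal t : idealp (cideal t).
Proof.
split; [exact: cideal0|exact: cidealD|] => p q hq.
elim/mpoly.mpolyind: p => [|c m p _ _ IH]; first by rewrite mul0r; exact: cideal0.
by rewrite mulrDl -scalerAl; apply: cidealD IH; apply: cidealZ; exact: cidealX.
Qed.

(** The total exponents agree, so the two correction terms involve the same shifted member of the
    family, and it cancels. *)
Lemma cideal_bin t (m1 m2 : mon) (s1 s2 : seq 'I_r) : deg m1 = deg m2 ->
  mal m1 + sQ Q s1 = mal m2 + sQ Q s2 ->
  cideal t (st s1 t *: XX m1 - st s2 t *: XX m2).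
Proof.
move=> hd hm d; have [e|e] := eqVneq (deg m1) d; last first.
  exists [::]; split => // p0 b0; exists [::]; split => // w y _ l.
  by rewrite !big_nil addr0 -scaleNr PsiD !PsiZ !PsiX -hd (negbTE e) !mulr0 addr0.
exists [:: (1, (m1, s1)); (-1, (m2, s2))]; split.
  by move=> q; rewrite !inE => /orP[]/eqP-> /=; rewrite -?hd.
move=> p0 b0; exists [::]; split => // w y _ l.
rewrite !big_cons !big_nil /= -scaleNr PsiD !PsiZ !PsiX -hd e eqxx -!addrA hm; ring.
Qed.

Lemma cideal_lin t (c0 : C) x : (forall j, dotv (row j Q) x = 0) ->
  cideal t (\sum_i ((c0 + dotv (al i) x) * ac i) *: XX (mpoly.mnm1 i)).
Proof.
move=> hx d; have [->|e] := eqVneq d 1%N; last first.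
  exists [::]; split => // p0 b0; exists [::]; split => // w y _ l.
  rewrite !big_nil addr0 Psi_sum big1 // => i _.
  by rewrite PsiZ PsiX mpoly.mdeg1 eq_sym (negbTE e) mulr0.
exists [::]; split => // p0 b0.
(* [fr1] contributes c0. For x orthogonal to the q_j the left side of [fr2] vanishes, which
   contributes (b0 . x)/(p0 + 1). *)
exists [:: (c0 + dotv b0 x / p0.+1%:R, @mpoly.mnm0 N)]; split.
  by move=> q; rewrite inE => /eqP->; rewrite mpoly.mdeg0.
move=> w y hy l; rewrite big_nil add0r big_seq1 /= mal0 addr0 mpoly.mdeg0 addn0.
rewrite Psi_sum; under eq_bigr do rewrite PsiZ PsiX mpoly.mdeg1 eqxx mal1 mulrDl mulrDl.
rewrite big_split /= addn1.
under eq_bigr do rewrite -mulrA; rewrite -mulr_sumr -(fr1 hy).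
have := fr2 hy x p0 b0 l; rewrite big1 => [/eqP|j _]; last by rewrite hx mul0r.
rewrite eq_sym subr_eq0 => /eqP E; rewrite mulrDl; congr (_ + _).
by rewrite mulrAC E mulrAC divff ?mul1r // pnatr_eq0.
Qed.

Fixpoint wmon (s : seq 'I_N) : mon :=
  if s is i :: s' then mpoly.mnm_add (mpoly.mnm1 i) (wmon s') else @mpoly.mnm0 N.

Lemma deg_wmon s : deg (wmon s) = size s.
Proof. by elim: s => [|i s IH] /=; rewrite ?mpoly.mdeg0 // mpoly.mdegD mpoly.mdeg1 IH. Qed.

Lemma mal_wmon s : mal (wmon s) = wsum al s.
Proof.
by elim: s => [|i s IH] /=; rewrite /wsum ?big_nil ?mal0 // big_cons malD mal1 IH.
Qed.

Definition mword (m : mon) : seq 'I_N := flatten [seq nseq (m i) i | i <- enum 'I_N].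

Lemma size_mword m : size (mword m) = deg m.
Proof.
rewrite /mword size_flatten /shape -map_comp mpoly.mdegE sumnE big_map big_enum /=.
by apply: eq_bigr => i _; rewrite size_nseq.
Qed.

Lemma wsum_mword m : wsum al (mword m) = mal m.
Proof.
rewrite /wsum /mword big_flatten big_map big_enum /=; apply: eq_bigr => i _.
rewrite big_nseq; elim: (m i) => /= [|k ->]; first by rewrite scale0r.
by have -> : Posz k.+1 = 1 + Posz k by []; rewrite scalerDl scale1r.
Qed.

Lemma big_word d (m : mon) (F : seq 'I_N -> C) : deg m = d ->
  \sum_(nu : d.-tuple 'I_N) (if mword m == nu then F nu else 0) = F (mword m).
Proof.
move=> hd; have sm : size (mword m) == d by rewrite size_mword hd.
rewrite (bigD1 (Tuple sm)) //= eqxx big1 ?addr0 // => nu /negP h.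
by case: eqP => // e; case: h; apply/eqP/val_inj.
Qed.

(** By pigeonhole all monomials of degree N K1 + 1 lie in the ideal. Each relation expresses a word
    through shorter words and corrections t^s y - (y shifted by s); with the corrections moved to
    the left, the matrix becomes the identity at t itself, where every correction vanishes. *)
Lemma cideal_good t : (forall i : 'I_N, exists K, cideal t (XX (mpoly.mnm1 i) ^+ K)) ->
  good al ac Q t.
Proof.
move=> /choice[Ki hK]; pose K1 := (\sum_i Ki i)%N; pose K := (N * K1)%N.
have KK i : (Ki i <= K1)%N by rewrite /K1 (bigD1 i) //= leq_addr.
have hw (mu : K.+1.-tuple 'I_N) : cideal t (XX (wmon mu)).
  have [i hi] : exists i, (Ki i <= wmon mu i)%N.
    apply/existsP; apply: contraT; rewrite negb_exists => /forallP h.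
    have : (deg (wmon mu) <= \sum_(i < N) K1)%N.
      by rewrite mpoly.mdegE; apply: leq_sum => i _; rewrite (leq_trans _ (KK i)) // ltnW // ltnNge h.
    by rewrite deg_wmon size_tuple sum_nat_const card_ord ltnn.
  rewrite mpoly.mpolyXE_id (bigD1 i) //= -(subnK hi) exprD -mulrA mulrCA.
  by rewrite mulrC; apply: (idM (cideal_ideal t)).
have /choice[L hL] : forall mu : K.+1.-tuple 'I_N, exists L : seq (C * (mon * seq 'I_r)),
    (forall q, q \in L -> deg q.2.1 = K.+1) /\
    forall p0 b0, exists M : seq (C * mon), (forall q, q \in M -> (deg q.2).+1 = K.+1) /\
    forall w y, diag_rel w y -> forall l, y (p0 + K.+1)%N (b0 + wsum al mu) l =
    \sum_(q <- L) q.1 * (st q.2.2 t * y (p0 + K.+1)%N (b0 + mal q.2.1) l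
                         - y (p0 + K.+1)%N (b0 + mal q.2.1 + sQ Q q.2.2) l) +
    \sum_(q <- M) q.1 * y (p0 + deg q.2)%N (b0 + mal q.2) l.
  move=> mu; have [L [h1 h2]] := hw mu K.+1; exists L; split => // p0 b0.
  have [M [h3 h4]] := h2 p0 b0; exists M; split => // w y hy l.
  by rewrite -(h4 w y hy) PsiX deg_wmon size_tuple eqxx mal_wmon.
pose H (mu nu : K.+1.-tuple 'I_N) : seq (C * seq 'I_r) :=
  (if mu == nu then [:: (1, [::])] else [::]) ++
  flatten [seq (if mword q.2.1 == nu then [:: (- q.1 * st q.2.2 t, [::]); (q.1, q.2.2)] else [::])
          | q <- L mu].
have sumH1 (mu nu : K.+1.-tuple 'I_N) (F : seq 'I_r -> C) :
    \sum_(e <- H mu nu) e.1 * F e.2 = (if mu == nu then F [::] else 0) +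
     \sum_(q <- L mu) (if mword q.2.1 == nu then - q.1 * st q.2.2 t * F [::] + q.1 * F q.2.2 else 0).
  rewrite big_cat /=; congr (_ + _).
    by case: eqP => _; [rewrite big_seq1 mul1r|rewrite big_nil].
  rewrite big_flatten big_map; apply: eq_bigr => q _.
  by case: eqP => _; [rewrite big_cons big_seq1|rewrite big_nil].
have sumH (mu : K.+1.-tuple 'I_N) (F : seq 'I_N -> seq 'I_r -> C) :
    \sum_(nu : K.+1.-tuple 'I_N) \sum_(e <- H mu nu) e.1 * F nu e.2 = F mu [::] +
    \sum_(q <- L mu) (- q.1 * st q.2.2 t * F (mword q.2.1) [::] + q.1 * F (mword q.2.1) q.2.2).
  transitivity (\sum_(nu : K.+1.-tuple 'I_N) ((if mu == nu then F nu [::] else 0) +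
     \sum_(q <- L mu) (if mword q.2.1 == nu then - q.1 * st q.2.2 t * F nu [::] + q.1 * F nu q.2.2 else 0))).
    by apply: eq_bigr => nu _; rewrite (sumH1 mu nu (F nu)).
  rewrite big_split /=; congr (_ + _).
    by rewrite (bigD1 mu) //= eqxx big1 ?addr0 // => nu /negbTE; rewrite eq_sym => ->.
  rewrite exchange_big /= big_seq [RHS]big_seq; apply: eq_bigr => q hq.
  exact: (big_word (fun nu : seq 'I_N => - q.1 * st q.2.2 t * F nu [::] + q.1 * F nu q.2.2) ((hL mu).1 q hq)).
exists K, H; split.
  move=> p0 b0.
  have /choice[M hM] : forall mu : K.+1.-tuple 'I_N, exists M : seq (C * mon), (forall q, q \in M -> (deg q.2).+1 = K.+1) /\
    forall w y, diag_rel w y -> forall l, y (p0 + K.+1)%N (b0 + wsum al mu) l =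
    \sum_(q <- L mu) q.1 * (st q.2.2 t * y (p0 + K.+1)%N (b0 + mal q.2.1) l
                         - y (p0 + K.+1)%N (b0 + mal q.2.1 + sQ Q q.2.2) l) +
    \sum_(q <- M) q.1 * y (p0 + deg q.2)%N (b0 + mal q.2) l.
    by move=> mu; exact: (hL mu).2.
  exists (fun (mu : K.+1.-tuple 'I_N) (nu : K.-tuple 'I_N) => \sum_(q <- M mu) (if mword q.2 == nu then q.1 else 0)) => w y hy mu l.
  rewrite (sumH mu (fun nu s => y (p0 + K.+1)%N (b0 + wsum al nu + sQ Q s) l)).
  have sQ0 : sQ Q [::] = 0 by rewrite /sQ big_nil.
  rewrite sQ0 addr0 ((hM mu).2 w y hy) addrAC -big_split /= big1 ?add0r => [|q _].
    transitivity (\sum_(q <- M mu) q.1 * y (p0 + K)%N (b0 + wsum al (mword q.2)) l).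
      rewrite big_seq [RHS]big_seq; apply: eq_bigr => q /(hM mu).1 [->].
      by rewrite wsum_mword.
    under [RHS]eq_bigr do rewrite mulr_suml.
    rewrite exchange_big /= big_seq [RHS]big_seq; apply: eq_bigr => q /(hM mu).1 [hq].
    rewrite -(big_word (fun nu : seq 'I_N => q.1 * y (p0 + K)%N (b0 + wsum al nu) l) hq).
    by apply: eq_bigr => nu _; case: ifP => // _; rewrite mul0r.
  by rewrite wsum_mword addr0; ring.
have -> : hmat H t = 1%:M; last exact: unitmx1.
apply/matrixP => i j; rewrite !mxE /hev (sumH1 _ _ (fun s => st s t)).
have -> : st [::] t = 1 by rewrite /st big_nil.
rewrite big1 ?addr0 ?(inj_eq enum_val_inj); first by case: eqP.
by move=> q _; case: ifP => // _; rewrite mulr1 mulNr addNr.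
Qed.
End Cert.

Section GoodL.
Variable R : realType.
Local Notation C := R[i].
Variables (n r : nat) (A : seq 'rV[int]_n) (a : 'rV[int]_n -> C) (Q : 'M[int]_(r, n)).

Lemma good_notin_Lset (t : 'rV[C]_r) : torus t -> ~ Lset A a Q t ->
  good (@expo n A) (coefA a) Q t.
Proof.
move=> ht hL; apply: cideal_good => i; apply: contrapT => /forallNP av.
have [lam [lam0 hlam]] := nullstellensatz (cideal_ideal (@expo n A) (coefA a) Q t) av.
apply: hL; apply: (@zero_in_Lset R n r A a Q t lam i ht lam0).
- move=> m1 m2 s1 s2 hm hs.
  pose mm (m : 'I_(size A) -> nat) := mpoly.Multinom (mktuple m).
  have mmE m j : mm m j = m j by rewrite mpoly.multinomE tnth_mktuple.
  have := hlam _ (@cideal_bin _ _ _ _ (@expo n A) (coefA a) Q t (mm m1) (mm m2) s1 s2 _ _).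
  rewrite mpoly.mevalB !mpoly.mevalZ !mpoly.mevalX => H.
  have E m : \prod_i lam i ^+ mm m i = \prod_i lam i ^+ m i.
    by apply: eq_bigr => j _; rewrite mmE.
  have hd : mpoly.mdeg (mm m1) = mpoly.mdeg (mm m2).
    by rewrite !mpoly.mdegE; under eq_bigr do rewrite mmE; under [RHS]eq_bigr do rewrite mmE.
  have malE m : mal (@expo n A) (mm m) = \sum_i (m i)%:Z *: expo i.
    by apply: eq_bigr => j _; rewrite mmE.
  have := H hd; rewrite !malE => /(_ hs); rewrite !E => /eqP.
  by rewrite subr_eq0 => /eqP.
- move=> c0 x hx; rewrite -[RHS](hlam _ (cideal_lin (@expo n A) (coefA a) t c0 hx)).
  elim/big_rec2: _ => [|j p u _ ->]; first by rewrite mpoly.meval0.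
  by rewrite mpoly.mevalD mpoly.mevalZ mpoly.mevalXU.
Qed.
End GoodL.

(** * Laurent expansions of the powers of 1/f *)

Section TorusMin.
Variable R : realType.
Local Notation C := R[i].
Variable T : topologicalType.

(* R[i] carries no topology here: continuity is that of the real and imaginary parts. *)
Definition ccont (h : T -> C) : Prop :=
  continuous (fun v => complex.Re (h v)) /\ continuous (fun v => complex.Im (h v)).

Lemma ccont_cst (c : C) : ccont (fun=> c).
Proof. by split => v; exact: cvg_cst. Qed.

Lemma ccontD h g : ccont h -> ccont g -> ccont (fun v => h v + g v).
Proof.
move=> [h1 h2] [g1 g2]; split => v.
  under eq_fun do rewrite raddfD /=; exact: (@continuousD _ _ _ _ _ _ (h1 v) (g1 v)).
under eq_fun do rewrite raddfD /=; exact: (@continuousD _ _ _ _ _ _ (h2 v) (g2 v)).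
Qed.

Lemma ccontM h g : ccont h -> ccont g -> ccont (fun v => h v * g v).
Proof.
have reM (x y : C) : complex.Re (x * y) = complex.Re x * complex.Re y - complex.Im x * complex.Im y.
  by case: x; case: y.
have imM (x y : C) : complex.Im (x * y) = complex.Re x * complex.Im y + complex.Im x * complex.Re y.
  by case: x; case: y.
move=> [h1 h2] [g1 g2]; split => v.
  under eq_fun do rewrite reM.
  exact: (continuousB (continuousM (h1 v) (g1 v)) (continuousM (h2 v) (g2 v))).
under eq_fun do rewrite imM.
exact: (continuousD (continuousM (h1 v) (g2 v)) (continuousM (h2 v) (g1 v))).
Qed.

Lemma ccont_sum (I : Type) (s : seq I) (P : pred I) (h : I -> T -> C) :
  (forall i, ccont (h i)) -> ccont (fun v => \sum_(i <- s | P i) h i v).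
Proof.
move=> hc; elim: s => [|i s IH].
  by under eq_fun do rewrite big_nil; exact: ccont_cst.
under eq_fun do rewrite big_cons; case: (P i) => //; exact: ccontD.
Qed.

Lemma ccont_prod (I : Type) (s : seq I) (P : pred I) (h : I -> T -> C) :
  (forall i, ccont (h i)) -> ccont (fun v => \prod_(i <- s | P i) h i v).
Proof.
move=> hc; elim: s => [|i s IH].
  by under eq_fun do rewrite big_nil; exact: ccont_cst.
under eq_fun do rewrite big_cons; case: (P i) => //; exact: ccontM.
Qed.

Lemma ccontX h k : ccont h -> ccont (fun v => h v ^+ k).
Proof.
move=> hc; elim: k => [|k IH]; first by under eq_fun do rewrite expr0; exact: ccont_cst.
under eq_fun do rewrite exprS; exact: ccontM.
Qed.
End TorusMin.

Section TorusBound.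
Variable R : realType.
Local Notation C := R[i].
Variable n : nat.
Let T : topologicalType := 'rV[R]_(n + n).
Let cre (v : T) (j : 'I_n) : R := v 0 (lshift n j).
Let cim (v : T) (j : 'I_n) : R := v 0 (rshift n j).
Let pt (v : T) (j : 'I_n) : C := Complex (cre v j) (cim v j).
Let ptc (v : T) (j : 'I_n) : C := Complex (cre v j) (- cim v j).

Let ccont_pt j : ccont (pt^~ j).
Proof. by split => v; apply: coord_continuous. Qed.

Let ccont_ptc j : ccont (ptc^~ j).
Proof.
split => v; first exact: coord_continuous.
by apply: (@continuousN R R^o _ (fun v : T => cim v j)); apply: coord_continuous.
Qed.

Let upow (v : T) j (k : int) : C :=
  match k with Posz m => pt v j ^+ m | Negz m => ptc v j ^+ m.+1 end.

(* Negative powers are replaced by powers of the conjugate, equal on the torus but defined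
   everywhere, and the constraint |w_j| = 1 by a penalty on a box. *)
Lemma torus_min A (a : 'rV[int]_n -> C) (z0 : 'rV[C]_n) : torus z0 ->
  (forall z : 'rV[C]_n, (forall j, cabs (z 0 j) = cabs (z0 0 j)) -> lpeval A a z != 0) ->
  exists2 e : R, 0 < e & forall z : 'rV[C]_n, (forall j, cabs (z 0 j) = cabs (z0 0 j)) ->
    e <= cabs (lpeval A a z).
Proof.
move=> z00 hz.
have rho0 j : 0 < cabs (z0 0 j) by rewrite cabs_gt0.
pose F (v : T) := \sum_(al <- A) a al * \prod_j (((cabs (z0 0 j))%:C)%C ^ al 0 j * upow v j (al 0 j)).
pose P (v : T) := \sum_j (pt v j * ptc v j - 1) ^+ 2.
have Fc : ccont F.
  apply: ccont_sum => al; apply: ccontM; first exact: ccont_cst.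
  apply: ccont_prod => j; apply: ccontM; first exact: ccont_cst.
  by case: (al 0 j) => m; apply: ccontX.
have Pc : ccont P.
  apply: ccont_sum => j; apply: ccontX; apply: ccontD; last exact: ccont_cst.
  exact: ccontM.
(* The penalty vanishes only where all moduli are 1, and there the first two terms give |f|^2 > 0;
   the minimum over the box is therefore positive. *)
pose g (v : T) : R := complex.Re (F v) ^+ 2 + complex.Im (F v) ^+ 2 + complex.Re (P v).
have gc : continuous g.
  move=> v; apply: (@continuousD R R^o _ (fun v => complex.Re (F v) ^+ 2 + complex.Im (F v) ^+ 2)); last exact: Pc.1.
  apply: (@continuousD R R^o _ (fun v => complex.Re (F v) ^+ 2)).
    by apply: (continuousM (Fc.1 v) (Fc.1 v)).
  by apply: (continuousM (Fc.2 v) (Fc.2 v)).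
have ptE v j : pt v j * ptc v j = ((cre v j ^+ 2 + cim v j ^+ 2)%:C)%C.
  apply/eqP; rewrite /pt /ptc eq_complex /=; apply/andP; split; apply/eqP; ring.
have PE v : complex.Re (P v) = \sum_j (cre v j ^+ 2 + cim v j ^+ 2 - 1) ^+ 2.
  suff -> : P v = ((\sum_j (cre v j ^+ 2 + cim v j ^+ 2 - 1) ^+ 2)%:C)%C by [].
  rewrite rmorph_sum; apply: eq_bigr => j _; rewrite ptE.
  by rewrite rmorphXn rmorphB.
have cabs2 (x : C) : cabs x ^+ 2 = complex.Re x ^+ 2 + complex.Im x ^+ 2.
  by case: x => x y; rewrite /cabs /= sqr_sqrtr // addr_ge0 // sqr_ge0.
have gE v : g v = cabs (F v) ^+ 2 + \sum_j (cre v j ^+ 2 + cim v j ^+ 2 - 1) ^+ 2.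
  by rewrite /g PE cabs2.
have FE v : (forall j, cre v j ^+ 2 + cim v j ^+ 2 = 1) ->
    F v = lpeval A a (\row_j (((cabs (z0 0 j))%:C)%C * pt v j)).
  move=> h1; apply: eq_bigr => al _; congr (_ * _); apply: eq_bigr => j _; rewrite mxE.
  have h2 : pt v j * ptc v j = 1 by rewrite ptE h1.
  have h3 : ptc v j = (pt v j)^-1.
    have h4 : pt v j != 0 by apply/eqP => h0; move/eqP: h2; rewrite h0 mul0r eq_sym oner_eq0.
    by apply: (mulfI h4); rewrite h2 divff.
  rewrite expfzMl; congr (_ * _); case: (al 0 j) => m //=.
  by rewrite h3 exprVn NegzE -exprnN.
have pt1 v j : cre v j ^+ 2 + cim v j ^+ 2 = 1 -> cabs (pt v j) = 1.
  by move=> h; rewrite /cabs /= h sqrtr1.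
have gpos v : 0 < g v.
  have P0 : 0 <= \sum_j (cre v j ^+ 2 + cim v j ^+ 2 - 1) ^+ 2.
    by apply: sumr_ge0 => j _; apply: sqr_ge0.
  have F0 := sqr_ge0 (cabs (F v)).
  rewrite lt_neqAle gE addr_ge0 // andbT eq_sym; apply/negP.
  rewrite paddr_eq0 // => /andP[/eqP f0 /eqP p0].
  have h1 j : cre v j ^+ 2 + cim v j ^+ 2 = 1.
    move/eqP: p0; rewrite psumr_eq0; last by move=> i _; apply: sqr_ge0.
    move/allP => /(_ j (mem_index_enum _)) /=.
    by rewrite sqrf_eq0 subr_eq0 => /eqP.
  move/eqP: f0; rewrite sqrf_eq0 cabs_eq0 FE //; apply/negP; apply: hz => j.
  by rewrite mxE cabsM pt1 // mulr1 cabs_real ger0_norm // ltW.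
pose K : set T := [set v : 'rV[R]_(n + n) | forall i, `[-1, 1]%classic (v ord0 i)].
have Kc : compact K by apply: (@rV_compact R _ (fun=> `[-1, 1]%classic)) => i; exact: segment_compact.
have K0 : K !=set0.
  by exists (0 : 'rV[R]_(n + n)) => i /=; rewrite mxE in_itv /= lerN10 ler01.
have [] := compact_EVT_min K0 Kc (continuous_subspaceT gc).
move=> c0 _ hc; exists (Num.sqrt (g c0)); first by rewrite sqrtr_gt0.
move=> z hzz.
pose v : T := row_mx (\row_j (complex.Re (z 0 j) / cabs (z0 0 j))) (\row_j (complex.Im (z 0 j) / cabs (z0 0 j))).
have vre j : cre v j = complex.Re (z 0 j) / cabs (z0 0 j) by rewrite /cre /v row_mxEl mxE.
have vim j : cim v j = complex.Im (z 0 j) / cabs (z0 0 j) by rewrite /cim /v row_mxEr mxE.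
have v1 j : cre v j ^+ 2 + cim v j ^+ 2 = 1.
  by rewrite vre vim !exprMn -mulrDl -cabs2 hzz exprVn divff // sqrf_eq0 gt_eqF.
have bd (x y : R) : x ^+ 2 + y ^+ 2 = 1 -> -1 <= x <= 1.
  move=> h; rewrite -ler_norml -(@ler_pXn2r _ 2) ?nnegrE ?normr_ge0 ?ler01 //.
  by rewrite real_normK ?num_real // expr1n -h lerDl sqr_ge0.
have vK : v \in K.
  rewrite inE => i /=; rewrite in_itv /=; case: (split_ordP i) => j ->.
    exact: bd (v1 j).
  by apply: (bd _ (cre v j)); rewrite addrC; exact: v1.
have zE : \row_j (((cabs (z0 0 j))%:C)%C * pt v j) = z.
  apply/rowP => j; rewrite mxE /pt vre vim; case: (z 0 j) => x y /=.
  apply/eqP; rewrite eq_complex /= !mul0r subr0 addr0.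
  by rewrite ![_ * (_ / _)]mulrC !divfK ?eqxx // gt_eqF.
have := hc _ vK; rewrite [g v]gE FE // zE [X in _ + X]big1 ?addr0; last first.
  by move=> j _; rewrite v1 subrr expr0n.
by move=> h; rewrite -[leRHS]ger0_norm ?cabs_ge0 // -sqrtr_sqr ler_wsqrtr.
Qed.
End TorusBound.

Section Geometric.
Variable R : realType.
Local Notation C := R[i].

Lemma geo_bound (x : R) (s : seq nat) : 0 <= x < 1 -> uniq s -> \sum_(j <- s) x ^+ j <= (1 - x)^-1.
Proof.
move=> /andP[x0 x1] us; pose L := \max_(j <- s) j.+1.
have sL j : j \in s -> (j < L)%N by move=> js; apply: (@leq_bigmax_seq _ _ xpredT (fun j => j.+1)).
apply: le_trans (_ : \sum_(0 <= j < L) x ^+ j <= _).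
  apply: ler_sum_uniq => //; first by move=> j; apply: exprn_ge0.
  by move=> j js; rewrite mem_index_iota sL.
rewrite -[leRHS]mul1r ler_pdivlMr ?subr_gt0 // mulrC -[_ - _]opprB mulNr big_mkord -subrX1 opprB.
by rewrite gerBl exprn_ge0.
Qed.

Lemma geo_summable (x : C) : cabs x < 1 -> abs_summable (fun j : nat => x ^+ j).
Proof.
move=> x1; exists (1 - cabs x)^-1 => s us.
under eq_bigr do rewrite cabsX.
by apply: geo_bound; rewrite ?cabs_ge0.
Qed.

Lemma geo_summable_int (x : R) : 0 <= x < 1 -> abs_summable (fun k : int => ((x ^+ absz k)%:C)%C).
Proof.
move=> x01; have /andP[x0 x1] := x01.
exists (\sum_(b : bool) (1 - x)^-1) => s us.
under eq_bigr do rewrite cabs_real ger0_norm ?exprn_ge0 //.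
rewrite (partition_big (fun k : int => (0 <= k)%R : bool) xpredT) //=.
apply: ler_sum => b _; rewrite -big_filter.
rewrite -(big_map absz xpredT (fun j => x ^+ j)); apply: geo_bound => //.
rewrite map_inj_in_uniq ?filter_uniq // => k l; rewrite !mem_filter.
by move=> /andP[/eqP kb _] /andP[/eqP lb _]; move: kb lb; case: k l b => k [] l [] //= _ _; lia.
Qed.

Lemma csum_succ (v : nat -> C) : abs_summable v -> csum (fun j => v j.+1) = csum v - v 0%N.
Proof.
move=> sv; apply: abs_sumE.
have h := abs_sumB (csumP sv) (abs_sum1 0%N (v 0%N)).
have h0 (i : nat) : v i - (if i == 0%N then v 0%N else 0) != 0 -> exists j, j.+1 = i.
  by case: i => [|j] /=; [rewrite subrr eqxx | exists j].
have := abs_sum_inj succn_inj h0 h; congr abs_sum.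
by apply/funext => j /=; rewrite subr0.
Qed.
Lemma bernoulli (x : R) (m : nat) : 0 <= x <= 1 -> 1 - m%:R * x <= (1 - x) ^+ m.
Proof.
move=> /andP[x0 x1]; elim: m => [|m IH]; first by rewrite mul0r subr0 expr0.
rewrite exprS; apply: le_trans (_ : (1 - x) * (1 - m%:R * x) <= _); last first.
  by rewrite ler_wpM2l ?subr_ge0.
have : 0 <= m%:R * (x * x) by rewrite !mulr_ge0.
rewrite -natr1; lra.
Qed.

(** Bernoulli's inequality gives (1 - d)^m >= 1 - m d > x for d = (1 - x)/(m + 2); sg is 1/(1 -
    d). *)
Lemma small_base (x : R) (m : nat) : 0 <= x < 1 -> exists2 sg : R, 1 < sg & x * sg ^+ m < 1.
Proof.
move=> /andP[x0 x1]; pose d : R := (1 - x) / m.+2%:R.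
have d0 : 0 < d by rewrite divr_gt0 ?subr_gt0.
have dm : m.+2%:R * d = 1 - x by rewrite mulrC divfK.
have d1 : d < 1.
  by rewrite ltr_pdivrMr // mul1r -natr1 -natr1; have := ler0n R m; lra.
have hb : x < (1 - d) ^+ m.
  apply: lt_le_trans (bernoulli m _); last by rewrite !ltW.
  have : m%:R * d + 2 * d = 1 - x by rewrite -dm -mulrDl -natrD addn2.
  by lra.
exists (1 - d)^-1; first by rewrite invf_gt1 ?subr_gt0 // gtrBl.
by rewrite exprVn ltr_pdivrMr ?mul1r // exprn_gt0 // subr_gt0.
Qed.
End Geometric.

(** * Weighted summable Laurent series and inversion of a Laurent polynomial *)

Section Wiener.
Variable R : realType.
Local Notation C := R[i].
Variable n : nat.
Implicit Types (u w : 'rV[int]_n -> C) (g d : 'rV[int]_n) (sg : R).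

Definition nrm g : nat := \sum_j absz (g 0%R j).

Lemma nrmD g d : (nrm (g + d) <= nrm g + nrm d)%N.
Proof. by rewrite /nrm -big_split; apply: leq_sum => j _; rewrite mxE -lez_nat PoszD !abszE ler_normD. Qed.

Lemma nrm0 : nrm 0 = 0%N.
Proof. by rewrite /nrm big1 // => j _; rewrite mxE. Qed.

Lemma nrm_geo (x : R) : 0 <= x < 1 -> abs_summable (fun g => ((x ^+ nrm g)%:C)%C).
Proof.
move=> x01.
suff -> : (fun g => ((x ^+ nrm g)%:C)%C) = (fun g => \prod_j ((x ^+ absz (g 0%R j))%:C)%C).
  by apply: (@abs_summable_prod _ _ (fun (_ : 'I_n) (k : int) => ((x ^+ absz k)%:C)%C)) => j; apply: geo_summable_int.
by apply/funext => g; rewrite -rmorph_prod prodrXr.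
Qed.

Variable z0 : 'rV[C]_n.
Hypothesis z00 : torus z0.

(* Weighted summability amounts to absolute convergence for sg^-1 <= |z_j / z0_j| <= sg. *)
Definition wt sg g : C := mono z0 g * ((sg ^+ nrm g)%:C)%C.
Definition wsm sg u := abs_summable (fun g => u g * wt sg g).

Lemma cabs_wt sg g : 0 <= sg -> cabs (wt sg g) = cabs (mono z0 g) * sg ^+ nrm g.
Proof. by move=> h; rewrite cabsM cabs_real ger0_norm // exprn_ge0. Qed.

Lemma wt_neq0 sg g : 0 < sg -> wt sg g != 0.
Proof.
move=> h; rewrite -cabs_eq0 cabs_wt ?ltW // mulf_neq0 ?gt_eqF ?exprn_gt0 //.
exact: cabs_mono_gt0.
Qed.

(** Submultiplicativity of the weight: it makes weighted summability stable under translation and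
    convolution. *)
Lemma cabs_wtD sg g d : 1 <= sg -> cabs (wt sg (g + d)) <= cabs (wt sg g) * cabs (wt sg d).
Proof.
move=> h; have h0 : 0 <= sg by apply: le_trans h.
rewrite !cabs_wt // monoD // cabsM mulrACA -exprD.
by rewrite ler_wpM2l ?mulr_ge0 ?cabs_ge0 // ler_weXn2l // nrmD.
Qed.

Lemma wsmZ sg k u : wsm sg u -> wsm sg (fun g => k * u g).
Proof. by move=> /(abs_summableZ k); congr abs_summable; apply/funext => g; rewrite mulrA. Qed.

Lemma wsmD sg u w : wsm sg u -> wsm sg w -> wsm sg (fun g => u g + w g).
Proof.
by move=> h /(abs_summableD h); congr abs_summable; apply/funext => g; rewrite mulrDl.
Qed.

Lemma wsm_sum sg (I : Type) (s : seq I) (P : pred I) (u : I -> 'rV[int]_n -> C) :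
  (forall i, wsm sg (u i)) -> wsm sg (fun g => \sum_(i <- s | P i) u i g).
Proof.
move=> h; elim: s => [|i s IH].
  under eq_fun do rewrite big_nil; have := abs_summable0 R 'rV[int]_n.
  by congr abs_summable; apply/funext => g; rewrite mul0r.
by under eq_fun do rewrite big_cons; case: (P i) => //; apply: wsmD.
Qed.

Lemma wsm_shift sg u d : 1 <= sg -> wsm sg u -> wsm sg (fun g => u (g - d)).
Proof.
move=> h hu; have hu' := abs_summable_inj (h := fun g => g - d) (@addIr _ (- d)) hu.
apply: abs_summable_le (cabs_ge0 (wt sg d)) _ hu' => g /=.
rewrite cabsM -{2}[g](subrK d); apply: le_trans (_ : cabs (u (g - d)) * (cabs (wt sg (g - d)) * cabs (wt sg d)) <= _).
  by rewrite ler_wpM2l ?cabs_ge0 // cabs_wtD.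
by rewrite cabsM [leRHS]mulrC mulrA.
Qed.

Lemma mono_wt_le sg (z : 'rV[C]_n) g : 1 <= sg ->
  (forall j, sg^-1 * cabs (z0 0 j) <= cabs (z 0 j) <= sg * cabs (z0 0 j)) ->
  cabs (mono z g) <= cabs (wt sg g).
Proof.
move=> h hz; have s0 : 0 < sg by apply: lt_le_trans h.
have rho0 j : 0 < cabs (z0 0 j) by rewrite cabs_gt0.
rewrite (cabs_wt _ (ltW s0)) !cabs_mono -prodrXr -big_split /=.
apply: ler_prod => j _; rewrite exprz_ge0 ?cabs_ge0 //=.
have /andP[h1 h2] := hz j; case: (g 0 j) => m /=.
  by rewrite -!exprnP -exprMn [_ * sg]mulrC; apply: lerXn2r; rewrite ?nnegrE ?mulr_ge0 ?cabs_ge0 // ltW.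
have zj0 : 0 < cabs (z 0 j) by apply: lt_le_trans h1; rewrite mulr_gt0 ?invr_gt0.
have h3 : (cabs (z 0 j))^-1 <= (cabs (z0 0 j))^-1 * sg.
  have -> : (cabs (z0 0 j))^-1 * sg = (sg^-1 * cabs (z0 0 j))^-1 by rewrite invfM invrK mulrC.
  by rewrite lef_pV2 ?posrE ?mulr_gt0 ?invr_gt0.
rewrite !NegzE -!exprnN -!exprVn -exprMn; apply: lerXn2r => //; rewrite nnegrE.
  by rewrite invr_ge0 cabs_ge0.
by apply: le_trans h3; rewrite invr_ge0 cabs_ge0.
Qed.

Lemma wsm_val sg u (z : 'rV[C]_n) : 1 <= sg ->
  (forall j, sg^-1 * cabs (z0 0 j) <= cabs (z 0 j) <= sg * cabs (z0 0 j)) ->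
  wsm sg u -> abs_summable (fun g => u g * mono z g).
Proof.
move=> h hz; apply: abs_summable_le1 => g; rewrite cabsM [leRHS]cabsM ler_wpM2l ?cabs_ge0 //.
exact: mono_wt_le.
Qed.

Lemma wsm_val1 sg u (z : 'rV[C]_n) : 1 <= sg ->
  (forall j, cabs (z 0 j) = cabs (z0 0 j)) ->
  wsm sg u -> abs_summable (fun g => u g * mono z g).
Proof.
move=> h hz; apply: wsm_val => // j; rewrite hz.
by rewrite ler_piMl ?cabs_ge0 ?ler_peMl ?cabs_ge0 ?invf_le1 //; apply: lt_le_trans h.
Qed.

(** Multiplication by the Laurent polynomial with coefficients [gg] at the exponents [dd], read on
    coefficients. *)
Definition opl (I : finType) (gg : I -> C) (dd : I -> 'rV[int]_n) u g : C :=
  \sum_i gg i * u (g - dd i).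

Lemma wsm_opl sg (I : finType) (gg : I -> C) dd u : 1 <= sg -> wsm sg u -> wsm sg (opl gg dd u).
Proof. by move=> h hu; apply: wsm_sum => i; apply/wsmZ/wsm_shift. Qed.

Lemma opl_val (I : finType) (gg : I -> C) dd u z l : torus z ->
  abs_sum (fun g => u g * mono z g) l ->
  abs_sum (fun g => opl gg dd u g * mono z g) ((\sum_i gg i * mono z (dd i)) * l).
Proof.
move=> tz hu; rewrite mulr_suml.
have := abs_sum_sum (index_enum I) (P := xpredT)
  (fun i _ => abs_sumZ (gg i * mono z (dd i)) (rV_shift_abs_sum (- dd i) hu)).
congr abs_sum; apply/funext => g; rewrite mulr_suml; apply: eq_bigr => i _.
rewrite monoB //; field; exact: mono_neq0.
Qed.

Lemma torus_same (z : 'rV[C]_n) : (forall j, cabs (z 0 j) = cabs (z0 0 j)) -> torus z.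
Proof. by move=> h j; rewrite -cabs_eq0 h cabs_eq0. Qed.
End Wiener.

Section Neumann.
Variable R : realType.
Local Notation C := R[i].
Variables (n N : nat) (al : 'I_N -> 'rV[int]_n) (ac : 'I_N -> C) (z0 : 'rV[C]_n) (e : R).
Hypotheses (z00 : torus z0) (e0 : 0 < e).
Let f (z : 'rV[C]_n) : C := \sum_i ac i * mono z (al i).
Hypothesis fe : forall z : 'rV[C]_n, (forall j, cabs (z 0 j) = cabs (z0 0 j)) -> e <= cabs (f z).
Let op := opl ac al.

Let M : R := (\sum_i cabs (ac i * mono z0 (al i))) ^+ 2.
(** On the torus of [z0] the conjugate of z^al is |z0^al|^2 z^(-al), so these are the coefficients
    of the Laurent polynomial equal there to conj f / M, where M bounds |f|^2. *)
Let acs (i : 'I_N) : C := conjc (ac i) * ((cabs (mono z0 (al i)) ^+ 2)%:C)%C / (M%:C)%C.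
Let ops := opl acs (fun i => - al i).

Let cs (z : 'rV[C]_n) (z1 : forall j, cabs (z 0 j) = cabs (z0 0 j)) al0 : cabs (mono z al0) = cabs (mono z0 al0).
Proof. by rewrite !cabs_mono; apply: eq_bigr => j _; rewrite z1. Qed.

Let normC2 (x : C) : x * conjc x = ((cabs x ^+ 2)%:C)%C.
Proof.
case: x => x y; apply/eqP; rewrite eq_complex /cabs /= sqr_sqrtr ?addr_ge0 ?sqr_ge0 //.
by apply/andP; split; apply/eqP; ring.
Qed.

Let fM (z : 'rV[C]_n) : (forall j, cabs (z 0 j) = cabs (z0 0 j)) -> e ^+ 2 <= cabs (f z) ^+ 2 <= M.
Proof.
move=> z1; apply/andP; split.
  by apply: lerXn2r; rewrite ?nnegrE ?cabs_ge0 ?fe // ltW.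
apply: lerXn2r; rewrite ?nnegrE ?cabs_ge0 //.
  by apply: sumr_ge0 => i _; apply: cabs_ge0.
apply: le_trans (cabs_sum _ _ _) _; apply: ler_sum => i _.
by rewrite !cabsM cs.
Qed.

Let M0 : 0 < M.
Proof.
have /andP[h1 h2] := @fM z0 (fun _ => erefl).
by apply: lt_le_trans (le_trans h1 h2); rewrite exprn_gt0.
Qed.

Let fsE (z : 'rV[C]_n) : (forall j, cabs (z 0 j) = cabs (z0 0 j)) ->
  f z * \sum_i acs i * mono z (- al i) = ((cabs (f z) ^+ 2 / M)%:C)%C.
Proof.
move=> z1; have tz : torus z := torus_same z00 z1.
have divC (x y : R) : ((x / y)%:C)%C = (x%:C)%C / (y%:C)%C by rewrite rmorphM fmorphV.
have MC : (M%:C)%C != 0 by rewrite -cabs_eq0 cabs_real normr_eq0 gt_eqF.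
rewrite divC -normC2 -mulrA; congr (_ * _).
have -> : conjc (f z) = \sum_i conjc (ac i * mono z (al i)) by exact: rmorph_sum.
rewrite mulr_suml; apply: eq_bigr => i _.
have -> : conjc (ac i * mono z (al i)) = conjc (ac i) * conjc (mono z (al i)) by exact: rmorphM.
rewrite monoN // /acs -(cs z1) -normC2; field.
by rewrite MC mono_neq0.
Qed.

(* The Laurent coefficients of (1 - f f^* / M)^j, where f^* is conj f on the torus of z0. *)
Let CC := fix CC (j : nat) : 'rV[int]_n -> C :=
  if j is j'.+1 then fun g => CC j' g - op (ops (CC j')) g else fun g => if g == 0 then 1 else 0.

Let CC_val j (z : 'rV[C]_n) : (forall j, cabs (z 0 j) = cabs (z0 0 j)) ->
  abs_sum (fun g => CC j g * mono z g) (((1 - cabs (f z) ^+ 2 / M)%:C)%C ^+ j).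
Proof.
move=> z1; have tz : torus z := torus_same z00 z1.
elim: j => [|j IH].
  have := abs_sum1 (0 : 'rV[int]_n) (1 : C); congr abs_sum; apply/funext => g /=.
  by case: eqP => [->|_]; rewrite ?mono0 ?mulr1 ?mul0r.
have := abs_sumB IH (opl_val ac al tz (opl_val acs (fun i => - al i) tz IH)).
rewrite mulrA -/(f z) fsE // [_ ^+ j.+1]exprS; set x : R := _ / M.
have -> : ((1 - x)%:C)%C = 1 - (x%:C)%C by exact: rmorphB.
rewrite mulrBl mul1r.
by congr abs_sum; apply/funext => g /=; rewrite mulrBl.
Qed.

Let theta : R := 1 - e ^+ 2 / M.
Let theta01 : 0 <= theta < 1.
Proof.
have /andP[h1 h2] := @fM z0 (fun _ => erefl).
apply/andP; split; first by rewrite subr_ge0 ler_pdivrMr // mul1r (le_trans h1 h2).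
by rewrite /theta gtrBl divr_gt0 // exprn_gt0.
Qed.

Let CC_bound j g : cabs (CC j g * mono z0 g) <= theta ^+ j.
Proof.
apply: coef_bound => //; first exact: (CC_val j (fun _ => erefl)).1.
move=> z z1; rewrite (abs_sumE (CC_val j z1)) cabsX cabs_real.
have /andP[h1 h2] := fM z1.
rewrite ger0_norm; last by rewrite subr_ge0 ler_pdivrMr // mul1r.
apply: lerXn2r; rewrite ?nnegrE.
- by rewrite subr_ge0 ler_pdivrMr // mul1r.
- by case/andP: theta01.
by rewrite lerD2l lerN2 ler_pM2r ?invr_gt0.
Qed.

Let D : nat := \sum_i \sum_i' nrm (al i - al i').

Let CC_supp j g : CC j g != 0 -> (nrm g <= j * D)%N.
Proof.
elim: j g => [|j IH] g /=.
  by case: (g =P 0) => [->|_]; rewrite ?nrm0 ?eqxx.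
apply: contraNT; rewrite -ltnNge => hg.
have h0 d : (nrm d <= D)%N -> CC j (g - d) = 0.
  move=> hd; apply/eqP; apply: contraTT hg => /IH hj.
  rewrite -leqNgt; apply: leq_trans (_ : (nrm (g - d) + nrm d <= _)%N).
    by rewrite -{1}[g](subrK d) nrmD.
  by rewrite mulSn addnC leq_add.
have := h0 0; rewrite subr0 nrm0 => -> //; rewrite sub0r oppr_eq0.
apply/eqP; rewrite /op /opl big1 // => i _; rewrite /ops /opl big1 ?mulr0 // => i' _.
rewrite -addrA -opprD h0 ?mulr0 //.
rewrite /D (bigD1 i) //= (bigD1 i') //=; apply: leq_trans (leq_addr _ _); exact: leq_addr.
Qed.

(** On the torus, 1 - |f|^2/M lies in [0, theta] whatever the argument of f, so the coefficients of
    its j-th power are at most theta^j by [coef_bound]. The support of that power grows linearly in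
    j, so a weight sg close to 1 is absorbed. *)
Lemma neumann : exists sg u, [/\ 1 < sg, wsm z0 sg u & op u = fun g => if g == 0 then 1 else 0].
Proof.
(* One factor sg^(j D) pays for the weight on the support of the j-th power; the other leaves
   sg^(-|g|) for the summation over g. *)
have [sg sg1 hsg] := small_base (D + D) theta01.
have sg0 : 0 < sg by apply: lt_trans sg1.
have /andP[th0 th1] := theta01.
pose x : R := theta * sg ^+ (D + D).
have x01 : 0 <= x < 1 by rewrite hsg andbT mulr_ge0 // exprn_ge0 // ltW.
have y0 : 0 <= sg^-1 by rewrite invr_ge0 ltW.
have x0 : 0 <= x by case/andP: x01.
have y01 : 0 <= sg^-1 < 1 by rewrite invr_ge0 (ltW sg0) invf_lt1.
have CCb j g : cabs (CC j g * wt z0 sg g) <= x ^+ j * sg^-1 ^+ nrm g.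
  have [->|/CC_supp hj] := eqVneq (CC j g) 0.
    by rewrite mul0r cabs0 mulr_ge0 ?exprn_ge0.
  rewrite /wt mulrA cabsM cabs_real ger0_norm ?exprn_ge0 ?(ltW sg0) //.
  apply: le_trans (_ : theta ^+ j * sg ^+ nrm g <= _).
    by rewrite ler_wpM2r ?CC_bound ?exprn_ge0 ?(ltW sg0).
  rewrite exprMn -mulrA ler_wpM2l ?exprn_ge0 // exprVn ler_pdivlMr ?exprn_gt0 //.
  rewrite -exprD -exprM ler_weXn2l ?(ltW sg1) //.
  by rewrite mulnDl leq_add // mulnC.
have sp : abs_summable (fun p : nat * 'rV[int]_n => CC p.1 p.2 * wt z0 sg p.2).
  have sx : abs_summable (fun j : nat => (x%:C)%C ^+ j).
    by apply: geo_summable; rewrite cabs_real ger0_norm; case/andP: x01.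
  have := (abs_sum_mul (csumP sx) (csumP (nrm_geo n y01))).1.
  apply: abs_summable_le1 => -[j g] /=; apply: le_trans (CCb j g) _.
  by rewrite cabsM cabsX !cabs_real !ger0_norm ?exprn_ge0.
have sj g : abs_summable (fun j => CC j g).
  have := abs_summableZ (wt z0 sg g)^-1 (abs_summable_snd g sp).
  congr abs_summable; apply/funext => j /=; field; exact: wt_neq0.
pose G g := csum (fun j => CC j g).
have GW : wsm z0 sg G.
  have [_ h _] := fubini_swap (u := fun j g => CC j g * wt z0 sg g) sp.
  move: h; congr abs_summable; apply/funext => g; rewrite mulrC -csumZ //.
  by congr csum; apply/funext => j; rewrite mulrC.
exists sg, (ops G); split=> //; first by apply: wsm_opl GW => //; exact: ltW.
apply/funext => g.
have hop (u0 : nat -> 'rV[int]_n -> C) : (forall g, abs_summable (u0^~ g)) -> forall (I : finType) (gg : I -> C) dd g,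
    abs_sum (fun j : nat => opl gg dd (u0 j) g) (opl gg dd (fun g => csum (u0^~ g)) g).
  move=> hu I gg dd g'; apply: abs_sum_sum => i _; apply: abs_sumZ; exact: csumP.
have h1 := hop CC sj _ acs (fun i => - al i).
have h2 := hop (fun j g => ops (CC j) g) (fun g => (h1 g).1) _ ac al g.
transitivity (opl ac al (fun g => csum (fun j => ops (CC j) g)) g).
  by congr (opl ac al _ g); apply/funext => g'; rewrite (abs_sumE (h1 g')).
rewrite -(abs_sumE h2).
(* Multiplying the j-th power by |f|^2/M gives the difference of consecutive powers; the sum
   telescopes to the 0-th power, the unit. *)
transitivity (csum (fun j => CC j g - CC j.+1 g)).
  by congr csum; apply/funext => j /=; rewrite opprB addrCA subrr addr0.
have ss : abs_summable (fun j => CC j.+1 g) := abs_summable_inj succn_inj (sj g).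
have /= e1 := csum_succ (sj g); have /= e2 := abs_sumE (abs_sumB (csumP (sj g)) (csumP ss)).
by rewrite e2 e1 opprB addrCA subrr addr0.
Qed.
End Neumann.

Section Powers.
Variable R : realType.
Local Notation C := R[i].
Variables (n N : nat) (al : 'I_N -> 'rV[int]_n) (ac : 'I_N -> C) (z0 : 'rV[C]_n) (e : R).
Hypotheses (z00 : torus z0) (e0 : 0 < e).
Let f (z : 'rV[C]_n) : C := \sum_i ac i * mono z (al i).
Hypothesis fe : forall z : 'rV[C]_n, (forall j, cabs (z 0 j) = cabs (z0 0 j)) -> e <= cabs (f z).
Let op := opl ac al.
Implicit Types (u w : 'rV[int]_n -> C).
Let delta : 'rV[int]_n -> C := fun g => if g == 0 then 1 else 0.

Let fn0 (z : 'rV[C]_n) : (forall j, cabs (z 0 j) = cabs (z0 0 j)) -> f z != 0.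
Proof. by move=> /fe h; rewrite -cabs_eq0 gt_eqF // (lt_le_trans e0). Qed.

Lemma opl_inj u w : wsm z0 1 u -> wsm z0 1 w -> op u = op w -> u = w.
Proof.
move=> hu hw uw; apply: (coef_unique z00) => z z1; have tz := torus_same z00 z1.
have su := csumP (wsm_val1 z00 (lexx 1) z1 hu); have sw := csumP (wsm_val1 z00 (lexx 1) z1 hw).
exists (csum (fun g => u g * mono z g)); split => //.
suff -> : csum (fun g => u g * mono z g) = csum (fun g => w g * mono z g) by [].
apply: (mulfI (fn0 z1)); rewrite -(abs_sumE (opl_val ac al tz su)) -(abs_sumE (opl_val ac al tz sw)).
by rewrite -/op uw.
Qed.

Lemma wsm_le (sg sg' : R) u : 0 <= sg -> sg <= sg' -> wsm z0 sg' u -> wsm z0 sg u.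
Proof.
move=> s0 ss; apply: abs_summable_le1 => g; rewrite !cabsM ler_wpM2l ?cabs_ge0 //.
rewrite ler_wpM2l ?cabs_ge0 // !cabs_real !ger0_norm ?exprn_ge0 ?lerXn2r ?nnegrE //.
all: exact: le_trans ss.
Qed.

(* The solution is the convolution of u with an inverse v of the symbol. *)
Lemma opl_surj (sg : R) v u : 1 <= sg -> wsm z0 sg v -> op v = delta -> wsm z0 sg u ->
  exists2 w, wsm z0 sg w & op w = u.
Proof.
move=> s1 hv vd hu; have s0 : 0 < sg by apply: lt_le_trans s1.
have sp : abs_summable (fun p : 'rV[int]_n * 'rV[int]_n => u p.2 * v (p.1 - p.2) * wt z0 sg p.1).
  have h := (abs_sum_mul (csumP hu) (csumP hv)).1.
  have hi : injective (fun p : 'rV[int]_n * 'rV[int]_n => (p.2, p.1 - p.2)).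
    by move=> [a b] [a' b'] /= [-> /addIr ->].
  apply: abs_summable_le1 (abs_summable_inj hi h) => -[g k] /=.
  rewrite [in leRHS]mulrACA [leLHS]cabsM [leRHS]cabsM ler_wpM2l ?cabs_ge0 //.
  by rewrite -{1}[g](subrK k) [X in _ <= X]cabsM mulrC cabs_wtD.
have sg' g : abs_summable (fun k => u k * v (g - k)).
  have := abs_summableZ (wt z0 sg g)^-1 (abs_summable_fst g sp).
  congr abs_summable; apply/funext => k /=; field; exact: wt_neq0.
exists (fun g => csum (fun k => u k * v (g - k))).
  have [h _ _] := fubini_swap (u := fun g k => u k * v (g - k) * wt z0 sg g) sp.
  move: h; congr abs_summable; apply/funext => g; rewrite mulrC -csumZ //.
  by congr csum; apply/funext => k; rewrite mulrC.
apply/funext => g; rewrite /op /opl.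
have := abs_sum_sum (index_enum 'I_N) (P := xpredT) (fun i _ => abs_sumZ (ac i) (csumP (sg' (g - al i)))).
move/abs_sumE <-; transitivity (csum (fun k => if k == g then u g else 0)); last first.
  by rewrite (abs_sumE (abs_sum1 g (u g))).
congr csum; apply/funext => k; transitivity (u k * op v (g - k)).
  by rewrite /op /opl mulr_sumr; apply: eq_bigr => i _; rewrite mulrCA addrAC.
rewrite vd /delta subr_eq0 [g == k]eq_sym; case: eqP => [->|_]; rewrite ?mulr1 ?mulr0 //.
Qed.

(** Differentiation introduces a linear form in g, dominated by sg^|g|. The weight drops to 1, which
    is all that [opl_inj] asks for. *)
Lemma wsm_dotv (sg : R) (x : 'cV[C]_n) u : 1 < sg -> wsm z0 sg u -> wsm z0 1 (fun g => dotv g x * u g).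
Proof.
move=> s1 hu; pose d := sg - 1; have d0 : 0 < d by rewrite subr_gt0.
pose K : R := \sum_i cabs (x i 0) / d.
have K0 : 0 <= K by apply: sumr_ge0 => i _; rewrite divr_ge0 ?cabs_ge0 ?ltW.
have nb (m : nat) : m%:R * d <= sg ^+ m.
  rewrite -[sg](subrK 1) -/d addrC; elim: m => [|m IH]; first by rewrite mul0r ler01.
  rewrite exprS mulrDl mul1r -natr1 mulrDl mul1r lerD //.
  by rewrite ler_peMr ?(ltW d0) // exprn_ege1 // lerDl ltW.
apply: abs_summable_le K0 _ hu => g.
have s0 : 0 <= sg by apply: le_trans (ltW s1).
have cint (m : int) : cabs (m%:~R : C) = (absz m)%:R.
  have -> : (m%:~R : C) = ((m%:~R : R)%:C)%C by rewrite rmorph_int.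
  by rewrite cabs_real -intr_norm -abszE.
rewrite cabsM cabsM cabs_wt ?ler01 // expr1n mulr1 cabsM cabs_wt //.
have -> : K * (cabs (u g) * (cabs (mono z0 g) * sg ^+ nrm g)) =
  (K * sg ^+ nrm g) * cabs (u g) * cabs (mono z0 g) by ring.
rewrite ler_wpM2r ?cabs_ge0 // ler_wpM2r ?cabs_ge0 //.
apply: le_trans (cabs_sum _ _ _) _; rewrite mulr_suml; apply: ler_sum => i _.
rewrite cabsM cint mulrC -mulrA ler_wpM2l ?cabs_ge0 // mulrC ler_pdivlMr //.
apply: le_trans (nb _) _; rewrite ler_weXn2l ?(ltW s1) //.
by rewrite /nrm (bigD1 i) //= leq_addr.
Qed.

Lemma wsm_delta sg : wsm z0 sg delta.
Proof.
have := (abs_sum1 (0 : 'rV[int]_n) (1 : C)).1; congr abs_summable; apply/funext => g /=.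
by rewrite /delta; case: eqP => [->|_]; rewrite ?mul0r // /wt mono0 nrm0 expr0 !mul1r.
Qed.

(** [w k] is the expansion of f^(-k). The Leibniz rule goes by induction on k: multiplied by f, the
    two sides for k+1 agree by the case k, and multiplication by f is injective on summable
    series. *)
Lemma powers : exists2 sg : R, 1 < sg & exists w : nat -> 'rV[int]_n -> C,
  [/\ w 0%N = delta, forall k, wsm z0 sg (w k), forall k, op (w k.+1) = w k &
      forall x k g, dotv g x * w k g = - (k%:R * \sum_i dotv (al i) x * ac i * w k.+1 (g - al i))].
Proof.
have [sg [v [s1 hv vd]]] := neumann z00 e0 fe; exists sg => //.
have S u : exists w, wsm z0 sg u -> wsm z0 sg w /\ op w = u.
  have [/(opl_surj (ltW s1) hv vd)[w h1 h2]|h] := pselect (wsm z0 sg u); first by exists w.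
  by exists u => /h.
have /choice[T hT] := S.
pose w k := iter k T delta.
have hw k : wsm z0 sg (w k) by elim: k => [|k /hT[]//]; exact: wsm_delta.
have ow k : op (w k.+1) = w k by case: (hT _ (hw k)).
have w1 k : wsm z0 1 (w k) by apply: wsm_le (hw k) => //; exact: ltW.
exists w; split => // x k; elim: k => [|k IH] g.
  by rewrite mul0r oppr0 /w /= /delta; case: eqP => [->|_]; rewrite ?mulr0 // /dotv big1 ?mul0r // => i _; rewrite mxE mul0r.
pose r k g := - (k%:R * \sum_i dotv (al i) x * ac i * w k.+1 (g - al i)).
have hr j : wsm z0 1 (r j).
  have := wsmZ (- j%:R) (wsm_opl z00 (fun i => dotv (al i) x * ac i) al (lexx 1) (w1 j.+1)).
  by congr wsm; apply/funext => h; rewrite /r mulNr.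
suff : (fun g => dotv g x * w k.+1 g) = r k.+1 by move/(congr1 (fun h => h g)).
apply: opl_inj => //; first exact: wsm_dotv s1 (hw _).
apply/funext => h; transitivity (- (k.+1%:R * \sum_i dotv (al i) x * ac i * w k.+1 (h - al i))).
  transitivity (dotv h x * op (w k.+1) h - \sum_i dotv (al i) x * ac i * w k.+1 (h - al i)).
    rewrite /op /opl mulr_sumr -sumrB; apply: eq_bigr => i _.
    have -> : dotv (h - al i) x = dotv h x - dotv (al i) x.
      by rewrite /dotv -sumrB; apply: eq_bigr => j _; rewrite !mxE rmorphB mulrBl.
    by ring.
  by rewrite ow IH -natr1; ring.
transitivity (- (k.+1%:R * \sum_i dotv (al i) x * ac i * op (w k.+2) (h - al i))); first by rewrite ow.
rewrite /op /opl /r.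
under eq_bigr do rewrite mulr_sumr.
rewrite exchange_big /= mulr_sumr -sumrN; apply: eq_bigr => i _.
rewrite mulrN mulrCA; congr (- (_ * _)); rewrite mulr_sumr; apply: eq_bigr => j _.
have -> : h - al j - al i = h - al i - al j by rewrite addrAC.
by ring.
Qed.
End Powers.

(** * Continuation along paths *)

Section PathLift.
Variables (R : realType) (T : Type) (St : R -> T -> Prop) (tr : R -> R -> T -> T).

Let near_in (s eta c x c' : R) : s - eta < c -> c <= x -> x <= c' -> c' < s + eta -> `|x - s| < eta.
Proof. by move=> h1 h2 h3 h4; rewrite ltr_norml; apply/andP; split; lra. Qed.

(** [tr s s'] stands for continuation from time s to time s', trusted for nearby times only. Around
    the supremum of the times reached by a lift, one local piece carries the lift beyond it, unless
    it is 1. *)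
Lemma path_lift (Y0 : T) : St 0 Y0 -> (forall s Y, St s Y -> tr s s Y = Y) ->
  (forall s, 0 <= s <= 1 -> exists2 eta : R, 0 < eta &
     (forall s1 s2 Y, 0 <= s1 <= 1 -> 0 <= s2 <= 1 -> `|s1 - s| < eta -> `|s2 - s| < eta ->
        St s1 Y -> St s2 (tr s1 s2 Y)) /\
     (forall s1 s2 s3 Y, 0 <= s1 <= 1 -> 0 <= s2 <= 1 -> 0 <= s3 <= 1 ->
        `|s1 - s| < eta -> `|s2 - s| < eta -> `|s3 - s| < eta ->
        St s1 Y -> tr s2 s3 (tr s1 s2 Y) = tr s1 s3 Y)) ->
  exists ys : R -> T, [/\ ys 0 = Y0, forall s, 0 <= s <= 1 -> St s (ys s) &
    forall s, 0 <= s <= 1 -> exists2 del : R, 0 < del &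
      forall s', 0 <= s' <= 1 -> `|s' - s| < del -> ys s' = tr s s' (ys s)].
Proof.
move=> St0 trid loc.
pose lift (c : R) := exists ys : R -> T, [/\ ys 0 = Y0, forall s, 0 <= s <= c -> St s (ys s) &
    forall s, 0 <= s <= c -> exists2 del : R, 0 < del &
      forall s', 0 <= s' <= c -> `|s' - s| < del -> ys s' = tr s s' (ys s)].
pose S : set R := [set c | 0 <= c <= 1 /\ lift c].
have ext c c' (s : R) (eta : R) : 0 <= s <= 1 -> 0 < eta ->
    (forall s1 s2 Y, 0 <= s1 <= 1 -> 0 <= s2 <= 1 -> `|s1 - s| < eta -> `|s2 - s| < eta ->
        St s1 Y -> St s2 (tr s1 s2 Y)) ->
     (forall s1 s2 s3 Y, 0 <= s1 <= 1 -> 0 <= s2 <= 1 -> 0 <= s3 <= 1 ->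
        `|s1 - s| < eta -> `|s2 - s| < eta -> `|s3 - s| < eta ->
        St s1 Y -> tr s2 s3 (tr s1 s2 Y) = tr s1 s3 Y) ->
    0 <= c -> c <= c' -> c' <= 1 -> s - eta < c -> c' < s + eta -> lift c -> lift c'.
  move=> s01 eta0 h1 h2 c0 cc c1 sc cs [ys [y0 yS yl]].
  exists (fun x => if x <= c then ys x else tr c x (ys c)); split; first by rewrite c0.
    move=> x /andP[x0 xc']; case: leP => [xc|cx]; first by apply: yS; rewrite x0.
    apply: h1; [by rewrite c0 (le_trans cc) | by rewrite x0 (le_trans xc') | exact: near_in sc _ cc cs |
      exact: near_in sc (ltW cx) xc' cs | by apply: yS; rewrite c0 lexx].
  move=> x /andP[x0 xc']; case: (leP x c) => [xc|cx]; last first.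
    exists (x - c); first by rewrite subr_gt0.
    move=> x' /andP[x'0 x'c]; rewrite ltr_norml => /andP[hx _].
    have cx' : c < x' by lra.
    rewrite leNgt cx' /= h2 //.
    - by rewrite c0 (le_trans cc).
    - by rewrite x0 (le_trans xc').
    - by rewrite x'0 (le_trans x'c).
    - exact: near_in sc _ cc cs.
    - exact: near_in sc (ltW cx) xc' cs.
    - exact: near_in sc (ltW cx') x'c cs.
    by apply: yS; rewrite c0 lexx.
  have [del del0 hd] := yl x (introT andP (conj x0 xc)).
  case: (eqVneq x c) => [xE|xc0].
    exists del => // x' /andP[x'0 x'c] xx'; case: leP => [h|h]; first by apply: hd; rewrite ?x'0.
    by rewrite xE.
  have xltc : x < c by rewrite lt_neqAle xc0.
  exists (Num.min del (c - x)); first by rewrite lt_min del0 subr_gt0.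
  move=> x' /andP[x'0 x'c]; rewrite lt_min => /andP[xx' hx'].
  have x'lc : x' <= c by move: hx'; rewrite ltr_norml => /andP[_]; lra.
  by rewrite x'lc; apply: hd => //; rewrite x'0.
have S0 : S 0.
  split; first by rewrite lexx ler01.
  exists (fun=> Y0); split=> // s /andP[h1 h2]; have -> : s = 0 by apply/eqP; rewrite eq_le h1 h2.
    by [].
  exists 1 => // s' /andP[h3 h4] _; have -> : s' = 0 by apply/eqP; rewrite eq_le h3 h4.
  by rewrite trid.
have hs : has_sup S by split; [exists 0 | exists 1 => c [/andP[]]].
pose s := sup S.
have s0 : 0 <= s by apply: ub_le_sup => //; case: hs.
have s1 : s <= 1 by apply: ge_sup => [|c [/andP[]] //]; exists 0.
have s01 : 0 <= s <= 1 by rewrite s0.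
have [eta eta0 [h1 h2]] := loc _ s01.
have [c [/andP[c0 c1] lc] hc] := sup_adherent eta0 hs.
pose c' := Num.min 1 (s + eta / 2).
have cs : c <= s by apply: ub_le_sup; [case: hs | split; rewrite ?c0].
have e2 : 0 < eta / 2 by rewrite divr_gt0.
have e3 : eta = eta / 2 + eta / 2 by rewrite -splitr.
have c'1 : c' <= 1 by rewrite ge_min lexx.
have cc' : c <= c' by rewrite le_min c1 /=; lra.
have hc' : c' < s + eta by rewrite gt_min; apply/orP; right; lra.
have lc' : lift c' by apply: (ext c c' s eta).
have : c' <= s.
  apply: ub_le_sup; first by case: hs.
  by split => //; rewrite c'1 (le_trans c0).
rewrite ge_min => /orP[h|]; last by lra.
have c'E : c' = 1 by apply/eqP; rewrite eq_le c'1 le_min lexx /=; lra.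
by move: lc'; rewrite c'E.
Qed.
End PathLift.

Section RecExtra.
Variable R : realType.
Local Notation C := R[i].
Variable r : nat.
Implicit Types (u : 'rV[int]_r -> C) (v t : 'rV[C]_r).

Lemma rb0 (k l : int) : 0 <= k -> rb (0 : C) k l = (k == l)%:R.
Proof.
case: k => k // _; case: l => l //=; rewrite /rb /= eqz_nat.
case: (ltngtP k l) => [h|h|->]; last by rewrite binn subrr expr0z mulr1.
  by rewrite bin_small ?mul0r.
by rewrite exp0rz subr_eq0 eqz_nat gtn_eqF ?mulr0.
Qed.

Lemma Rec0 u : nnsupp u -> Rec 0 u = u.
Proof.
move=> hu; apply/funext => l; transitivity (csum (fun k => if k == l then u l else 0)); last first.
  by rewrite (abs_sumE (abs_sum1 l (u l))).
congr csum; apply/funext => k.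
have [u0|u0] := eqVneq (u k) 0; first by rewrite u0 mul0r; case: eqP => // <-.
have k0 j : 0 <= k 0 j by rewrite leNgt; apply/negP => /hu e; rewrite e eqxx in u0.
case: eqP => [<-|kl].
  by rewrite /RB big1 ?mulr1 // => j _; rewrite mxE rb0 ?eqxx.
have [j hj] : exists j, k 0 j != l 0 j.
  by apply/existsP; rewrite -negb_forall; apply/negP => /forallP h; apply: kl; apply/rowP => j; apply/eqP.
by rewrite /RB (bigD1 j) //= mxE rb0 // (negbTE hj) mul0r mulr0.
Qed.

Definition bdd (dd : R) u := nnsupp u /\ exists M : R, forall l, cabs (u l) * dd ^ wdeg l <= M.

Lemma wdeg_nrm (k : 'rV[int]_r) : (forall j, 0 <= k 0 j) -> wdeg k = nrm k.
Proof.
move=> k0; rewrite /wdeg /nrm -natz natr_sum; apply: eq_bigr => j _.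
by rewrite natz gez0_abs.
Qed.

Lemma bdd_recable (dd x h : R) v u : 0 < dd -> 0 <= x < 1 -> 0 <= h ->
  (forall j, cabs (v 0 j) + h <= x * dd) -> bdd dd u -> recable v h u.
Proof.
move=> d0 x01 h0 hv [hu [M hM]].
have k0 k : u k != 0 -> forall j, 0 <= k 0 j.
  by move=> uk j; rewrite leNgt; apply/negP => /hu e; rewrite e eqxx in uk.
split; first by move=> k uk j; rewrite /expandable k0.
have [N hN] := nrm_geo r x01; have M0 : 0 <= M.
  by apply: le_trans (hM 0); rewrite mulr_ge0 ?cabs_ge0 ?exprz_ge0 ?ltW.
exists (M * N) => s us; apply: le_trans (_ : M * \sum_(k <- s) cabs ((x ^+ nrm k)%:C)%C <= _); last first.
  by rewrite ler_wpM2l ?hN.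
rewrite mulr_sumr; apply: ler_sum => k _; rewrite cabs_real.
have [u0|/k0 uk] := eqVneq (u k) 0; first by rewrite u0 cabs0 mul0r mulr_ge0.
rewrite ger0_norm; last by rewrite exprn_ge0 //; case/andP: x01.
have mwE : majmono v h k <= x ^+ nrm k * dd ^ wdeg k.
  rewrite wdeg_nrm // -exprnP -exprMn -prodrXr; apply: ler_prod => j _.
  have := uk j; case: (k 0 j) => m //= _; rewrite -exprnP.
  by rewrite exprn_ge0 ?addr_ge0 ?cabs_ge0 //= lerXn2r ?nnegrE ?hv ?addr_ge0 ?cabs_ge0 // (le_trans _ (hv j)) // addr_ge0 ?cabs_ge0.
apply: le_trans (_ : cabs (u k) * (x ^+ nrm k * dd ^ wdeg k) <= _).
  by rewrite ler_wpM2l ?cabs_ge0.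
by rewrite mulrCA mulrC ler_wpM2r ?hM // exprn_ge0 //; case/andP: x01.
Qed.

(** Both sides have the same sum on the torus of radius h about the new center, so [coef_unique]
    applies; the radius h1 leaves room for v' and h together. *)
Lemma Rec_Rec (h h1 : R) v v' u : 0 < h -> 0 < h1 -> (forall j, cabs (v' 0 j) + h <= h1) ->
  recable v h1 u -> recable v' h (Rec v u) -> recable (v + v') h u ->
  Rec v' (Rec v u) = Rec (v + v') u.
Proof.
move=> h0 h10 hv r1 r2 r3.
pose z0 : 'rV[C]_r := const_mx (h%:C)%C.
have z0E j : cabs (z0 0 j) = h by rewrite mxE cabs_real gtr0_norm.
have z00 : torus z0 by move=> j; rewrite -cabs_eq0 z0E gt_eqF.
apply: (coef_unique z00) => z z1.
have zh j : cabs (z 0 j) <= h by rewrite z1 z0E.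
have [s2 _] := Rec_val h0 zh r2; have [s3 _] := Rec_val h0 zh r3.
have zv j : cabs ((v' + z) 0 j) <= h1.
  by apply: le_trans (hv j); rewrite mxE (le_trans (ler_cabsD _ _)) // lerD2l.
have [s1 _] := Rec_val h10 zv r1.
exists (csum (fun k => u k * mono (v + v' + z) k)); split; last exact: s3.
by rewrite (abs_sumE s1) addrA in s2.
Qed.
End RecExtra.

(** * Transport of families of germs along a path *)

Section FamilyLift.
Variable R : realType.
Local Notation C := R[i].
Variables (n r N : nat) (al : 'I_N -> 'rV[int]_n) (ac : 'I_N -> C) (Q : 'M[int]_(r, n)).
Local Notation fam := (nat -> 'rV[int]_n -> 'rV[int]_r -> C).
Hypothesis dual : exists U : 'I_r -> 'cV[C]_n, forall j j', dotv (row j Q) (U j') = (j == j')%:R.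
Variables (B : seq 'rV[int]_n) (b : 'rV[int]_n -> C) (gam : R -> 'rV[C]_r).
Hypothesis gam_cont : forall s, 0 <= s <= 1 -> forall e : R, 0 < e -> exists del : R, 0 < del /\
     forall s', 0 <= s' <= 1 -> `|s' - s| < del -> polydisc (gam s) e (gam s').
Hypothesis gam_good : forall s, 0 <= s <= 1 -> torus (gam s) /\ good al ac Q (gam s).

Definition comb (Y : fam) : 'rV[int]_r -> C := fun l => \sum_(be <- B) b be * Y 0%N be l.

(** A property of the combined germ to be carried along: equality with the germ of a fixed Laurent
    series in [start_family], nothing in [continues_of_family]. *)
Variable Ex : R -> ('rV[int]_r -> C) -> Prop.
Hypothesis Ex_loc : forall s, 0 <= s <= 1 -> exists eta h1 : R, [/\ 0 < eta, 0 < h1 &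
  forall s1 s2, 0 <= s1 <= 1 -> 0 <= s2 <= 1 -> `|s1 - s| < eta -> `|s2 - s| < eta ->
  forall u (h : R), 0 < h -> (forall j, cabs ((gam s2 - gam s1) 0 j) + h <= h1) ->
    recable (gam s2 - gam s1) h u -> Ex s1 u -> Ex s2 (Rec (gam s2 - gam s1) u)].

Definition famst (s : R) (Y : fam) : Prop :=
  [/\ diag_rel al ac Q (gam s) Y, (forall k be, nnsupp (Y k be)) & Ex s (comb Y)].

Lemma bdd_sum (I : Type) (s : seq I) (dd : R) (k : I -> C) (u : I -> 'rV[int]_r -> C) :
  0 < dd -> (forall i, bdd dd (u i)) -> bdd dd (fun l => \sum_(i <- s) k i * u i l).
Proof.
move=> d0 hu; split; first by move=> l j lj; rewrite big1 // => i _; rewrite ((hu i).1 _ _ lj) mulr0.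
elim: s => [|i s [M hM]]; first by exists 0 => l; rewrite big_nil cabs0 mul0r.
have [_ [M' hM']] := hu i; exists (cabs (k i) * M' + M) => l; rewrite big_cons.
apply: le_trans (_ : (cabs (k i * u i l) + cabs (\sum_(i <- s) k i * u i l)) * dd ^ wdeg l <= _).
  by rewrite ler_wpM2r ?ler_cabsD // exprz_ge0 // ltW.
by rewrite mulrDl lerD // cabsM -mulrA ler_wpM2l ?cabs_ge0.
Qed.

Lemma comb_Rec v (h : R) (Y : fam) : 0 < h -> (forall k be, recable v h (Y k be)) ->
  comb (fun k be => Rec v (Y k be)) = Rec v (comb Y).
Proof.
move=> h0 hY; apply/funext => l; apply/esym/abs_sumE.
have := abs_sum_sum B (P := xpredT) (fun be _ => abs_sumZ (b be) (csumP (Rec_psm l h0 (hY 0%N be)))).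
by congr abs_sum; apply/funext => k; rewrite /comb mulr_suml; apply: eq_bigr => be _; rewrite mulrA.
Qed.

Let tr (s s' : R) (Y : fam) : fam := fun k be => Rec (gam s' - gam s) (Y k be).

(** The radius given by [local_ext] at a point serves every family at nearby times, so short
    transports preserve the state and compose, as [path_lift] requires. *)
Lemma family_lift (Y0 : fam) : famst 0 Y0 -> exists ys : R -> fam,
  [/\ ys 0 = Y0, (forall s, 0 <= s <= 1 -> famst s (ys s)),
    (forall s, 0 <= s <= 1 -> exists2 dd : R, 0 < dd & bdd dd (comb (ys s))) &
    forall s, 0 <= s <= 1 -> exists2 del : R, 0 < del &
      forall s', 0 <= s' <= 1 -> `|s' - s| < del -> comb (ys s') = Rec (gam s' - gam s) (comb (ys s))].
Proof.
move=> h0.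
have bnd s : 0 <= s <= 1 -> exists2 dd : R, 0 < dd & forall s' Y, 
    (forall j, cabs (gam s' 0 j - gam s 0 j) <= dd) -> famst s' Y -> forall k be, bdd dd (Y k be).
  move=> hs; have [ht hg] := gam_good hs.
  have [dd dd0 hd] := local_ext dual ht hg; exists dd => // s' Y hs' [h1 h2 _] k be.
  by split => //; exact: (hd (gam s')).
have loc s : 0 <= s <= 1 -> exists dd h1 eta : R, [/\ 0 < dd, 0 < h1, 0 < eta,
   (forall s', 0 <= s' <= 1 -> `|s' - s| < eta ->
     forall j, cabs (gam s' 0 j - gam s 0 j) <= Num.min (dd / 12) (h1 / 4)) /\
   (forall s' Y, (forall j, cabs (gam s' 0 j - gam s 0 j) <= dd) -> famst s' Y -> forall k be, bdd dd (Y k be)) &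
   forall s1 s2, 0 <= s1 <= 1 -> 0 <= s2 <= 1 -> `|s1 - s| < eta -> `|s2 - s| < eta ->
  forall u (h : R), 0 < h -> (forall j, cabs ((gam s2 - gam s1) 0 j) + h <= h1) ->
    recable (gam s2 - gam s1) h u -> Ex s1 u -> Ex s2 (Rec (gam s2 - gam s1) u)].
  move=> hs; have [dd dd0 hd] := bnd _ hs; have [eta [h1 [eta0 h10 he]]] := Ex_loc hs.
  have e0 : 0 < Num.min (dd / 12) (h1 / 4) by rewrite lt_min !divr_gt0.
  have [del [del0 hdel]] := gam_cont hs e0.
  exists dd, h1, (Num.min del eta); split => //.
  - by rewrite lt_min del0.
  - by split => // s' hs'; rewrite lt_min => /andP[h _] j; exact/ltW/hdel.
  - by move=> s1 s2 i1 i2; rewrite !lt_min => /andP[_ h2] /andP[_ h3]; exact: he.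
have main s (hs : 0 <= s <= 1) : exists h eta : R, [/\ 0 < h, 0 < eta, 
    (forall s1 s2 Y, 0 <= s1 <= 1 -> 0 <= s2 <= 1 -> `|s1 - s| < eta -> `|s2 - s| < eta ->
       famst s1 Y -> famst s2 (tr s1 s2 Y)),
    (forall s1 s2 s3 Y, 0 <= s1 <= 1 -> 0 <= s2 <= 1 -> 0 <= s3 <= 1 ->
        `|s1 - s| < eta -> `|s2 - s| < eta -> `|s3 - s| < eta ->
        famst s1 Y -> tr s2 s3 (tr s1 s2 Y) = tr s1 s3 Y) &
    (forall s1 s2 Y, 0 <= s1 <= 1 -> 0 <= s2 <= 1 -> `|s1 - s| < eta -> `|s2 - s| < eta ->
       famst s1 Y -> forall k be, recable (gam s2 - gam s1) h (Y k be))].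
  have [dd [h1 [eta [dd0 h10 eta0 [hg hb] hE]]]] := loc _ hs.
  (* Twice the distance allowed from gam s, so h bounds the distance between two nearby centers.
     Recentering by at most h with a radius up to 2 h stays within dd/2 since h <= dd/6; the 4 gives
     2 h <= h1. *)
  pose h : R := Num.min (dd / 12) (h1 / 4) + Num.min (dd / 12) (h1 / 4).
  have e0 : 0 < Num.min (dd / 12) (h1 / 4) by rewrite lt_min !divr_gt0.
  have eh : h <= dd / 6 by have : Num.min (dd / 12) (h1 / 4) <= dd / 12 by [rewrite ge_min lexx]; rewrite /h; lra.
  have eh1 : h <= h1 / 2 by have : Num.min (dd / 12) (h1 / 4) <= h1 / 4 by [rewrite ge_min lexx orbT]; rewrite /h; lra.
  have hh : 0 < h by rewrite addr_gt0.
  exists h, eta.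
  have vb s1 s2 : 0 <= s1 <= 1 -> 0 <= s2 <= 1 -> `|s1 - s| < eta -> `|s2 - s| < eta ->
      forall j, cabs ((gam s2 - gam s1) 0 j) <= h.
    move=> i1 i2 n1 n2 j; rewrite !mxE.
    have -> : gam s2 0 j - gam s1 0 j = (gam s2 0 j - gam s 0 j) - (gam s1 0 j - gam s 0 j) by ring.
    rewrite -[X in _ + X]opprK; apply: le_trans (ler_cabsD _ _) _; rewrite opprK cabsN; exact: lerD (hg _ i2 n2 j) (hg _ i1 n1 j).
  have Yb s1 Y : 0 <= s1 <= 1 -> `|s1 - s| < eta -> famst s1 Y -> forall k be, bdd dd (Y k be).
    move=> i1 n1; apply: hb => j; apply: le_trans (hg _ i1 n1 j) _.
    by rewrite ge_min; apply/orP; left; move: dd0; lra.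
  have x01 : 0 <= (1 / 2 : R) < 1 by lra.
  have rc (v : 'rV[C]_r) u (h' : R) : 0 <= h' -> h' <= h + h -> (forall j, cabs (v 0 j) <= h) -> bdd dd u -> recable v h' u.
    move=> h'0 h'h hv; apply: (bdd_recable dd0 x01 h'0) => j.
    by have := hv j; move: eh h'h; lra.
  have P1 s1 s2 Y : 0 <= s1 <= 1 -> 0 <= s2 <= 1 -> `|s1 - s| < eta -> `|s2 - s| < eta ->
       famst s1 Y -> famst s2 (tr s1 s2 Y).
    move=> i1 i2 n1 n2 hY; have [Y1 Y2 Y3] := hY.
    have rY k be : recable (gam s2 - gam s1) h (Y k be).
      by apply: rc; [exact: ltW | rewrite lerDl ltW | exact: vb | exact: Yb hY _ _].
    split.
    - have := diag_rel_Rec (w := gam s1) (v := gam s2 - gam s1) (fun k be => recable_shift_ok (ltW hh) (rY k be))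
        (fun k be l => Rec_psm l hh (rY k be)) Y1.
      by rewrite addrC subrK.
    - by move=> k be l j; exact: Rec_neg.
    rewrite (comb_Rec hh rY); apply: (hE s1 s2 i1 i2 n1 n2 _ h hh) => //.
      by move=> j; have := vb _ _ i1 i2 n1 n2 j; move: eh1; lra.
    apply: rc; [exact: ltW | by rewrite lerDl ltW | exact: vb |].
    by apply: bdd_sum => // be; exact: Yb hY _ _.
  split; [exact: hh | exact: eta0 | exact: P1 | |].
    move=> s1 s2 s3 Y i1 i2 i3 n1 n2 n3 hY; apply/funext => k; apply/funext => be; rewrite /tr.
    have -> : gam s3 - gam s1 = (gam s2 - gam s1) + (gam s3 - gam s2) by rewrite [RHS]addrC subrKA.
    apply: (Rec_Rec (h := h) (h1 := h + h)); rewrite ?addr_gt0 //.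
    - by move=> j; rewrite lerD2r; exact: vb.
    - apply: rc; [by rewrite addr_ge0 // ltW | by [] | exact: vb | exact: Yb hY _ _].
    - apply: rc; [exact: ltW | by rewrite lerDl ltW | exact: vb | exact: (Yb s2 _ i2 n2 (P1 _ _ _ i1 i2 n1 n2 hY))].
    have -> : (gam s2 - gam s1) + (gam s3 - gam s2) = gam s3 - gam s1 by rewrite addrC subrKA.
    by apply: rc; [exact: ltW | rewrite lerDl ltW | exact: vb | exact: Yb hY _ _].
  move=> s1 s2 Y i1 i2 n1 n2 hY k be.
  by apply: rc; [exact: ltW | rewrite lerDl ltW | exact: vb | exact: Yb hY _ _].
have [||ys [y0 yS yl]] := path_lift (tr := tr) h0.
- by move=> s Y [_ Y2 _]; apply/funext => k; apply/funext => be; rewrite /tr subrr Rec0.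
- by move=> s /main[h [eta [_ e0 h1 h2 _]]]; exists eta.
exists ys; split => //.
  move=> s hs; have [dd d0 hd] := bnd _ hs; exists dd => //; apply: bdd_sum => // be.
  by apply: hd (yS _ hs) _ _ => j; rewrite subrr cabs0 ltW.
move=> s hs; have [del del0 hdel] := yl _ hs; have [h [eta [h00 e0 _ _ hr]]] := main _ hs.
exists (Num.min del eta); first by rewrite lt_min del0.
move=> s' hs'; rewrite lt_min => /andP[n1 n2]; rewrite (hdel _ hs' n1); apply: (comb_Rec h00).
by apply: hr => //; [rewrite subrr normr0 | exact: yS].
Qed.
End FamilyLift.

Section Continue.
Variable R : realType.
Local Notation C := R[i].
Variable r : nat.
Implicit Types (u d : 'rV[int]_r -> C) (t v : 'rV[C]_r).

Lemma pmono_mono t (k : 'rV[nat]_r) : pmono t k = mono t (map_mx Posz k).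
Proof. by apply: eq_bigr => j _; rewrite mxE. Qed.

Lemma map_mx_Posz_inj : injective (fun k : 'rV[nat]_r => map_mx Posz k).
Proof. by move=> k l /rowP h; apply/rowP => j; have := h j; rewrite !mxE => -[]. Qed.

Lemma abs_sum_nat (f : 'rV[int]_r -> C) l : (forall (k : 'rV[int]_r) j, k 0 j < 0 -> f k = 0) ->
  abs_sum f l -> abs_sum (fun k : 'rV[nat]_r => f (map_mx Posz k)) l.
Proof.
move=> f0; apply: (abs_sum_inj map_mx_Posz_inj) => k fk; exists (\row_j absz (k 0%R j)).
apply/rowP => j; rewrite !mxE gez0_abs // leNgt; apply/negP => /f0 e.
by rewrite e eqxx in fk.
Qed.

Lemma bdd_psum (dd : R) u v t : 0 < dd -> bdd dd u -> (forall j, cabs ((t - v) 0 j) <= dd / 2) ->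
  psum_at (fun k => u (map_mx Posz k)) v t (csum (fun k => u k * mono (t - v) k)).
Proof.
move=> d0 hu ht.
have x01 : 0 <= (1 / 2 : R) < 1 by lra.
have rc : recable 0 (dd / 2) u.
  apply: (bdd_recable d0 x01) hu; first by rewrite divr_ge0 ?ltW.
  by move=> j; rewrite mxE cabs0 add0r mul1r mulrC.
have d2 : 0 < dd / 2 by rewrite divr_gt0.
have [_] := Rec_val d2 ht rc; rewrite add0r => /csumP /abs_sum_nat h.
rewrite /psum_at; under eq_fun do rewrite pmono_mono; apply: h => k j kj.
by rewrite (hu.1 _ _ kj) mul0r.
Qed.

Lemma Rec_psum (h : R) u v v' t : 0 < h -> recable (v' - v) h u -> (forall j, cabs ((t - v') 0 j) <= h) ->
  psum_at (fun k => Rec (v' - v) u (map_mx Posz k)) v' t (csum (fun k => u k * mono (t - v) k)).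
Proof.
move=> h0 rc ht; have [hs _] := Rec_val h0 ht rc.
rewrite /psum_at; under eq_fun do rewrite pmono_mono.
have -> : t - v = v' - v + (t - v') by rewrite [RHS]addrC subrKA.
by apply: abs_sum_nat hs => k j kj; rewrite (Rec_neg _ _ kj) mul0r.
Qed.

Variables (n N : nat) (al : 'I_N -> 'rV[int]_n) (ac : 'I_N -> C) (Q : 'M[int]_(r, n)).
Hypothesis dual : exists U : 'I_r -> 'cV[C]_n, forall j j', dotv (row j Q) (U j') = (j == j')%:R.
Variables (B : seq 'rV[int]_n) (b : 'rV[int]_n -> C) (gam : R -> 'rV[C]_r).
Hypothesis gam_cont : forall s, 0 <= s <= 1 -> forall e : R, 0 < e -> exists del : R, 0 < del /\
     forall s', 0 <= s' <= 1 -> `|s' - s| < del -> polydisc (gam s) e (gam s').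
Hypothesis gam_good : forall s, 0 <= s <= 1 -> torus (gam s) /\ good al ac Q (gam s).

Lemma continues_of_family (h : R) Y0 d : 0 < h -> recable (gam 0) h d ->
  diag_rel al ac Q (gam 0) Y0 -> (forall k be, nnsupp (Y0 k be)) -> comb B b Y0 = Rec (gam 0) d ->
  continues_along d gam.
Proof.
move=> h0 rc Y1 Y2 Y3.
have [||ys [y0 yS yb yl]] := @family_lift R n r N al ac Q dual B b gam gam_cont gam_good (fun _ _ => True) _ Y0.
- by move=> s _; exists 1, 1; split.
- by split.
pose D s := comb B b (ys s).
have /choice[dd hd] : forall s, exists dd : R, 0 <= s <= 1 -> 0 < dd /\ bdd dd (D s).
  move=> s; have [/yb[x x0 xb]|hs] := pselect (0 <= s <= 1); first by exists x.
  by exists 1 => /hs.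
exists (fun s k => D s (map_mx Posz k)), (fun s => dd s / 2); split.
- move=> s /hd[d0 hb]; split; first by rewrite divr_gt0.
  move=> t ht; apply: (bdd_psum d0 hb _).1 => j; rewrite mxE [X in _ + X]mxE; exact/ltW/ht.
- exists h; split => // t ht; exists (csum (fun k => d k * mono t k)).
  have th j : cabs ((t - gam 0) 0 j) <= h by rewrite mxE [X in _ + X]mxE; exact/ltW/ht.
  rewrite /D y0 Y3; split.
    have := @Rec_psum h d 0 (gam 0) t h0; rewrite !subr0; exact.
  by have [_] := Rec_val h0 th rc; rewrite addrC subrK => /csumP.
move=> s hs; have [d0 hb] := hd _ hs; have [del del0 hdel] := yl _ hs.
(* A move of the center by dd/4 followed by a radius dd/4 stays within dd/2, where the bound [dd]
   gives absolute convergence. *)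
have e0 : 0 < dd s / 4 by rewrite divr_gt0.
have [del' [del'0 hdel']] := gam_cont hs e0.
exists (Num.min del del'); split; first by rewrite lt_min del0.
move=> s' hs'; rewrite lt_min => /andP[n1 n2]; have gs := hdel' _ hs' n2.
have e2 : dd s / 4 + dd s / 4 = dd s / 2 by lra.
split; first by move=> j; apply: lt_le_trans (gs j) _; rewrite -e2 lerDl ltW.
exists (dd s / 4); split => // t ht; exists (csum (fun k => D s k * mono (t - gam s) k)).
have x01 : 0 <= (1 / 2 : R) < 1 by lra.
have th j : cabs ((t - gam s') 0 j) <= dd s / 4 by rewrite mxE [X in _ + X]mxE; exact/ltW/ht.
have gsl j : cabs ((gam s' - gam s) 0 j) <= dd s / 4 by rewrite mxE [X in _ + X]mxE; exact/ltW/gs.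
split.
  apply: (bdd_psum d0 hb) => j; rewrite -e2.
  have -> : t - gam s = (t - gam s') + (gam s' - gam s) by rewrite subrKA.
  by rewrite mxE; apply: le_trans (ler_cabsD _ _) _; exact: lerD.
rewrite /D (hdel _ hs' n1); apply: (Rec_psum e0) => //.
apply: bdd_recable d0 x01 _ _ hb; first exact: ltW.
by move=> j; apply: le_trans (lerD (gsl j) (lexx _)) _; rewrite e2 mul1r mulrC.
Qed.
End Continue.

(** * The initial germ *)

Section Lattice.
Variable R : realType.
Local Notation C := R[i].
Variables (n r : nat) (Q : 'M[int]_(r, n)).
Hypothesis Qinj : forall k : 'rV[int]_r, k *m Q = 0 -> k = 0.

Let intr_mx_inj m1 m2 (V W : 'M[int]_(m1, m2)) : map_mx intr V = map_mx intr W :> 'M[rat]_(m1, m2) -> V = W.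
Proof. by move=> /matrixP h; apply/matrixP => i j; have := h i j; rewrite !mxE => /intr_inj. Qed.

(** Clearing denominators turns independence over Z into independence over Q; a rational right
    inverse times a common denominator gives [U]. *)
Lemma lattice_rinv : exists2 D : int, D != 0 & exists U : 'M[int]_(n, r), Q *m U = D%:M.
Proof.
have free : row_free (map_mx intr Q : 'M[rat]_(r, n)).
  apply: inj_row_free => v hv; have [M [m [M0 hm]]] := rat_clear v.
  have mE : map_mx intr m = M%:~R *: v :> 'rV[rat]_r by apply/rowP => i; rewrite !mxE hm.
  have M0' : (M%:~R : rat) != 0 by rewrite intr_eq0 gt_eqF.
  have /intr_mx_inj : map_mx intr (m *m Q) = map_mx intr 0 :> 'rV[rat]_n.
    by rewrite map_mxM mE -scalemxAl hv scaler0 map_mx0.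
  move=> /Qinj m0; have := mE; rewrite m0 map_mx0 => /esym/eqP.
  by rewrite scaler_eq0 (negbTE M0') => /eqP.
have [V hV] := row_freeP free; have [M [m [M0 hm]]] := rat_clear (mxvec V).
exists M; first by rewrite gt_eqF.
exists (vec_mx m); apply: intr_mx_inj.
have -> : map_mx intr (Q *m vec_mx m) = map_mx intr Q *m (M%:~R *: V) :> 'M[rat]_r.
  rewrite map_mxM; congr (_ *m _); apply/matrixP => i j.
  have h := hm (mxvec_index i j); rewrite -(vec_mxK m) !mxvecE in h.
  by rewrite mxE [RHS]mxE.
by rewrite -scalemxAr hV map_scalar_mx scalemx1.
Qed.

Lemma lattice_dual : exists U : 'I_r -> 'cV[C]_n, forall j j', dotv (row j Q) (U j') = (j == j')%:R.
Proof.
have [D D0 [U hU]] := lattice_rinv.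
exists (fun j' => \col_i ((U i j')%:~R / D%:~R)) => j j'.
transitivity (((Q *m U) j j')%:~R / D%:~R : C).
  rewrite mxE rmorph_sum mulr_suml; apply: eq_bigr => i _.
  by rewrite !mxE rmorphM mulrA.
rewrite hU mxE; case: eqP => _; rewrite ?mulr0n ?mul0r // mulr1n divff //.
by rewrite intr_eq0.
Qed.

(** From k Q U = D k. It compares weights on Z^r with weights on Z^n along the sublattice. *)
Lemma lattice_nrm : exists S : nat, forall k : 'rV[int]_r, (nrm k <= S * nrm (k *m Q))%N.
Proof.
have [D D0 [U hU]] := lattice_rinv.
exists (\sum_j \sum_i absz (U i j))%N => k; rewrite /nrm big_distrl /=; apply: leq_sum => j _.
apply: (@leq_trans (absz (D * k 0%R j))); first by rewrite abszM leq_pmull // absz_gt0.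
have -> : D * k 0 j = \sum_i (k *m Q) 0 i * U i j.
  by have := congr1 (fun M : 'rV[int]_r => M 0 j) (mulmxA k Q U); rewrite hU mul_mx_scalar !mxE.
rewrite -lez_nat; apply: le_trans (_ : \sum_i `|(k *m Q) 0 i * U i j|%R <= _).
  by rewrite abszE; exact: ler_norm_sum.
rewrite big_distrl /= -natz natr_sum; apply: ler_sum => i _.
rewrite normrM mulrC natz PoszM !abszE ler_wpM2l //.
rewrite -!abszE lez_nat (bigD1 i) //=; exact: leq_addr.
Qed.
End Lattice.

(** * Recentering a Laurent series inside its domain of convergence *)

Section Near.
Variable R : realType.
Local Notation C := R[i].
Variable r : nat.
Implicit Types (u d : 'rV[int]_r -> C) (s t v : 'rV[C]_r).

(** The majorant of a monomial is its value at a real point with coordinates |v_j| + h or |v_j| - h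
    according to the sign of k_j, and this point lies in the polyannulus controlled by the
    weight. *)
Lemma wsm_recable s v (tau h : R) u : torus s -> 1 <= tau -> 0 <= h ->
  (forall j, cabs (v 0 j) + h <= tau * cabs (s 0 j)) ->
  (forall j, tau^-1 * cabs (s 0 j) <= cabs (v 0 j) - h) -> wsm s tau u -> recable v h u.
Proof.
move=> ts t1 h0 h1 h2 [M hM].
have t0 : 0 < tau by apply: lt_le_trans t1.
have hv j : h < cabs (v 0 j).
  rewrite -subr_gt0; apply: lt_le_trans (h2 j).
  by rewrite mulr_gt0 ?invr_gt0 // cabs_gt0.
split; first by move=> k _ j; rewrite /expandable hv orbT.
exists M => sq usq; apply: le_trans (hM sq usq); apply: ler_sum => k _.
rewrite cabsM ler_wpM2l ?cabs_ge0 //.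
pose z : 'rV[C]_r := \row_j ((if 0 <= k 0 j then cabs (v 0 j) + h else cabs (v 0 j) - h)%:C)%C.
have zE j : cabs (z 0 j) = if 0 <= k 0 j then cabs (v 0 j) + h else cabs (v 0 j) - h.
  rewrite mxE cabs_real; case: ifP => _; rewrite ger0_norm //; first by rewrite addr_ge0 ?cabs_ge0.
  by rewrite subr_ge0 ltW.
have -> : majmono v h k = cabs (mono z k).
  by rewrite cabs_mono; apply: eq_bigr => j _; rewrite zE; case: (k 0 j).
apply: mono_wt_le => // j; rewrite zE.
have := h1 j; have := h2 j; case: ifP => _ a1 a2; apply/andP; split => //.
  by apply: le_trans a1 _; move: h0; lra.
by apply: le_trans a2; move: h0; lra.
Qed.

Lemma wsm_recable_near s (tau : R) : torus s -> 1 < tau -> exists2 h1 : R, 0 < h1 &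
  forall v, (forall j, cabs (v 0 j - s 0 j) <= h1) -> forall h, 0 <= h -> h <= h1 ->
  forall u, wsm s tau u -> recable v h u.
Proof.
move=> ts t1; have t0 : 0 < tau by apply: lt_trans t1.
have [x x0 hx] := torus_lb ts.
have i1 : tau^-1 < 1 by rewrite invf_lt1.
have ti : 1 - tau^-1 <= tau - 1.
  have : tau * tau^-1 = 1 by rewrite divff ?gt_eqF.
  have : 0 < (tau - 1) * (1 - tau^-1) by rewrite mulr_gt0 ?subr_gt0.
  nra.
(* 2 h1 is at most the distance from |s_j| to either edge of the annulus, the inner edge being the
   closer as 1 - 1/tau <= tau - 1. *)
pose h1 : R := x * (1 - tau^-1) / 2.
have h10 : 0 < h1 by rewrite divr_gt0 ?mulr_gt0 ?subr_gt0.
have h11 : h1 + h1 = x * (1 - tau^-1) by rewrite -splitr.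
exists h1 => // v hv h h0 hh1 u.
have A j : h1 + h1 <= cabs (s 0 j) * (1 - tau^-1).
  by rewrite h11 ler_wpM2r ?hx // subr_ge0 ltW.
have A' j : cabs (s 0 j) * (1 - tau^-1) <= cabs (s 0 j) * (tau - 1) by rewrite ler_wpM2l ?cabs_ge0.
apply: wsm_recable => // [|j|j]; first exact: ltW.
  have := ler_cabsB (v 0 j) (s 0 j); have := hv j; have := A j; have := A' j; rewrite !mulrBr mulr1 [tau * _]mulrC.
  by move: hh1; lra.
have := ler_cabsB (s 0 j) (v 0 j); rewrite cabsB; have := hv j; have := A j; rewrite mulrBr mulr1 [tau^-1 * _]mulrC.
by move: hh1; lra.
Qed.

Lemma wsm_move s v (tau tau1 tau2 : R) u : torus s -> torus v -> 1 <= tau1 -> 0 <= tau2 -> tau1 * tau2 <= tau ->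
  (forall j, tau1^-1 * cabs (s 0 j) <= cabs (v 0 j) <= tau1 * cabs (s 0 j)) -> wsm s tau u -> wsm v tau2 u.
Proof.
move=> ts tv t1 t2 t12 hv; apply: abs_summable_le1 => k; rewrite cabsM [leRHS]cabsM ler_wpM2l ?cabs_ge0 //.
have tt : 0 <= tau1 * tau2 by rewrite mulr_ge0 // (le_trans _ t1).
rewrite cabs_wt // cabs_wt; last exact: le_trans t12.
apply: le_trans (_ : cabs (mono s k) * (tau1 * tau2) ^+ nrm k <= _); last first.
  by rewrite ler_wpM2l ?cabs_ge0 // lerXn2r ?nnegrE // (le_trans tt).
rewrite exprMn mulrA ler_wpM2r ?exprn_ge0 //.
by apply: le_trans (mono_wt_le ts k t1 hv) _; rewrite cabs_wt // (le_trans _ t1).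
Qed.

(** By openness the series converges at the 2^r points obtained by multiplying each t_j by 1 + eta
    or its inverse; the weight of k is attained at the one whose choices match the signs of k. *)
Lemma wsm_of_conv d t : conv_domain d t -> torus t /\ exists2 tau : R, 1 < tau & wsm t tau d.
Proof.
move=> [e [e0 he]].
have tt : torus t by apply: (he t _).1 => j; rewrite subrr cabs0.
split=> //; pose S : R := 1 + \sum_j cabs (t 0 j).
have S0 : 0 < S by rewrite ltr_pwDl // sumr_ge0 // => j _; apply: cabs_ge0.
have tS j : cabs (t 0 j) < S.
  rewrite /S (bigD1 j) //= addrCA ltrDl ltr_pwDl // sumr_ge0 // => i _; exact: cabs_ge0.
pose eta : R := e / S; have eta0 : 0 < eta by rewrite divr_gt0.
exists (1 + eta); first by rewrite ltrDl.
pose tc (f : {ffun 'I_r -> bool}) : 'rV[C]_r := \row_j (t 0 j * ((if f j then 1 + eta else (1 + eta)^-1)%:C)%C).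
have p1 : 0 < 1 + eta by rewrite addr_gt0.
have tcE f j : cabs (tc f 0 j) = cabs (t 0 j) * (if f j then 1 + eta else (1 + eta)^-1).
  by rewrite mxE cabsM cabs_real; case: (f j); rewrite gtr0_norm ?invr_gt0.
have /choice[M hM] : forall f, exists M : R, forall sq, uniq sq -> \sum_(k <- sq) cabs (d k * mono (tc f) k) <= M.
  move=> f; apply: (he (tc f) _).2 => j.
  have -> : tc f 0 j - t 0 j = t 0 j * (((if f j then 1 + eta else (1 + eta)^-1) - 1)%:C)%C.
    by rewrite mxE rmorphB mulrBr mulr1.
  rewrite cabsM cabs_real; apply: le_lt_trans (_ : cabs (t 0 j) * eta < e).
    rewrite ler_wpM2l ?cabs_ge0 //; case: (f j); first by rewrite addrAC subrr add0r gtr0_norm.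
    have := divff (lt0r_neq0 p1); set y := (1 + eta)^-1 => hy.
    have y0 : 0 < y by rewrite invr_gt0.
    by rewrite ler_norml; apply/andP; split; nra.
  by rewrite /eta mulrC -mulrA -ltr_pdivlMl // mulVf ?gt_eqF // mulrC ltr_pdivrMr // mul1r.
exists (\sum_f M f) => sq us; apply: le_trans (_ : \sum_f \sum_(k <- sq) cabs (d k * mono (tc f) k) <= _); last first.
  by apply: ler_sum => f _; apply: hM.
rewrite exchange_big /=; apply: ler_sum => k _; pose f := [ffun j => 0 <= k 0 j].
rewrite (bigD1 f) //=; apply: le_trans (_ : cabs (d k * mono (tc f) k) <= _); last first.
  by rewrite lerDl sumr_ge0 // => g _; apply: cabs_ge0.
rewrite cabsM [leRHS]cabsM ler_wpM2l ?cabs_ge0 // (cabs_wt _ _ (ltW p1)) !cabs_mono -prodrXr -big_split /=.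
rewrite le_eqVlt; apply/orP; left; apply/eqP; apply: eq_bigr => j _; rewrite tcE ffunE expfzMl; congr (_ * _).
by case: (k 0 j) => m //=; rewrite NegzE -exprnN exprVn invrK.
Qed.
End Near.

(** * A curve avoiding the zeros of a Laurent polynomial *)

Section Avoid.
Variable R : realType.
Local Notation C := R[i].

Lemma log_floor (x q : R) : 1 < x -> 0 < q -> exists m : int, x^-1 * q <= x ^ m <= x * q.
Proof.
move=> x1; have x0 : 0 < x by apply: lt_trans x1.
have H (p : R) : 1 <= p -> exists m : int, x^-1 * p <= x ^ m <= x * p.
  move=> p1; have ex : exists m, p <= x ^+ m.
    have [k hk] : exists k : nat, p <= k%:R * (x - 1).
      exists (Num.bound (p / (x - 1))); rewrite -ler_pdivrMr ?subr_gt0 //.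
      by apply/ltW/archi_boundP; rewrite divr_ge0 ?subr_ge0 ?(ltW x1) // (le_trans ler01).
    exists k; apply: le_trans hk _; elim: k => [|k IH]; first by rewrite mul0r ler01.
    rewrite exprS -natr1 mulrDl mul1r; apply: le_trans (lerD IH (lexx _)) _.
    have : 1 <= x ^+ k by rewrite exprn_ege1 // ltW.
    by nra.
  have [m hm hmin] := ex_minnP ex; exists m%:Z; rewrite -exprnP; apply/andP; split.
    by apply: le_trans hm; rewrite ler_piMl ?(le_trans ler01) // invf_le1 // ltW.
  case: m hm hmin => [|m] hm hmin; first by rewrite expr0 mulr_ege1 // ltW.
  rewrite exprS ler_pM2l // leNgt; apply/negP => /ltW /hmin.
  by rewrite ltnn.
move=> q0; have [/H//|q1] := leP 1 q.
have [|m /andP[h1 h2]] := H q^-1; first by rewrite invf_ge1 // ltW.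
have xm : 0 < x ^ m by rewrite exprz_gt0.
exists (- m); rewrite -invr_expz; apply/andP; split.
  by rewrite -[_ * q]invrK invfM invrK lef_pV2 ?posrE ?mulr_gt0 ?invr_gt0.
by rewrite -[_ * q]invrK invfM lef_pV2 ?posrE ?mulr_gt0 ?invr_gt0.
Qed.

Definition lpoly (f : C -> C) : Prop := exists m (P : {poly C}), forall x, x != 0 -> f x * x ^+ m = P.[x].

Lemma lpoly_cst c : lpoly (fun=> c).
Proof. by exists 0%N, (c%:P) => x _; rewrite hornerC mulr1. Qed.

Lemma lpolyD f g : lpoly f -> lpoly g -> lpoly (fun x => f x + g x).
Proof.
move=> [m [P hP]] [k [S hS]]; exists (m + k)%N, (P * 'X^k + S * 'X^m) => x x0.
by rewrite !hornerE -hP // -hS // exprD; ring.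
Qed.

Lemma lpolyM f g : lpoly f -> lpoly g -> lpoly (fun x => f x * g x).
Proof.
move=> [m [P hP]] [k [S hS]]; exists (m + k)%N, (P * S) => x x0.
by rewrite hornerM -hP // -hS // exprD; ring.
Qed.

Lemma lpolyXz (k : int) : lpoly (fun x => x ^ k).
Proof.
case: k => k; first by exists 0%N, 'X^k => x _; rewrite hornerXn mulr1.
by exists k.+1, 1 => x x0; rewrite hornerC NegzE -exprnN mulVf // expf_neq0.
Qed.

Lemma lpoly_sum (I : Type) (s : seq I) (P : pred I) (f : I -> C -> C) : (forall i, lpoly (f i)) ->
  lpoly (fun x => \sum_(i <- s | P i) f i x).
Proof.
move=> h; elim: s => [|i s IH]; first by under eq_fun do rewrite big_nil; exact: lpoly_cst.
by under eq_fun do rewrite big_cons; case: (P i) => //; exact: lpolyD.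
Qed.

Lemma lpoly_prod (I : Type) (s : seq I) (P : pred I) (f : I -> C -> C) : (forall i, lpoly (f i)) ->
  lpoly (fun x => \prod_(i <- s | P i) f i x).
Proof.
move=> h; elim: s => [|i s IH]; first by under eq_fun do rewrite big_nil; exact: lpoly_cst.
by under eq_fun do rewrite big_cons; case: (P i) => //; exact: lpolyM.
Qed.

Lemma lpoly_roots f : lpoly f -> f 1 != 0 -> exists rs : seq C, forall x, x != 0 -> f x = 0 -> x \in rs.
Proof.
move=> [m [P hP]] f1; have [rs hrs] := closed_field_poly_normal P.
have P0 : P != 0.
  apply: contraNneq f1 => P0; have := hP 1 (oner_neq0 _).
  by rewrite P0 horner0 expr1n mulr1 => ->.
exists rs => x x0 fx; have /esym := hP _ x0; rewrite fx mul0r => /eqP.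
by rewrite -/(root P x) hrs rootZ ?lead_coef_eq0 // root_prod_XsubC.
Qed.

(* For x > 1 and small y > 0 the point [turn x y] has modulus x and real part at least 1, and
   the segments from 1 to these points meet only at 1. *)
Definition turn (x y : R) : C := Complex (x * (1 - y ^+ 2) / (1 + y ^+ 2)) (x * (2 * y) / (1 + y ^+ 2)).

Lemma cabs_turn x y : 0 <= x -> cabs (turn x y) = x.
Proof.
move=> x0; rewrite /cabs /turn /=; have y1 : 1 + y ^+ 2 != 0 by rewrite gt_eqF // ltr_pwDl // sqr_ge0.
rewrite -[RHS]ger0_norm // -sqrtr_sqr; congr Num.sqrt; field; exact: y1.
Qed.

(** With z - 1 = a + i b, the parameter is a root w of b (x + 1) w^2 + 2 a x w - b (x - 1). Here b >
    0, so the product of the roots is negative and only one is positive. *)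
Lemma turn_inj (x y y' : R) (z : C) (s s' : R) : 1 < x -> 0 < y -> 0 < y' -> 0 < s -> 0 < s' ->
  z - 1 = (s%:C)%C * (turn x y - 1) -> z - 1 = (s'%:C)%C * (turn x y' - 1) -> y = y'.
Proof.
move=> x1 y0 y'0 s0 s'0 h h'.
have D0 (w : R) : 1 + w ^+ 2 != 0 by rewrite gt_eqF // ltr_pwDl // sqr_ge0.
have key (w s1 : R) : 0 < w -> 0 < s1 -> z - 1 = (s1%:C)%C * (turn x w - 1) ->
    0 < complex.Im z /\ complex.Im z * ((x - 1) - (x + 1) * w ^+ 2) = (complex.Re z - 1) * (2 * x * w).
  move=> w0 s10; case: z h h' => a b _ _ /eqP; rewrite /turn eq_complex /= => /andP[/eqP e1 /eqP e2].
  have {}e1 : a - 1 = s1 * (x * (1 - w ^+ 2) / (1 + w ^+ 2) - 1) by rewrite e1; ring.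
  have {}e2 : b = s1 * (x * (2 * w) / (1 + w ^+ 2)) by rewrite -[LHS]subr0 e2; ring.
  split; last by rewrite e1 e2; field; exact: D0.
  by rewrite e2 !(mulr_gt0, invr_gt0, divr_gt0) // ?ltr_pwDl ?sqr_ge0 // (lt_trans _ x1).
have [b0 e1] := key _ _ y0 s0 h; have [_ e2] := key _ _ y'0 s'0 h'.
set b := complex.Im z in b0 e1 e2; set a := complex.Re z - 1 in e1 e2.
have e3 : b * ((y' - y) * ((x - 1) + (x + 1) * (y * y'))) = 0.
  transitivity (b * ((x - 1) - (x + 1) * y ^+ 2) * y' - b * ((x - 1) - (x + 1) * y' ^+ 2) * y); first by ring.
  by rewrite e1 e2; ring.
have p0 : 0 < x - 1 + (x + 1) * (y * y').
  by rewrite addr_gt0 ?subr_gt0 // !mulr_gt0 // addr_gt0 // (lt_trans _ x1).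
move/eqP: e3; rewrite !mulf_eq0 (gt_eqF b0) (gt_eqF p0) orbF /= subr_eq0.
by move=> /eqP ->.
Qed.

Lemma fresh_pos (y0 : R) (l : seq R) : 0 < y0 -> exists2 y, 0 < y <= y0 & y \notin l.
Proof.
move=> h0; pose f (k : nat) := y0 / k.+1%:R.
have f_inj : injective f.
  move=> k k' /(mulfI (lt0r_neq0 h0)) /invr_inj /eqP.
  by rewrite eqr_nat => /eqP [].
have [/hasP[y /mapP[k _ ->] hy]|] := boolP (has (fun y => y \notin l) (map f (iota 0 (size l).+1))).
  exists (f k) => //; rewrite divr_gt0 //= ler_pdivrMr // ler_peMr ?(ltW h0) //.
  by rewrite ler1n.
rewrite -all_predC => /allP h; have := @uniq_leq_size _ (map f (iota 0 (size l).+1)) l.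
rewrite map_inj_uniq ?iota_uniq // size_map size_iota ltnn => /(_ isT).
suff H : {subset [seq f i | i <- iota 0 (size l).+1] <= l} by move/(_ H).
by move=> y /h /=; rewrite negbK.
Qed.

(** Each point of [rs] lies on at most one segment, so finitely many y are excluded. For y <= (x -
    1)/(x + 1) <= 1 also y^2 <= (x - 1)/(x + 1), the condition for a real part at least 1. *)
Lemma turn_avoid (x : R) (rs : seq C) : 1 < x -> exists y : R,
  1 <= complex.Re (turn x y) /\
  forall s : R, 0 < s <= 1 -> 1 + (s%:C)%C * (turn x y - 1) \notin rs.
Proof.
move=> x1; pose y0 : R := (x - 1) / (x + 1).
have x0 : 0 < x by apply: lt_trans x1.
have y00 : 0 < y0 by rewrite divr_gt0 ?subr_gt0 // addr_gt0.
have y01 : y0 <= 1 by rewrite ler_pdivrMr ?addr_gt0 // mul1r; lra.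
have /choice[yb hyb] : forall z : C, exists y : R, forall y' s, 0 < y' -> 0 < s ->
    z - 1 = (s%:C)%C * (turn x y' - 1) -> y' = y.
  move=> z; have [[y [s [h1 h2 h3]]]|h] := pselect (exists y s, [/\ 0 < y, 0 < s & z - 1 = (s%:C)%C * (turn x y - 1)]).
    by exists y => y' s' a1 a2 a3; apply: (@turn_inj x y' y z s' s).
  by exists 0 => y' s' a1 a2 a3; case: h; exists y', s'.
have [y /andP[yp yl] hy] := fresh_pos (map yb rs) y00.
exists y; split.
  rewrite /turn /= ler_pdivlMr ?ltr_pwDl ?sqr_ge0 // mul1r.
  have h1 : y ^+ 2 <= y0.
    by rewrite expr2; apply: le_trans (ler_pM (ltW yp) (ltW yp) yl (le_trans yl y01)) _; rewrite mulr1.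
  have : y0 * (x + 1) = x - 1 by rewrite divfK // gt_eqF // addr_gt0.
  have : y ^+ 2 * (x + 1) <= y0 * (x + 1) by rewrite ler_pM2r // addr_gt0.
  lra.
move=> s /andP[s0 _]; apply: contraNN hy => hin; apply/mapP; exists (1 + (s%:C)%C * (turn x y - 1)) => //.
by apply: (hyb _ _ s) => //; rewrite addrAC subrr add0r.
Qed.
End Avoid.

Section RayPath.
Variable R : realType.
Local Notation C := R[i].
Variables (n r N : nat) (al : 'I_N -> 'rV[int]_n) (ac : 'I_N -> C) (Q : 'M[int]_(r, n)).

Lemma pow_lip (x y : C) (b : R) (m : nat) : 1 <= b -> cabs x <= b -> cabs y <= b ->
  cabs (x ^+ m - y ^+ m) <= m%:R * b ^+ m * cabs (x - y).
Proof.
move=> b1 xb yb; have b0 : 0 <= b by apply: le_trans b1.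
elim: m => [|m IH]; first by rewrite !expr0 subrr cabs0 !mul0r.
have -> : x ^+ m.+1 - y ^+ m.+1 = x * (x ^+ m - y ^+ m) + (x - y) * y ^+ m by rewrite !exprS; ring.
apply: le_trans (ler_cabsD _ _) _; rewrite !cabsM cabsX -natr1 !mulrDl mul1r exprS.
apply: lerD; last first.
  rewrite mulrC ler_wpM2r ?cabs_ge0 //; apply: le_trans (_ : b ^+ m <= _).
    by apply: lerXn2r; rewrite ?nnegrE ?cabs_ge0.
  by rewrite ler_peMl // exprn_ge0.
apply: le_trans (ler_pM (cabs_ge0 _) (cabs_ge0 _) xb IH) _.
by rewrite !mulrA [b * _]mulrC.
Qed.

Lemma powz_lip (x y : C) (b : R) (k : int) : 1 <= cabs x <= b -> 1 <= cabs y <= b ->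
  cabs (x ^ k - y ^ k) <= (absz k)%:R * b ^+ absz k * cabs (x - y).
Proof.
move=> /andP[x1 xb] /andP[y1 yb]; have b1 : 1 <= b by apply: le_trans xb.
case: k => m; first exact: pow_lip.
apply: le_trans (pow_lip m.+1 b1 xb yb); rewrite NegzE -!exprnN.
have nz (z : C) : 1 <= cabs z -> z ^+ m.+1 != 0 /\ 1 <= cabs (z ^+ m.+1).
  move=> z1; rewrite cabsX exprn_ege1 // expf_neq0 // -cabs_eq0 gt_eqF //.
  exact: lt_le_trans z1.
have [[x0 xl] [y0 yl]] := (nz _ x1, nz _ y1).
have -> : x ^- m.+1 - y ^- m.+1 = (y ^+ m.+1 - x ^+ m.+1) / (x ^+ m.+1 * y ^+ m.+1).
  by field; rewrite x0 y0.
rewrite cabsM cabsV cabsB ler_pdivrMr; last by rewrite cabsM mulr_gt0 // (lt_le_trans ltr01).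
by rewrite ler_peMr ?cabs_ge0 // cabsM mulr_ege1.
Qed.

Variables (t0 s : 'rV[C]_r) (x1 : R).
Hypotheses (tt0 : torus t0) (ts : torus s) (x11 : 1 < x1).

(** The exponents m_j are integers, so det H is a Laurent polynomial in xi along the curve, nonzero
    at xi = 1, and the certificate chosen at t0 serves everywhere off its zeros. They are chosen so
    that for |xi| = x1 the curve comes within a factor x1 of s. As 1 <= |xi| <= x1, a monomial is
    bounded by the sum of its moduli at the two ends. *)
Lemma ray_path : good al ac Q t0 -> exists gam : R -> 'rV[C]_r,
  [/\ gam 1 = t0,
      (forall u, 0 <= u <= 1 -> torus (gam u) /\ good al ac Q (gam u)),
      (forall u, 0 <= u <= 1 -> forall e : R, 0 < e -> exists del : R, 0 < del /\
        forall u', 0 <= u' <= 1 -> `|u' - u| < del -> polydisc (gam u) e (gam u')),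
      (forall j, x1^-1 * cabs (s 0 j) <= cabs (gam 0 0 j) <= x1 * cabs (s 0 j)) &
      (forall u, 0 <= u <= 1 -> forall k,
         cabs (mono (gam u) k) <= cabs (mono t0 k) + cabs (mono (gam 0) k))].
Proof.
move=> [K [H [hc hu]]]; have x10 : 0 < x1 by apply: lt_trans x11.
have /choice[m hm] : forall j, exists m : int, x1^-1 * (cabs (s 0 j) / cabs (t0 0 j)) <= x1 ^ m <= x1 * (cabs (s 0 j) / cabs (t0 0 j)).
  by move=> j; apply: log_floor => //; rewrite divr_gt0 // cabs_gt0.
pose g (x : C) : 'rV[C]_r := \row_j (t0 0 j * x ^ m j).
have g1 : g 1 = t0 by apply/rowP => j; rewrite mxE exp1rz mulr1.
have glip X Y j : 1 <= cabs X <= x1 -> 1 <= cabs Y <= x1 ->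
    cabs (g X 0 j - g Y 0 j) <= cabs (t0 0 j) * ((absz (m j))%:R * x1 ^+ absz (m j) * cabs (X - Y)).
  move=> hX hY; have gE x : g x 0 j = t0 0 j * x ^ m j by rewrite mxE.
  rewrite !gE -mulrBr cabsM.
  by rewrite ler_wpM2l ?cabs_ge0 //; exact: powz_lip.
have gmono X Y k : 1 <= cabs X <= x1 -> cabs Y = x1 ->
    cabs (mono (g X) k) <= cabs (mono t0 k) + cabs (mono (g Y) k).
  move=> /andP[h1 h2] h3; have h0 : 0 < cabs X by apply: lt_le_trans h1.
  have gk x : x != 0 -> mono (g x) k = mono t0 k * x ^ (\sum_j m j * k 0 j).
    move=> x0; rewrite /mono (big_morph _ (fun a b => expfzDr a b x0) (expr0z x)) -big_split /=.
    by apply: eq_bigr => j _; rewrite mxE expfzMl exprz_exp.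
  have X0 : X != 0 by rewrite -cabs_eq0 gt_eqF.
  have Y0 : Y != 0 by rewrite -cabs_eq0 h3 gt_eqF.
  rewrite (gk X X0) (gk Y Y0) !cabsM !cabsXz h3; set e := \sum_j _.
  rewrite -{2}[cabs (mono t0 k)]mulr1 -mulrDr ler_wpM2l ?cabs_ge0 //.
  case: e => l.
    rewrite -!exprnP; apply: le_trans (_ : x1 ^+ l <= _); last by rewrite lerDr.
    by apply: lerXn2r; rewrite ?nnegrE ?cabs_ge0 // ltW.
  rewrite !NegzE -!exprnN; apply: le_trans (_ : 1 <= _).
    by rewrite invf_le1 ?exprn_gt0 // exprn_ege1.
  by rewrite lerDl invr_ge0 exprn_ge0 // ltW.
have gl : lpoly (fun x => \det (hmat H (g x))).
  rewrite /determinant; apply: lpoly_sum => p; apply: lpolyM; first exact: lpoly_cst.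
  apply: lpoly_prod => i; under eq_fun do rewrite mxE.
  rewrite /hev; apply: lpoly_sum => e; apply: lpolyM; first exact: lpoly_cst.
  apply: lpoly_prod => j; under eq_fun do rewrite mxE.
  by apply: lpolyM; [exact: lpoly_cst | exact: lpolyXz].
have [|rs hrs] := lpoly_roots gl.
  by rewrite g1; move: hu; rewrite unitmxE unitfE.
have [y [y1 hy]] := turn_avoid rs x11.
pose xi1 := turn x1 y; have xi1E : cabs xi1 = x1 by rewrite cabs_turn // ltW.
pose xi (u : R) : C := 1 + ((1 - u)%:C)%C * (xi1 - 1).
have xi_1 : xi 1 = 1 by rewrite /xi subrr mul0r addr0.
have xi_0 : xi 0 = xi1 by rewrite /xi subr0 mul1r addrC subrK.
have xib u : 0 <= u <= 1 -> 1 <= cabs (xi u) <= x1.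
  move=> /andP[u0 u1]; apply/andP; split.
    apply: le_trans (Re_le_cabs _); rewrite /xi /=.
    have -> : 1 + ((1 - u) * (complex.Re xi1 - 1) - 0 * (complex.Im xi1 - 0)) = 1 + (1 - u) * (complex.Re xi1 - 1) by ring.
    by apply: le_trans (ler_norm _); rewrite lerDl mulr_ge0 ?subr_ge0.
  have -> : xi u = (u%:C)%C + ((1 - u)%:C)%C * xi1.
    have e : ((1 - u)%:C)%C = 1 - (u%:C)%C by rewrite rmorphB.
    by rewrite /xi e; ring.
  apply: le_trans (ler_cabsD _ _) _; rewrite cabsM !cabs_real xi1E !ger0_norm ?subr_ge0 //.
  have : 0 <= u * (x1 - 1) by rewrite mulr_ge0 // subr_ge0 ltW.
  by lra.
have xi0 u : 0 <= u <= 1 -> xi u != 0.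
  by move=> /xib /andP[h _]; rewrite -cabs_eq0 gt_eqF // (lt_le_trans ltr01).
exists (fun u => g (xi u)); split.
- by rewrite xi_1.
- move=> u hu'; split; first by move=> j; rewrite mxE mulf_neq0 // ?tt0 // expfz_neq0 // xi0.
  exists K, H; split=> //; case: (eqVneq u 1) => [->|u1]; first by rewrite xi_1 g1.
  rewrite unitmxE unitfE; apply/eqP => /(hrs _ (xi0 _ hu')); apply/negP/hy.
  by case/andP: hu' => u0 u1'; rewrite subr_gt0 lt_neqAle u1 u1' lerBlDr lerDl.
- move=> u hu' e e0.
  pose L : R := 1 + \sum_j cabs (t0 0 j) * ((absz (m j))%:R * x1 ^+ absz (m j) * cabs (xi1 - 1)).
  have Lj j : 0 <= cabs (t0 0 j) * ((absz (m j))%:R * x1 ^+ absz (m j) * cabs (xi1 - 1)).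
    by rewrite !mulr_ge0 ?cabs_ge0 // exprn_ge0 // ltW.
  have L0 : 0 < L by rewrite ltr_pwDl // sumr_ge0.
  exists (e / L); split; first by rewrite divr_gt0.
  move=> u' hu'' hd j.
  apply: le_lt_trans (_ : L * `|u' - u| < e); last by rewrite mulrC -ltr_pdivlMr.
  apply: le_trans (glip (xi u') (xi u) j (xib _ hu'') (xib _ hu')) _.
  have -> : xi u' - xi u = ((u - u')%:C)%C * (xi1 - 1).
    have e1 : ((u - u')%:C)%C = (((1 - u')%:C)%C - ((1 - u)%:C)%C) by rewrite -rmorphB; congr (_%:C)%C; ring.
    by rewrite /xi e1; ring.
  rewrite cabsM cabs_real distrC [X in _ * (_ * X)]mulrC !mulrA ler_wpM2r //.
  rewrite -!mulrA mulrA /L (bigD1 j) // addrCA -[leLHS]addr0 !mulrA lerD //.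
  by rewrite addr_ge0 // sumr_ge0 // => i _; exact: Lj.
- move=> j; rewrite xi_0 mxE cabsM cabsXz xi1E.
  have := hm j; have tj : 0 < cabs (t0 0 j) by rewrite cabs_gt0.
  by rewrite !mulrA ler_pdivrMr // ler_pdivlMr // [cabs (t0 0 j) * _]mulrC.
move=> u hu' k.
apply: gmono; first exact: xib.
by rewrite xi_0.
Qed.
End RayPath.

(** * The family of diagonals of the given expansion *)

Section Laurent.
Variable R : realType.
Local Notation C := R[i].
Variables (n r : nat) (A : seq 'rV[int]_n) (a : 'rV[int]_n -> C)
  (B : seq 'rV[int]_n) (b : 'rV[int]_n -> C) (E : set 'rV[R]_n) (c : 'rV[int]_n -> C)
  (Q : 'M[int]_(r, n)).

Lemma lpeval_expo z : lpeval A a z = \sum_i coefA a i * mono z (@expo n A i).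
Proof. by rewrite /lpeval (big_nth 0) big_mkord. Qed.

(** A single torus over a point of [E] suffices: the given expansion and the one built from f^(-1)
    have the same sum on it, so [coef_unique] identifies them. *)
Lemma laurent_powers : amoeba_complement_component A a E -> laurent_expansion A a B b E c ->
  exists (z0 : 'rV[C]_n) (sg : R) (w : nat -> 'rV[int]_n -> C), [/\ torus z0, 1 < sg,
    (forall k, wsm z0 sg (w k)) /\ (forall k g, w k g = \sum_i coefA a i * w k.+1 (g - @expo n A i)),
    (forall x k g, dotv g x * w k g = - (k%:R * \sum_i dotv (@expo n A i) x * coefA a i * w k.+1 (g - @expo n A i))) &
    forall g, c g = \sum_(be <- B) b be * w 1%N (g - be)].
Proof.
move=> [x [xA EE]] hc.
pose z0 : 'rV[C]_n := \row_j ((expR (x 0 j))%:C)%C.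
have z0E j : cabs (z0 0 j) = expR (x 0 j) by rewrite mxE cabs_real gtr0_norm ?expR_gt0.
have z00 : torus z0 by move=> j; rewrite -cabs_eq0 z0E gt_eqF ?expR_gt0.
have Lz (z : 'rV[C]_n) : (forall j, cabs (z 0 j) = cabs (z0 0 j)) -> Lambda z = x.
  by move=> h; apply/rowP => j; rewrite mxE h z0E expRK.
have fn (z : 'rV[C]_n) : (forall j, cabs (z 0 j) = cabs (z0 0 j)) -> lpeval A a z != 0.
  move=> h; apply/eqP => e; apply: xA; exists z; split=> //; last by rewrite Lz.
  exact (torus_same z00 h).
have Ex : E x by rewrite EE; exact: connected_component_refl.
have [e e0 he] := torus_min z00 fn.
have [|sg sg1 [w [w0 w1 w2 w3]]] := @powers R n _ (@expo n A) (coefA a) z0 e z00 e0.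
  by move=> z /he; rewrite lpeval_expo.
exists z0, sg, w; split=> //.
  split=> // k g; rewrite -{1}(w2 k) //.
suff -> : c = fun g => \sum_(be <- B) b be * w 1%N (g - be) by [].
apply: (coef_unique z00) => z z1; have tz := torus_same z00 z1.
exists (lpeval B b z / lpeval A a z); split; first by apply: hc => //; rewrite Lz.
have s1 := csumP (wsm_val1 z00 (ltW sg1) z1 (w1 1%N)).
have v1 : lpeval A a z * csum (fun g => w 1%N g * mono z g) = 1.
  rewrite lpeval_expo -(abs_sumE (opl_val (coefA a) (@expo n A) tz s1)) w2 w0.
  transitivity (csum (fun g : 'rV[int]_n => if g == 0 then 1 else 0 : C)); last exact: abs_sumE (abs_sum1 _ _).
  congr csum; apply/funext => g; case: eqP => [->|_]; by rewrite ?mono0 ?mulr1 ?mul0r.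
have -> : lpeval B b z / lpeval A a z = \sum_(be <- B) b be * mono z be * csum (fun g => w 1%N g * mono z g).
  by rewrite -mulr_suml; congr (_ * _); apply: (mulfI (fn _ z1)); rewrite v1 divff ?fn.
have := abs_sum_sum B (P := xpredT) (fun be _ => abs_sumZ (b be * mono z be) (rV_shift_abs_sum (- be) s1)).
congr abs_sum; apply/funext => g; rewrite mulr_suml; apply: eq_bigr => be _.
rewrite monoB //; field; exact: mono_neq0.
Qed.

Lemma laurent_family : (forall k : 'rV[int]_r, k *m Q = 0 -> k = 0) ->
  amoeba_complement_component A a E -> laurent_expansion A a B b E c ->
  exists (s : 'rV[C]_r) (tau : R) (Y : nat -> 'rV[int]_n -> 'rV[int]_r -> C),
    [/\ torus s, 1 < tau, (forall k be, wsm s tau (Y k be)), diag_rel (@expo n A) (coefA a) Q 0 Y &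
        comb B b Y = diag_coef c Q].
Proof.
move=> Qinj hE hc; have [z0 [sg [w [z00 sg1 [w1 w2] w3 w4]]]] := laurent_powers hE hc.
have sg0 : 0 < sg by apply: lt_trans sg1.
have [S hS] := lattice_nrm Qinj.
(* This amounts to tau^S <= sg, so that by [lattice_nrm] the weight tau on Z^r is dominated by the
   weight sg on the sublattice. *)
have [|tau tau1 htau] := @small_base R sg^-1 S; first by rewrite invr_ge0 (ltW sg0) invf_lt1.
have tau0 : 0 < tau by apply: lt_trans tau1.
have {}htau : tau ^+ S <= sg by move: htau; rewrite mulrC ltr_pdivrMr // mul1r => /ltW.
pose s : 'rV[C]_r := \row_j mono z0 (row j Q).
(* Level k stands for f^(-k-1), whence [k.+1]. *)
exists s, tau, (fun k be l => w k.+1 (l *m Q - be)); split=> //.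
- exact: row_torus.
- move=> k be; have hi : injective (fun l : 'rV[int]_r => l *m Q).
    move=> l l' /eqP; rewrite -subr_eq0 -mulmxBl => /eqP /Qinj /eqP.
    by rewrite subr_eq0 => /eqP.
  have := abs_summable_inj hi (wsm_shift z00 be (ltW sg1) (w1 k.+1)).
  apply: abs_summable_le1 => l /=; rewrite [leLHS]cabsM [leRHS]cabsM ler_wpM2l ?cabs_ge0 //.
  rewrite !cabs_wt ?(ltW sg0) ?(ltW tau0) // -mono_mulmx // ler_wpM2l ?cabs_ge0 //.
  apply: le_trans (_ : tau ^+ (S * nrm (l *m Q)) <= _).
    by apply: ler_weXn2l (hS l); exact: ltW.
  by rewrite exprM; apply: lerXn2r; rewrite ?nnegrE ?exprn_ge0 // ltW.
- split.
  + move=> k be j l; rewrite mxE mul0r add0r mulmxBl -rowE opprD addrA addrAC.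
    by [].
  + by move=> k be l; rewrite {1}w2; apply: eq_bigr => i _; rewrite opprD addrA.
  move=> x k be l.
  transitivity (dotv (l *m Q) x * w k.+1 (l *m Q - be)).
    rewrite /dotv mulr_suml; under [RHS]eq_bigr do rewrite mxE rmorph_sum !mulr_suml.
    rewrite exchange_big /=; apply: eq_bigr => j _.
    rewrite /er mxE !mul0r add0r mulr_suml; apply: eq_bigr => i _.
    by rewrite !mxE rmorphM; ring.
  have -> : dotv (l *m Q) x = dotv be x + dotv (l *m Q - be) x.
    rewrite /dotv -big_split; apply: eq_bigr => i _ /=.
    by rewrite [((l *m Q)%R - be) 0 i]mxE [(- be) 0 i]mxE rmorphB mulrBl addrC subrK.
  rewrite mulrDl w3; congr (_ - (_ * _)); apply: eq_bigr => i _.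
  by rewrite opprD addrA.
by apply/funext => l; rewrite /comb /diag_coef w4.
Qed.
End Laurent.

(** * Germs at [t0] and the conclusion *)

Section Start.
Variable R : realType.
Local Notation C := R[i].
Variables (n r N : nat) (al : 'I_N -> 'rV[int]_n) (ac : 'I_N -> C) (Q : 'M[int]_(r, n)).
Hypothesis dual : exists U : 'I_r -> 'cV[C]_n, forall j j', dotv (row j Q) (U j') = (j == j')%:R.
Hypothesis r0 : (0 < r)%N.
Variables (B : seq 'rV[int]_n) (b : 'rV[int]_n -> C).

Lemma start_family (s t0 : 'rV[C]_r) (tau taud : R) Y :
  torus s -> 1 < tau -> (forall k be, wsm s tau (Y k be)) -> diag_rel al ac Q 0 Y ->
  torus t0 -> 1 < taud -> wsm t0 taud (comb B b Y) -> good al ac Q t0 ->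
  exists Y0, [/\ diag_rel al ac Q t0 Y0, (forall k be, nnsupp (Y0 k be)) &
    comb B b Y0 = Rec t0 (comb B b Y)].
Proof.
move=> ts tau1 hY Yr tt taud1 hd gt0.
(* The margin tau is split: one factor x1 to pass from the torus of s to the end of the curve, the
   other kept as margin there. *)
pose x1 := Num.sqrt tau; have x11 : 1 < x1 by rewrite -sqrtr1 ltr_sqrt // (lt_trans _ tau1).
have x10 : 0 < x1 by apply: lt_trans x11.
have xx : x1 * x1 <= tau by rewrite -expr2 sqr_sqrtr // (le_trans _ (ltW tau1)).
have [g [g1 gg gc gs gm]] := ray_path tt ts x11 gt0.
have i0 : 0 <= (0 : R) <= 1 by rewrite lexx ler01.
have i1 : 0 <= (1 : R) <= 1 by rewrite lexx ler01.
have tg0 := (gg _ i0).1.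
have hY1 k be : wsm (g 0) x1 (Y k be) by apply: (wsm_move ts tg0 (ltW x11) (ltW x10) xx gs).
have hd1 : wsm (g 0) x1 (comb B b Y) by apply: wsm_sum => be; apply: wsmZ.
pose t3 := Num.min taud x1; have t31 : 1 < t3 by rewrite lt_min taud1.
have t30 : 0 < t3 by apply: lt_trans t31.
(* Monomials on the curve are dominated by those at its two ends, where the combined series
   converges with margin at least [t3]. *)
have hdu u : 0 <= u <= 1 -> wsm (g u) t3 (comb B b Y).
  move=> hu; have [M hM] := hd; have [M' hM'] := hd1; exists (M + M') => sq us.
  apply: le_trans (lerD (hM _ us) (hM' _ us)); rewrite -big_split; apply: ler_sum => k _ /=.
  rewrite [leLHS]cabsM [X in _ <= X + _]cabsM [X in _ <= _ + X]cabsM -mulrDr ler_wpM2l ?cabs_ge0 //.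
  rewrite !cabs_wt ?(ltW t30) ?(ltW x10) ?(le_trans ler01 (ltW taud1)) //.
  apply: le_trans (_ : (cabs (mono t0 k) + cabs (mono (g 0) k)) * t3 ^+ nrm k <= _).
    by rewrite ler_wpM2r ?exprn_ge0 ?gm // ltW.
  rewrite mulrDl; apply: lerD; rewrite ler_wpM2l ?cabs_ge0 //; apply: lerXn2r; rewrite ?nnegrE ?(ltW t30) ?(ltW x10) ?(le_trans ler01 (ltW taud1)) //.
    by rewrite /t3 ge_min lexx.
  by rewrite /t3 ge_min lexx orbT.
have [h1 h10 hr] := wsm_recable_near tg0 x11.
have rY k be : recable (g 0) h1 (Y k be).
  by apply: hr => // [j|]; [rewrite subrr cabs0 ltW | exact: ltW].
(* The combined germ stays the Taylor germ of the Laurent series; at time 1 this is the required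
   equality at t0. *)
pose Ex u v := v = Rec (g u) (comb B b Y).
have Ex_loc u : 0 <= u <= 1 -> exists eta h1 : R, [/\ 0 < eta, 0 < h1 &
  forall s1 s2, 0 <= s1 <= 1 -> 0 <= s2 <= 1 -> `|s1 - u| < eta -> `|s2 - u| < eta ->
  forall v (h : R), 0 < h -> (forall j, cabs ((g s2 - g s1) 0 j) + h <= h1) ->
    recable (g s2 - g s1) h v -> Ex s1 v -> Ex s2 (Rec (g s2 - g s1) v)].
  move=> hu; have [h2 h20 hr2] := wsm_recable_near (gg _ hu).1 t31.
  have [eta [eta0 he]] := gc _ hu _ h20.
  exists eta, h2; split; [exact: eta0 | exact: h20 |] => s1 s2 a1 a2 n1 n2 v h h0 hh rc; rewrite /Ex => vE.
  have hh2 : h <= h2 by apply: le_trans (hh (Ordinal r0)); rewrite lerDr cabs_ge0.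
  rewrite vE in rc *.
  have e2 : g s1 + (g s2 - g s1) = g s2 by rewrite addrC subrK.
  rewrite -[in RHS]e2; apply: (Rec_Rec h0 h20 hh); last 2 first.
  - exact: rc.
  - by rewrite e2; apply: hr2 hh2 _ (hdu _ hu); [move=> j; exact/ltW/he | exact: ltW].
  by apply: hr2 (lexx _) _ (hdu _ hu); [move=> j; exact/ltW/he | exact: ltW].
have [|ys [y0 yS _ _]] := @family_lift R n r N al ac Q dual B b g gc gg Ex Ex_loc (fun k be => Rec (g 0) (Y k be)).
  split.
  - have := diag_rel_Rec (w := 0) (v := g 0) (fun k be => recable_shift_ok (ltW h10) (rY k be))
        (fun k be l => Rec_psm l h10 (rY k be)) Yr.
    by rewrite add0r.
  - by move=> k be l j; exact: Rec_neg.
  exact: comb_Rec h10 rY.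
have [z1 z2 z3] := yS _ i1.
exists (ys 1); rewrite /Ex g1 in z3; rewrite g1 in z1.
by split; [exact: z1 | exact: z2 | exact: z3].
Qed.
End Start.

Theorem theorem1 (R : realType) (n r : nat)
    (A : seq 'rV[int]_n) (a : 'rV[int]_n -> R[i])
    (B : seq 'rV[int]_n) (b : 'rV[int]_n -> R[i])
    (E : set 'rV[R]_n) (c : 'rV[int]_n -> R[i])
    (Q : 'M[int]_(r, n)) (t0 : 'rV[R[i]]_r) (gam : R -> 'rV[R[i]]_r) :
  (1 <= n)%N -> (1 <= r <= n)%N ->
  uniq A -> (forall al, al \in A -> a al != 0) ->
  newton_nondegenerate A a ->
  lp_coprime (lpeval A a) (lpeval B b) ->
  amoeba_complement_component A a E ->
  laurent_expansion A a B b E c ->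
  saturated_lattice Q ->
  conv_domain (diag_coef c Q) t0 ->
  path_in gam (torus (n := r) `\` Lset A a Q) ->
  gam 0 = t0 ->
  continues_along (diag_coef c Q) gam.
Proof.
move=> _ /andP[r0 _] _ _ _ _ hE hc [Qinj _] hd [gL gc] g0.
have dual := lattice_dual R Qinj.
have [s [tau [Y [ts tau1 hY Yr dE]]]] := laurent_family Qinj hE hc.
have [tt [taud taud1 wd]] := wsm_of_conv hd.
have gg u : 0 <= u <= 1 -> torus (gam u) /\ good (@expo n A) (coefA a) Q (gam u).
  by move=> /gL[h1 h2]; split => //; exact: good_notin_Lset.
have i0 : 0 <= (0 : R) <= 1 by rewrite lexx ler01.
have gt0 := (gg _ i0).2; rewrite g0 in gt0.
rewrite -dE in wd; have [Y0 [z1 z2 z3]] := start_family dual r0 ts tau1 hY Yr tt taud1 wd gt0.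
have [h h0 hr] := wsm_recable_near tt taud1.
rewrite dE in z3 wd.
apply: (continues_of_family dual gc gg h0 (Y0 := Y0)); rewrite ?g0 //.
- by apply: hr wd => // [j|]; [rewrite subrr cabs0 ltW | exact: ltW].
- exact: z3.
Qed.
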